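(* Let $f:\mathbb{R}^2\to\mathbb{R}$ satisfy assumptions (S), (UC), (C2), (N), (FSP) listed in the context, with associated constants $u_+<u_-$. Let $x_-<x_+$ be real numbers and let $u_0\in L^\infty(\mathbb{R})$ satisfy $u_0(x)=u_-$ for $x<x_-$ and $u_0(x)=u_+$ for $x>x_+$. Let $u$ be the entropy solution of $u_t+f(x,u)_x=0$, $u(x,0)=u_0(x)$. Then there exist $X\in\mathbb{R}$ and a finite $T>0$ such that for all $t>T$ $$u(x,t)=\begin{cases}u_-&\text{if }x<X+\sigma(t-T),\\ u_+&\text{if }x>X+\sigma(t-T),\end{cases}\qquad \sigma=\frac{f(u_-)-f(u_+)}{u_--u_+}.$$
   Context: Assumptions on the flux $f=f(x,u)$: (S) there are real numbers $u_+<u_-$ with $f_x(\cdot,u_\pm)\equiv0$; $f(u_\pm)$ denotes the constant value of $f(\cdot,u_\pm)$. (UC) $f_{uu}\ge\alpha$ on $\mathbb{R}^2$ for some constant $\alpha>0$. (C2) $f\in C^2(\mathbb{R}^2;\mathbb{R})$. (N) there is $N\in C([0,\infty);\mathbb{R})$ with $\lim_{y\to\infty}N(y)/y=\infty$ and $|f(x,u)|\ge N(|u|)$ for all $x,u\in\mathbb{R}$. (FSP) $\theta(v)=\sup_{x\in\mathbb{R}}|f_u(x,v)|$ is finite for every $v$ and $\theta\in C(\mathbb{R})$. Entropy solution: for $u_0\in L^\infty(\mathbb{R})$, the entropy solution is the (unique) bounded weak solution $u$ such that for every convex entropy $\eta$, every $Q(x,u)$ with $Q(x,\cdot)$ an antiderivative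 of $\eta'(\cdot)f_u(x,\cdot)$ for each $x$, and every smooth nonnegative $\varphi$ compactly supported in $\mathbb{R}\times[0,\infty)$, $$\iint\big(\eta(u)\varphi_t+Q(x,u)\varphi_x\big)\,dx\,dt+\int\eta(u_0)\varphi(x,0)\,dx\ge\iint\varphi\,\big(\eta'(u)f_x(x,u)-Q_x(x,u)\big)\,dx\,dt,$$ where $Q_x(x,u)$ in the right-hand integral is the partial derivative in the first variable. When $f$ satisfies (S), (UC), (C2), (N) and (FSP), the Cauchy problem $u_t+f(x,u)_x=0$, $u(x,0)=u_0(x)$ is well posed in $L^\infty$, and at every time $t>0$ the left and right spatial traces $u(x\pm,t)$ exist at every $x$, with $u(x-,t)\ge u(x+,t)$. Equalities for $u_0$ and $u(\cdot,t)$ are understood almost everywhere in $x$. *)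

(* Defs.v *)
From HB Require Import structures.
From mathcomp Require Import all_boot all_order all_algebra.
From mathcomp Require Import all_classical all_reals all_analysis.

Set Implicit Arguments.
Unset Strict Implicit.
Unset Printing Implicit Defensive.

Import Order.TTheory GRing.Theory Num.Theory.
Import numFieldNormedType.Exports.

Local Open Scope classical_set_scope.
Local Open Scope ring_scope.

(* A function of two real variables is curried: [g x u] or [g x t]. *)
Section plane_functions.
Context {R : realType}.
Implicit Types g : R -> R -> R.

Definition d1 g : R -> R -> R := fun x y => derive1 (g ^~ y) x.
Definition d2 g : R -> R -> R := fun x y => derive1 (g x) y.

Definition jointly_continuous g := continuous (fun p : R * R => g p.1 p.2).

(* C^n on the whole plane: all iterated partial derivatives up to order n
   exist and are jointly continuous. *)
Fixpoint Ck (n : nat) g : Prop :=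
  jointly_continuous g /\
  if n is m.+1 then
    [/\ forall x y, derivable (g ^~ y) x 1,
        forall x y, derivable (g x) y 1,
        Ck m (d1 g) & Ck m (d2 g)]
  else True.

Definition smooth g := forall n, Ck n g.

End plane_functions.

Section flux.
Context {R : realType}.
Variables (f : R -> R -> R) (up um : R).

Definition stationary_states :=
  [/\ up < um, forall x, d1 f x up = 0 & forall x, d1 f x um = 0].

Definition uniformly_convex_flux :=
  exists2 alpha : R, 0 < alpha & forall x u, alpha <= d2 (d2 f) x u.

Definition superlinear_flux := exists N : R -> R,
  [/\ {within `[0, +oo[, continuous N},
      N y / y @[y --> +oo%R] --> +oo%R &
      forall x u, N `|u| <= `|f x u|].

Definition max_speed (v : R) : R := sup (range (fun x => `|d2 f x v|)).

(* The first clause says that the supremum is finite: [sup] is a junk value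
   on unbounded sets. *)
Definition finite_speed :=
  (forall v, has_ubound (range (fun x => `|d2 f x v|))) /\
  continuous max_speed.

Record flux_assumptions : Prop := FluxAssumptions {
  flux_S : stationary_states ;
  flux_UC : uniformly_convex_flux ;
  flux_C2 : Ck 2 f ;
  flux_N : superlinear_flux ;
  flux_FSP : finite_speed }.

(* [f ^~ um] and [f ^~ up] are constant under [stationary_states], so the
   choice of the abscissa 0 is immaterial. *)
Definition shock_speed : R := (f 0 um - f 0 up) / (um - up).

End flux.

Section entropy_solutions.
Context {R : realType}.

Local Notation mu := (@lebesgue_measure R).
Local Notation mu2 := (mu \x mu)%E.

Definition half_plane : set (R * R) := [set p | 0 <= p.2].

(* Test functions on R x [0, +oo[ are restrictions to the half-plane of smooth
   functions on R^2: they need not vanish at t = 0, and what they do for t < 0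
   is irrelevant. *)
Definition test_function (phi : R -> R -> R) :=
  smooth phi /\
  compact (closure [set p : R * R | half_plane p /\ phi p.1 p.2 != 0]).

(* Essentially bounded measurable functions of (x, t) in R x [0, +oo[. *)
Definition Linfty_half_plane (u : R -> R -> R) :=
  ((fun p : R * R => u p.1 p.2) \_ half_plane) \in Lfun mu2 +oo%E.

Definition weak_solution (f : R -> R -> R) (u0 : R -> R) (u : R -> R -> R) :=
  forall phi, test_function phi ->
    \int[mu2]_(p in half_plane)
       (u p.1 p.2 * d2 phi p.1 p.2 + f p.1 (u p.1 p.2) * d1 phi p.1 p.2)
    + \int[mu]_x (u0 x * phi x 0) = 0.

(* [eta] is an entropy with entropy flux [Q].  [Q x] is determined up to an
   additive function of x; the last two conditions make the term Q_x of the
   entropy inequality exist and be continuous. *)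
Definition entropy_pair (f : R -> R -> R) (eta : R -> R) (Q : R -> R -> R) :=
  [/\ convex_function (setT : set R^o) eta,
      forall v, derivable eta v 1,
      forall x v : R, is_derive v (1 : R) (Q x) (derive1 eta v * d2 f x v),
      forall x v, derivable (Q ^~ v) x 1 &
      jointly_continuous (d1 Q)].

Definition entropy_inequality (f : R -> R -> R) (u0 : R -> R)
    (u : R -> R -> R) :=
  forall eta Q phi, entropy_pair f eta Q -> test_function phi ->
    (forall x t, 0 <= t -> 0 <= phi x t) ->
    \int[mu2]_(p in half_plane)
       (phi p.1 p.2 *
          (derive1 eta (u p.1 p.2) * d1 f p.1 (u p.1 p.2) - d1 Q p.1 (u p.1 p.2)))
    <= \int[mu2]_(p in half_plane)
         (eta (u p.1 p.2) * d2 phi p.1 p.2 + Q p.1 (u p.1 p.2) * d1 phi p.1 p.2)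
       + \int[mu]_x (eta (u0 x) * phi x 0).

Record entropy_solution (f : R -> R -> R) (u0 : R -> R) (u : R -> R -> R)
    : Prop := EntropySolution {
  entropy_solution_bounded : Linfty_half_plane u ;
  entropy_solution_weak : weak_solution f u0 u ;
  entropy_solution_entropy : entropy_inequality f u0 u }.

(* Continuity at time t of s |-> u(., s) with values in L^1_loc(R). *)
Definition L1loc_continuous_at (u : R -> R -> R) (t : R) :=
  forall M : R,
    (\int[mu]_(x in `[(- M)%R, M]) (`|u x s - u x t|%R)%:E)%E @[s --> t]
      --> 0%E.

Definition is_shock (um up X : R) (v : R -> R) :=
  {ae mu, forall x, (x < X -> v x = um) /\ (X < x -> v x = up)}.

End entropy_solutions.

(* Main.v *)
Require Import Defs.
From HB Require Import structures.
From mathcomp Require Import all_boot all_order all_algebra.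
From mathcomp Require Import all_classical all_reals all_analysis.
From mathcomp Require Import measurable_realfun ess_sup_inf.
From mathcomp Require Import ring lra.
Set Implicit Arguments.
Unset Strict Implicit.
Unset Printing Implicit Defensive.
Import Order.TTheory GRing.Theory Num.Theory.
Import numFieldNormedType.Exports.
Local Open Scope classical_set_scope.
Local Open Scope ring_scope.

(** Integrate the equation once: a potential [W] with [W_x = u], [W_t = - f(x, u)]
    solves the Hamilton-Jacobi equation [W_t + f(x, W_x) = 0], and its initial value is
    affine with slope [um] left of [xm] and slope [up] right of [xp].  Both stationary
    states give exact affine solutions, [left_state = um x - f(um) t + const] and
    [right_state = up x - f(up) t + const], which coincide on a line of slope
    [shock_speed f up um].  The theorem amounts to [W = min(left_state, right_state)]
    after a finite time: differentiating in [x] gives the shock.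

    Upper bound.  Convexity puts [f] above its tangent at [um], so [W - left_state] is a
    subsolution of a linear transport equation, of speed [d2 f x um >= shock_speed +
    alpha (um - up) / 2].  It vanishes initially on [x <= xm - 1], hence by the maximum
    principle [W <= left_state] on a half-plane whose edge runs faster than the
    shock; symmetrically for [right_state] ([upper_left], [upper_right]).  From some time
    on, these two regions cover the two sides of the shock.

    Lower bound.  Here the entropy condition is needed.  Three affine barriers are placed
    under [W]: the two states, lowered a little and decreasing at an extra rate [eps],
    and a third one, of intermediate slope [m = (up + um) / 2], whose descent is slower
    than that of the average of the two states by [c = alpha (um - up)^2 / 16].
    One entropy, Kruzhkov-like with kinks at [m], [um] and [up], has the right sign at
    all three ([kruzhkov_fast], [kruzhkov_slow], [kruzhkov_mid]).  Testing the entropy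
    inequality with a function of [sum_i exp((W - A_i) / tau)] that vanishes where this sum
    exceeds 1 shows that [W] cannot be below all barriers [A_i] by a fixed margin
    ([total_excess_integral], [lower_bound]).  The third barrier starts far below, but
    after a finite time it is above the average of the two states, hence above
    their minimum.

    In place of [W] itself, the argument uses smooth potentials of mollified solutions
    ([near_potential_exists]); the inequalities hold up to errors that vanish with the
    mollification, and [potential_limit] states the resulting convergence.

    Conclusion.  On a rectangle where [W] tends to the affine function of slope [um], uniform
    convexity bounds the integral of [(u - um)^2] by that of [f(x, u) - f(um) -
    d2 f x um (u - um)], which is a boundary term in [W - left_state] and tends to 0
    ([constant_on_rect]).  So [u = um] almost everywhere left of the shock line, and
    [u = up] right of it; Fubini's theorem gives almost every time slice, and the slices
    at times of continuity are limits of these. *)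

(** * One-variable calculus *)

Section mean_value.
Context {R : realType}.
Implicit Types (h dh : R -> R) (a b c C : R).

Lemma derive_range h dh a b : a <= b ->
  (forall x, a <= x <= b -> is_derive x 1 h (dh x)) ->
  exists2 c, a <= c <= b & h b - h a = dh c * (b - a).
Proof.
move=> ab hd.
have hd' x : x \in `]a, b[ -> is_derive x 1 h (dh x).
  by rewrite in_itv/= => /andP[/ltW ax /ltW xb]; apply: hd; rewrite ax.
have [|c cab E] := MVT_segment ab hd'; last by exists c; rewrite // -in_itv.
apply: derivable_within_continuous => x; rewrite in_itv/= => /hd xab.
exact: ex_derive.
Qed.

Lemma derive_le h dh a b C : a <= b ->
  (forall x, a <= x <= b -> is_derive x 1 h (dh x)) ->
  (forall x, a <= x <= b -> dh x <= C) -> h b - h a <= C * (b - a).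
Proof.
move=> ab hd hC; have [c cab ->] := derive_range ab hd.
by apply: ler_wpM2r; rewrite ?subr_ge0// hC.
Qed.

Lemma derive_ge h dh a b C : a <= b ->
  (forall x, a <= x <= b -> is_derive x 1 h (dh x)) ->
  (forall x, a <= x <= b -> C <= dh x) -> C * (b - a) <= h b - h a.
Proof.
move=> ab hd hC; have [c cab ->] := derive_range ab hd.
by apply: ler_wpM2r; rewrite ?subr_ge0// hC.
Qed.

Lemma derive_norm_le h dh a b C :
  (forall x : R, is_derive x 1 h (dh x)) ->
  (forall x, Num.min a b <= x <= Num.max a b -> `|dh x| <= C) ->
  `|h b - h a| <= C * `|b - a|.
Proof.
move=> hd; wlog ab : a b / a <= b => [wlg hC|].
  have /orP[ab|ba] := le_total a b; first exact: wlg.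
  by rewrite distrC (distrC b); apply: wlg => // x; rewrite minC maxC; exact: hC.
rewrite min_l// max_r// => hC.
have [c cab ->] := derive_range ab (fun x _ => hd x).
by rewrite normrM ler_wpM2r// hC.
Qed.

Lemma derive0_cst h : (forall x : R, is_derive x 1 h 0) -> forall a b, h a = h b.
Proof. by move=> hd a b; apply: is_derive_0_is_cst. Qed.

End mean_value.

Section derivation_rules.
Context {R : realType}.
Implicit Types (h k : R -> R) (x a b c : R).

Lemma derD h k x a b : is_derive x 1 h a -> is_derive x 1 k b ->
  is_derive x 1 (fun s => h s + k s) (a + b).
Proof. exact: is_deriveD. Qed.

Lemma derN h x a : is_derive x 1 h a -> is_derive x 1 (fun s => - h s) (- a).
Proof. exact: is_deriveN. Qed.

Lemma derB h k x a b : is_derive x 1 h a -> is_derive x 1 k b ->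
  is_derive x 1 (fun s => h s - k s) (a - b).
Proof. exact: is_deriveB. Qed.

Lemma derM h k x a b : is_derive x 1 h a -> is_derive x 1 k b ->
  is_derive x 1 (fun s => h s * k s) (h x * b + k x * a).
Proof. exact: is_deriveM. Qed.

Lemma derZ c h x a : is_derive x 1 h a -> is_derive x 1 (fun s => c * h s) (c * a).
Proof. exact: is_deriveZ. Qed.

Lemma der_comp h k x a b : is_derive (k x) 1 h a -> is_derive x 1 k b ->
  is_derive x 1 (fun s => h (k s)) (a * b).
Proof. exact: is_derive1_comp. Qed.

Lemma der_cst c x : is_derive x 1 (fun _ : R => c) 0.
Proof. exact: is_derive_cst. Qed.

Lemma der_id x : is_derive x 1 (fun s : R => s) 1.
Proof. exact: is_derive_id. Qed.

Lemma der_eq h x a b : is_derive x 1 h a -> a = b -> is_derive x 1 h b.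
Proof. by move=> + <-. Qed.

(** A derivative from a first-order expansion, for functions defined by integrals. *)
Lemma der_littleo h x L :
  (forall e, 0 < e -> exists2 d, 0 < d &
     forall y, `|y - x| < d -> `|h y - h x - L * (y - x)| <= e * `|y - x|) ->
  is_derive x 1 h L.
Proof.
move=> hL.
have cv : t^-1 *: (h (t *: 1 + x) - h x) @[t --> 0^'] --> L.
  apply/cvgrPdist_le => /= e e0; have [d d0 hd] := hL _ e0.
  near=> t.
  have t0 : t != 0 by near: t; exact: nbhs_dnbhs_neq.
  have td : `|t| < d by near: t; apply: dnbhs0_lt.
  rewrite /GRing.scale/= mulr1.
  have := hd (t + x); rewrite addrK => /(_ td) htx.
  rewrite distrC -(ler_pM2r (_ : 0 < `|t|)) ?normr_gt0//.
  rewrite -normrM mulrBl mulrAC mulVf// mul1r.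
  exact: htx.
apply: DeriveDef; first by apply/cvg_ex; exists L.
exact: (cvg_lim _ cv).
Unshelve. all: by end_near. Qed.

Lemma der_quad h x L C :
  (forall y, `|h y - h x - L * (y - x)| <= C * (y - x) ^+ 2) -> is_derive x 1 h L.
Proof.
move=> hL; apply: der_littleo => e e0.
have C0 : 0 < `|C| + 1 by rewrite ltr_wpDl.
exists (e / (`|C| + 1)); first by rewrite divr_gt0.
move=> y yx; apply: (le_trans (hL y)).
rewrite -real_normK ?num_real// expr2 mulrA ler_wpM2r//.
apply: (@le_trans _ _ ((`|C| + 1) * `|y - x|)).
  by rewrite ler_wpM2r// ler_wpDr// ler_norm.
by rewrite mulrC -ler_pdivlMr// ltW.
Qed.

End derivation_rules.

(** * Functions of class C^k on the plane *)

Section plane.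
Context {R : realType}.
Implicit Types (g k : R -> R -> R).

Lemma d1_derive g x y : derivable (g ^~ y) x 1 -> is_derive x 1 (g ^~ y) (d1 g x y).
Proof. by move=> dg; rewrite /d1 derive1E; exact: derivableP. Qed.

Lemma d2_derive g x y : derivable (g x) y 1 -> is_derive y 1 (g x) (d2 g x y).
Proof. by move=> dg; rewrite /d2 derive1E; exact: derivableP. Qed.

Lemma is_derive_derive1 (h : R -> R) (x dh : R) : is_derive x 1 h dh -> derive1 h x = dh.
Proof. by move=> hd; rewrite derive1E derive_val. Qed.

Lemma jcont_l g y : jointly_continuous g -> continuous (g ^~ y).
Proof.
move=> cg x; apply: (@continuous_comp _ _ _ (fun x => (x, y)) (fun p => g p.1 p.2)); last exact: cg.
exact: (cvg_pair cvg_id (cvg_cst _)).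
Qed.

Lemma jcont_r g x : jointly_continuous g -> continuous (g x).
Proof.
move=> cg y; apply: (@continuous_comp _ _ _ (fun y => (x, y)) (fun p => g p.1 p.2)); last exact: cg.
exact: (cvg_pair (cvg_cst _) cvg_id).
Qed.

Lemma Ck_intro n g g1 g2 : jointly_continuous g ->
  (forall x y : R, is_derive x 1 (g ^~ y) (g1 x y)) ->
  (forall x y : R, is_derive y 1 (g x) (g2 x y)) ->
  Ck n g1 -> Ck n g2 -> Ck n.+1 g.
Proof.
move=> cg h1 h2 c1 c2; split => //; split.
- by move=> x y; exact: ex_derive.
- by move=> x y; exact: ex_derive.
- by rewrite (_ : d1 g = g1)//; apply/funext => x; apply/funext => y; exact: is_derive_derive1.
- by rewrite (_ : d2 g = g2)//; apply/funext => x; apply/funext => y; exact: is_derive_derive1.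
Qed.

Lemma Ck_jcont n g : Ck n g -> jointly_continuous g.
Proof. by case: n => [|n] []. Qed.

Lemma Ck_d1 n g : Ck n.+1 g -> forall x y : R, is_derive x 1 (g ^~ y) (d1 g x y).
Proof. by move=> [_ [h _ _ _]] x y; exact: d1_derive. Qed.

Lemma Ck_d2 n g : Ck n.+1 g -> forall x y : R, is_derive y 1 (g x) (d2 g x y).
Proof. by move=> [_ [_ h _ _]] x y; exact: d2_derive. Qed.

Lemma CkS n g : Ck n.+1 g -> Ck n g.
Proof.
elim: n g => [|n IH] g [cg [h1 h2 c1 c2]]; first by split.
by split; [exact: cg|split; [exact: h1|exact: h2|exact: IH|exact: IH]].
Qed.

Lemma Ck_cst n (c : R) : Ck n (fun _ _ => c).
Proof.
have cc (d : R) : jointly_continuous (fun _ _ : R => d) by move=> p; exact: cvg_cst.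
elim: n c => [|n IH] c; first by split.
apply: (@Ck_intro _ _ (fun _ _ => 0) (fun _ _ => 0)) => // x y.
exact: is_derive_cst.
Qed.

Lemma Ck_fst n : Ck n (fun x _ : R => x).
Proof.
have cc : jointly_continuous (fun x _ : R => x) by move=> p; exact: cvg_fst.
case: n => [|n]; first by split.
apply: (@Ck_intro _ _ (fun _ _ => 1) (fun _ _ => 0)) => //. all: exact (Ck_cst n _).
Qed.

Lemma Ck_snd n : Ck n (fun _ y : R => y).
Proof.
have cc : jointly_continuous (fun _ y : R => y) by move=> p; exact: cvg_snd.
case: n => [|n]; first by split.
apply: (@Ck_intro _ _ (fun _ _ => 0) (fun _ _ => 1)) => //; [|exact: Ck_cst..].
by move=> x y; exact: is_derive_cst.
Qed.

Lemma jcontD g k : jointly_continuous g -> jointly_continuous k ->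
  jointly_continuous (fun x y => g x y + k x y).
Proof. by move=> cg ck p; apply: cvgD; [exact: cg|exact: ck]. Qed.

Lemma jcontM g k : jointly_continuous g -> jointly_continuous k ->
  jointly_continuous (fun x y => g x y * k x y).
Proof. by move=> cg ck p; apply: cvgM; [exact: cg|exact: ck]. Qed.

Lemma CkD n g k : Ck n g -> Ck n k -> Ck n (fun x y => g x y + k x y).
Proof.
elim: n g k => [|n IH] g k cg ck.
  by split => //; exact: (jcontD (Ck_jcont cg) (Ck_jcont ck)).
apply: (@Ck_intro _ _ (fun x y => d1 g x y + d1 k x y) (fun x y => d2 g x y + d2 k x y)).
- by exact: (jcontD (Ck_jcont cg) (Ck_jcont ck)).
- by move=> x y; exact: (derD (Ck_d1 cg x y) (Ck_d1 ck x y)).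
- by move=> x y; exact: (derD (Ck_d2 cg x y) (Ck_d2 ck x y)).
- by apply: IH; [case: cg => _ []|case: ck => _ []].
- by apply: IH; [case: cg => _ []|case: ck => _ []].
Qed.

Lemma CkM n g k : Ck n g -> Ck n k -> Ck n (fun x y => g x y * k x y).
Proof.
elim: n g k => [|n IH] g k cg ck.
  by split => //; exact: (jcontM (Ck_jcont cg) (Ck_jcont ck)).
apply: (@Ck_intro _ _ (fun x y => g x y * d1 k x y + k x y * d1 g x y)
                      (fun x y => g x y * d2 k x y + k x y * d2 g x y)).
- by exact: (jcontM (Ck_jcont cg) (Ck_jcont ck)).
- by move=> x y; exact: (derM (Ck_d1 cg x y) (Ck_d1 ck x y)).
- by move=> x y; exact: (derM (Ck_d2 cg x y) (Ck_d2 ck x y)).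
- by apply: CkD; apply: IH; try exact: CkS; [case: ck => _ []|case: cg => _ []].
- by apply: CkD; apply: IH; try exact: CkS; [case: ck => _ []|case: cg => _ []].
Qed.

Lemma CkN n g : Ck n g -> Ck n (fun x y => - g x y).
Proof.
move=> cg; rewrite (_ : (fun x y => - g x y) = (fun x y => (-1) * g x y)).
  by apply: CkM => //; exact: Ck_cst.
by apply/funext => x; apply/funext => y; rewrite mulN1r.
Qed.

Lemma CkB n g k : Ck n g -> Ck n k -> Ck n (fun x y => g x y - k x y).
Proof. by move=> cg ck; apply: CkD => //; exact: CkN. Qed.

(** A set of functions closed under differentiation consists of functions of
    class C^oo; quantifying over such a set lets the induction on the order of
    differentiation go through the chain rule. *)
Definition derivation_closed (S : set (R -> R)) :=
  forall phi, S phi -> exists2 dphi, S dphi & forall x : R, is_derive x 1 phi (dphi x).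

Lemma Ck_comp (S : set (R -> R)) n phi g : derivation_closed S -> S phi ->
  Ck n g -> Ck n (fun x y => phi (g x y)).
Proof.
move=> cS; have cphi psi : S psi -> continuous psi.
  move=> /cS[dpsi _ h] x; apply: differentiable_continuous.
  by apply/derivable1_diffP; exact: ex_derive.
elim: n phi g => [|n IH] phi g Sphi cg.
  split => // p; apply: (@continuous_comp _ _ _ (fun p : R * R => g p.1 p.2) phi).
    exact: (Ck_jcont cg).
  exact: cphi.
have [dphi Sd hd] := cS _ Sphi.
apply: (@Ck_intro _ _ (fun x y => d1 g x y * dphi (g x y)) (fun x y => d2 g x y * dphi (g x y))).
- move=> p; apply: (@continuous_comp _ _ _ (fun p : R * R => g p.1 p.2) phi).
    exact: (Ck_jcont cg).
  exact: cphi.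
- move=> x y; have := Ck_d1 cg x y; have := hd (g x y) => h1 h2.
  by rewrite mulrC; exact: der_comp h1 h2.
- move=> x y; have := Ck_d2 cg x y; have := hd (g x y) => h1 h2.
  by rewrite mulrC; exact: der_comp h1 h2.
- by apply: CkM; [case: cg => _ []|apply: IH => //; exact: CkS].
- by apply: CkM; [case: cg => _ []|apply: IH => //; exact: CkS].
Qed.

Lemma expR_closed : derivation_closed [set expR].
Proof. by move=> _ ->; exists expR => // x; exact: is_derive_expR. Qed.

Lemma Ck_expR n g : Ck n g -> Ck n (fun x y => expR (g x y)).
Proof. exact: (Ck_comp expR_closed). Qed.

End plane.

(** * A flat function *)

Section flat.
Context {R : realType}.
Implicit Types (p q : {poly R}) (x : R).

Lemma der_horner p x : is_derive x 1 (fun s => p.[s]) (p^`()).[x].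
Proof.
elim/poly_ind: p => [|p c IH].
  rewrite deriv0 horner0 (_ : (fun s => _) = fun=> 0); first exact: der_cst.
  by apply/funext => s; rewrite horner0.
rewrite (_ : (fun s => _) = (fun s => p.[s] * s + c)); last first.
  by apply/funext => s; rewrite hornerMXaddC.
apply: (der_eq (derD (derM IH (der_id x)) (der_cst c x))).
by rewrite derivMXaddC hornerD hornerM hornerX; ring.
Qed.

(** [flat p x] is [p(1/x) exp(-1/x)] extended by 0 to [x <= 0].  The factor
    [p] makes the family closed under differentiation. *)
Definition flat p x := if 0 < x then p.[x^-1] * expR (- x^-1) else 0.

Lemma pow_expRN (n : nat) (y : R) : 0 <= y -> y ^+ n * expR (- y) <= n`!%:R.
Proof.
move=> y0; rewrite expRN ler_pdivrMr ?expR_gt0//.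
case: n => [|n]; first by rewrite expr0 fact0 mul1r (le_trans _ (expR_ge1Dx y))// lerDl.
have := expR_ge1Dxn n y0; have f0 : 0 < n.+1`!%:R :> R by rewrite ltr0n fact_gt0.
move=> /(le_trans _) h; rewrite mulrC -ler_pdivrMr//; apply: h.
by rewrite lerDr.
Qed.

(** Any power of [1/x] is absorbed by [exp(-1/x)]; this gives the derivative at 0. *)
Lemma flat_small p : exists C, forall x, `|flat p x| <= C * x ^+ 2.
Proof.
exists (\sum_(i < size p) `|p`_i| * (i + 2)`!%:R) => x; rewrite /flat.
have C0 : 0 <= \sum_(i < size p) `|p`_i| * (i + 2)`!%:R by apply: sumr_ge0 => i _; rewrite mulr_ge0.
case: ifPn => [x0|_]; last by rewrite normr0 mulr_ge0// sqr_ge0.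
have y0 : 0 < x^-1 by rewrite invr_gt0.
rewrite -[x in _ * x ^+ 2]invrK exprVn ler_pdivlMr ?exprn_gt0//.
rewrite normrM (ger0_norm (expR_ge0 _)) horner_coef.
rewrite -mulrA (@le_trans _ _ ((\sum_(i < size p) `|p`_i * x^-1 ^+ i|) * (expR (- x^-1) * x^-1 ^+ 2)))//.
  by rewrite ler_wpM2r ?mulr_ge0 ?expR_ge0 ?exprn_ge0 ?(ltW y0)//; exact: ler_norm_sum.
rewrite mulr_suml; apply: ler_sum => i _.
rewrite normrM (ger0_norm (exprn_ge0 _ (ltW y0))) -mulrA ler_wpM2l//.
by rewrite (mulrC (expR _)) mulrA -exprD pow_expRN// ltW.
Qed.

Lemma der_flat p x : is_derive x 1 (flat p) (flat ('X ^+ 2 * (p - p^`())) x).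
Proof.
have [x0|x0|->] := ltgtP x 0.
- rewrite [flat _ x](_ : _ = 0); last by rewrite /flat lt_gtF.
  apply: (near_eq_is_derive (f := fun=> 0)).
  near=> y; rewrite /flat lt_gtF//.
  by near: y; exact: lt_nbhsl.
- apply: (near_eq_is_derive (f := fun s : R => p.[s^-1] * expR (- s^-1))).
    near=> y; rewrite /flat ifT//.
    by near: y; exact: lt_nbhsr.
  have xn0 : x != 0 by rewrite gt_eqF.
  have dV : is_derive x 1 (fun s : R => s^-1) (- x ^- 2).
    by apply: (der_eq (is_deriveV xn0 (der_id x))); rewrite /GRing.scale/= mulr1.
  have d1 := der_comp (der_horner p x^-1) dV.
  have d2 := der_comp (h := expR) (k := fun s : R => - s^-1) (is_derive_expR (- x^-1)) (derN dV).
  apply: (der_eq (derM d1 d2)); rewrite /flat x0.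
  by rewrite hornerM hornerXn hornerD hornerN -exprVn; ring.
- rewrite [flat _ 0]/flat ltxx.
  have [C hC] := flat_small p; apply: (der_quad (C := C)) => y.
  by rewrite [flat p 0]/flat ltxx mul0r !subr0.
Unshelve. all: by end_near. Qed.

Lemma flat_closed : derivation_closed (range flat).
Proof.
by move=> _ [p _ <-]; exists (flat ('X ^+ 2 * (p - p^`()))) => [|x]; [exists ('X ^+ 2 * (p - p^`()))|exact: der_flat].
Qed.

Lemma Ck_flat n p g : Ck n g -> Ck n (fun x y => flat p (g x y)).
Proof. by apply: (Ck_comp flat_closed); exists p. Qed.

Definition flatexp x := flat 1 x.
Definition dflatexp x := flat ('X ^+ 2) x.

Lemma der_flatexp x : is_derive x 1 flatexp (dflatexp x).
Proof. by apply: (der_eq (der_flat 1 x)); rewrite derivC subr0 mulr1. Qed.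

Lemma flatexp_le0 x : x <= 0 -> flatexp x = 0.
Proof. by rewrite /flatexp /flat leNgt => /negbTE ->. Qed.

Lemma dflatexp_le0 x : x <= 0 -> dflatexp x = 0.
Proof. by rewrite /dflatexp /flat leNgt => /negbTE ->. Qed.

Lemma flatexpE x : 0 < x -> flatexp x = expR (- x^-1).
Proof. by rewrite /flatexp /flat => ->; rewrite hornerC mul1r. Qed.

Lemma dflatexpE x : 0 < x -> dflatexp x = x ^- 2 * flatexp x.
Proof. by move=> x0; rewrite flatexpE// /dflatexp /flat x0 hornerXn exprVn. Qed.

Lemma flatexp_gt0 x : 0 < x -> 0 < flatexp x.
Proof. by move=> /flatexpE ->; exact: expR_gt0. Qed.

Lemma flatexp_ge0 x : 0 <= flatexp x.
Proof. by have [/flatexp_le0 ->//|/flatexp_gt0/ltW] := leP x 0. Qed.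

Lemma dflatexp_ge0 x : 0 <= dflatexp x.
Proof.
have [/dflatexp_le0 ->//|x0] := leP x 0.
by rewrite dflatexpE// mulr_ge0 ?flatexp_ge0// invr_ge0 sqr_ge0.
Qed.

Lemma flatexp_le1 x : flatexp x <= 1.
Proof.
have [/flatexp_le0 ->//|x0] := leP x 0.
by rewrite flatexpE// expR_le1 oppr_le0 invr_ge0 ltW.
Qed.

(** Bounds the derivative of [flatexp (1 - E)] uniformly in [E >= 0]. *)
Lemma dflatexp_bounded : exists2 C, 0 < C & forall x, x <= 1 -> dflatexp x <= C.
Proof.
have [C hC] := flat_small ('X ^+ 2); exists (`|C| + 1) => [|x x1]; first by rewrite ltr_wpDl.
have [/dflatexp_le0 ->|x0] := leP x 0; first by rewrite addr_ge0.
have := hC x; rewrite ger0_norm ?dflatexp_ge0// => /le_trans; apply.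
apply: (@le_trans _ _ (`|C| * 1)); last by rewrite mulr1 lerDl.
apply: (@le_trans _ _ (`|C| * x ^+ 2)); first by rewrite ler_wpM2r ?sqr_ge0// ler_norm.
by rewrite ler_wpM2l// expr_le1// ltW.
Qed.

Lemma le_flatexp x y : x <= y -> flatexp x <= flatexp y.
Proof.
move=> xy; rewrite -subr_ge0; apply: le_trans (derive_ge xy (fun s _ => der_flatexp s) (fun s _ => dflatexp_ge0 s)).
by rewrite mul0r.
Qed.

End flat.

(** * Primitives of continuous functions *)

Section primitive.
Context {R : realType}.
Notation mu := (@lebesgue_measure R).
Implicit Types g : R -> R.

(** The two terms make one formula valid on both sides of 0. *)
Definition prim g v := \int[mu]_(s in `[0, v]) g s - \int[mu]_(s in `[v, 0]) g s.

Lemma continuous_integrable_itv g a b : continuous g -> mu.-integrable `[a, b] (EFin \o g).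
Proof.
move=> cg; apply: continuous_compact_integrable; first exact: segment_compact.
exact: continuous_subspaceT.
Qed.

Lemma prim0 g : prim g 0 = 0.
Proof. by rewrite /prim subrr. Qed.

Lemma primE g a v : continuous g -> a <= 0 -> a <= v ->
  prim g v = \int[mu]_(s in `[a, v]) g s - \int[mu]_(s in `[a, 0]) g s.
Proof.
move=> cg a0 av; have int b c := @continuous_integrable_itv g b c cg.
have empty (b c : R) : c <= b -> \int[mu]_(s in `[b, c]) g s = 0.
  rewrite le_eqVlt => /predU1P[->|cb]; first by rewrite set_itv1 Rintegral_set1.
  by rewrite set_itv_ge ?bnd_simp -?ltNge// Rintegral_set0.
have half (b c : R) : \int[mu]_(s in `]b, c]) g s = \int[mu]_(s in `[b, c]) g s.
  rewrite Rintegral_itv_obnd_cbnd//.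
  by apply: integrableS (int b c) => //; exact: subset_itv_oc_cc.
rewrite /prim; have [v0|/ltW v0] := leP 0 v.
  by rewrite (empty v 0)// subr0 (Rintegral_itvB (int a v)) ?bnd_simp// half.
rewrite (empty 0 v)// sub0r -[RHS]opprB; congr (- _).
by rewrite (Rintegral_itvB (int a 0)) ?bnd_simp// half.
Qed.

Lemma der_prim g (v : R) : continuous g -> is_derive v 1 (prim g) (g v).
Proof.
move=> cg; pose a := Num.min 0 v - 1.
have a0 : a <= 0 by rewrite /a lerBlDr add0r ge_min ler01.
have av : a < v by rewrite /a ltrBlDr (@le_lt_trans _ _ v)// ?ltrDl// ge_min lexx orbT.
apply: (near_eq_is_derive (f := fun s : R => \int[mu]_(z in `[a, s]) g z - \int[mu]_(z in `[a, 0]) g z)).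
  near=> s; rewrite (@primE g a)//.
  by apply: ltW; near: s; exact: lt_nbhsr.
have vv : v < v + 1 by rewrite ltrDl.
have [h1 h2] := @continuous_FTC1_closed R g a v (v + 1) vv (@continuous_integrable_itv g _ _ cg) av (cg v).
have h : is_derive v 1 (fun s : R => \int[mu]_(z in `[a, s]) g z) (g v).
  by rewrite -h2 derive1E; exact: derivableP.
by apply: (der_eq (derB h (der_cst _ _))); rewrite subr0.
Unshelve. all: by end_near. Qed.

End primitive.

(** * Compact boxes of the plane *)

Section compact_boxes.
Context {R : realType}.
Implicit Types (g G : R -> R -> R).

Definition box (r : R) : set (R * R) := `[- r, r] `*` `[- r, r].

Lemma boxE (r x y : R) : box r (x, y) <-> `|x| <= r /\ `|y| <= r.
Proof.
by rewrite /box /setX/= !in_itv/= -!ler_norml.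
Qed.

Lemma box_compact (r : R) : compact (box r).
Proof. by apply: compact_setX; exact: segment_compact. Qed.

Lemma jcont_eps G x y (e : R) : jointly_continuous G -> 0 < e ->
  exists2 d, 0 < d & forall x' y', `|x' - x| < d -> `|y' - y| < d ->
    `|G x' y' - G x y| < e.
Proof.
move=> cG e0; have /cvgrPdist_lt/(_ _ e0)[[A B] [/= nA nB] AB] := cG (x, y).
have /nbhs_ballP[a /= a0 hA] := nA.
have /nbhs_ballP[b /= b0 hB] := nB.
exists (Num.min a b); first by rewrite lt_min a0.
move=> x' y'; rewrite !lt_min => /andP[xa _] /andP[_ yb].
rewrite distrC; apply: (AB (x', y')); split => /=.
  by apply: hA; rewrite /ball/= distrC.
by apply: hB; rewrite /ball/= distrC.
Qed.

Lemma box_uniform_continuous G (r e : R) : jointly_continuous G -> 0 < e ->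
  exists2 d, 0 < d & forall x y x' y', `|x| <= r -> `|y| <= r ->
    `|x' - x| < d -> `|y' - y| < d -> `|G x' y' - G x y| < e.
Proof.
move=> cG e0; have e20 : 0 < e / 2 by rewrite divr_gt0.
have /compact_near_coveringP/(_ R (0^'+)%R (fun (d : R) (p : R * R) => forall x' y',
  `|x' - p.1| < d -> `|y' - p.2| < d -> `|G x' y' - G p.1 p.2| < e) _) := @box_compact r.
case.
  move=> [x y] _; have [d d0 hd] := jcont_eps x y cG e20.
  have d20 : 0 < d / 2 by rewrite divr_gt0.
  exists (([set x' | `|x - x'| < d / 2] `*` [set y' | `|y - y'| < d / 2]), [set k | k < d / 2]).
    split => /=; last exact: nbhs_right_lt.
    by exists ([set x' | `|x - x'| < d / 2], [set y' | `|y - y'| < d / 2]) => //; split => /=;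
      apply/nbhs_ballP; exists (d / 2).
  move=> [[x1 y1] k] /= [[x1d y1d] kd] x' y' x'k y'k.
  rewrite (_ : G x' y' - G x1 y1 = (G x' y' - G x y) - (G x1 y1 - G x y)); last by ring.
  rewrite (le_lt_trans (ler_normB _ _))// [e]splitr ltrD//; apply: hd.
  - rewrite (_ : x' - x = (x' - x1) - (x - x1)); last by ring.
    by rewrite (le_lt_trans (ler_normB _ _))// [d]splitr ltrD// (lt_trans x'k).
  - rewrite (_ : y' - y = (y' - y1) - (y - y1)); last by ring.
    by rewrite (le_lt_trans (ler_normB _ _))// [d]splitr ltrD// (lt_trans y'k).
  - by rewrite distrC (lt_trans x1d)// ltr_pdivrMr// ltr_pMr// ltr1n.
  - by rewrite distrC (lt_trans y1d)// ltr_pdivrMr// ltr_pMr// ltr1n.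
move=> d /= d0 hd; have d20 : 0 < d / 2 by rewrite divr_gt0.
exists (d / 2) => // x y x' y' xr yr x'd y'd.
have /hd/(_ _ (x, y)) : `|0 - d / 2| < d.
  by rewrite sub0r normrN gtr0_norm// ltr_pdivrMr// ltr_pMr// ltr1n.
by apply => //; exact/boxE.
Qed.

Lemma box_bounded G (r : R) : jointly_continuous G ->
  exists2 C, 0 < C & forall x y, `|x| <= r -> `|y| <= r -> `|G x y| <= C.
Proof.
move=> cG.
have /compact_near_coveringP/(_ R (+oo)%R (fun (d : R) (p : R * R) => `|G p.1 p.2| <= d) _) := @box_compact r.
case.
  move=> [x y] _; have [d d0 hd] := jcont_eps x y cG (@ltr01 R).
  exists (([set x' | `|x - x'| < d] `*` [set y' | `|y - y'| < d]), [set k | `|G x y| + 1 < k]).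
    split => /=; last by apply: nbhs_pinfty_gt; exact: num_real.
    by exists ([set x' | `|x - x'| < d], [set y' | `|y - y'| < d]) => //; split => /=;
      apply/nbhs_ballP; exists d.
  move=> [[x1 y1] k] /= [[x1d y1d] kd].
  rewrite (_ : G x1 y1 = G x y + (G x1 y1 - G x y)); last by ring.
  rewrite (le_trans (ler_normD _ _))// (le_trans _ (ltW kd))// lerD2l ltW// hd// distrC//.
move=> d [_ hd]; exists (`|d| + 1); first by rewrite ltr_wpDl.
move=> x y xr yr; have /hd/(_ (x, y)) : d < `|d| + 1 by rewrite (le_lt_trans (ler_norm _))// ltrDl.
by apply; exact/boxE.
Qed.

End compact_boxes.

Section primitive_with_parameter.
Context {R : realType}.
Implicit Types (G : R -> R -> R) (g h k : R -> R).

Lemma prim_der h dh (v : R) : (forall x : R, is_derive x 1 h (dh x)) -> continuous dh ->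
  prim dh v = h v - h 0.
Proof.
move=> hd cdh; apply/eqP; rewrite -subr_eq0; apply/eqP.
rewrite (@derive0_cst _ (fun v => prim dh v - (h v - h 0)) _ v 0).
  by rewrite prim0 subrr subrr.
move=> x; apply: (der_eq (derB (der_prim x cdh) (derB (hd x) (der_cst _ _)))).
by rewrite subr0 subrr.
Qed.

Lemma prim_lipschitz g (C a b : R) : continuous g ->
  (forall x, Num.min a b <= x <= Num.max a b -> `|g x| <= C) ->
  `|prim g b - prim g a| <= C * `|b - a|.
Proof. by move=> cg; apply: derive_norm_le => x; exact: der_prim. Qed.

Lemma prim_norm_le g (C v : R) : continuous g ->
  (forall x, `|x| <= `|v| -> `|g x| <= C) -> `|prim g v| <= C * `|v|.
Proof.
move=> cg hC; have := @prim_lipschitz g C 0 v cg.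
rewrite prim0 !subr0; apply => x /andP[]; rewrite ge_min le_max => h1 h2; apply: hC.
have := ler_norm v; have := ler_norm (- v); rewrite normrN => v1 v2.
by rewrite ler_norml; apply/andP; split;
  [case/orP: h1|case/orP: h2] => h; lra.
Qed.

Lemma prim_subl g k (C v : R) : continuous g -> continuous k ->
  (forall x, `|x| <= `|v| -> `|g x - k x| <= C) -> `|prim g v - prim k v| <= C * `|v|.
Proof.
move=> cg ck hC.
have cgk : continuous (fun x => g x - k x) by move=> x; apply: cvgB; [exact: cg|exact: ck].
have hd (x : R) : is_derive x 1 (fun v => prim g v - prim k v) (g x - k x) by apply: derB; exact: der_prim.
have := prim_der v hd cgk; rewrite !prim0 subrr subr0 => <-; exact: prim_norm_le.
Qed.

Lemma jcont_prim G : jointly_continuous G -> jointly_continuous (fun x v => prim (G x) v).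
Proof.
move=> cG [x v]; apply/cvgrPdist_le => /= e e0.
pose r := `|x| + `|v| + 1.
have [C C0 hC] := box_bounded (`|x| + `|v| + 1) cG.
have e20 : 0 < e / 2 by rewrite divr_gt0.
have e'0 : 0 < e / 2 / (`|v| + 1) by rewrite divr_gt0// ltr_wpDl.
have [d d0 hd] := box_uniform_continuous r cG e'0.
near=> p.
have xd : `|x - p.1| < d.
  near: p; apply: (@cvgr_dist_lt _ _ _ _ _ (fun p : R * R => p.1) x) => //; exact: cvg_fst.
have x1 : `|x - p.1| < 1.
  near: p; apply: (@cvgr_dist_lt _ _ _ _ _ (fun p : R * R => p.1) x) => //; exact: cvg_fst.
have v1 : `|v - p.2| < Num.min 1 (e / 2 / C).
  near: p; apply: (@cvgr_dist_lt _ _ _ _ _ (fun p : R * R => p.2) v); first exact: cvg_snd.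
  by rewrite lt_min ltr01 divr_gt0.
move: xd x1 v1; set x' := p.1; set v' := p.2 => xd x1; rewrite lt_min => /andP[v1 vC].
rewrite (_ : prim (G x) v - _ = (prim (G x) v - prim (G x') v) + (prim (G x') v - prim (G x') v')); last by ring.
rewrite [e]splitr (le_trans (ler_normD _ _))// lerD//.
  apply: (@le_trans _ _ (e / 2 / (`|v| + 1) * `|v|)).
    apply: prim_subl; [exact: jcont_r|exact: jcont_r|move=> s sv].
    rewrite distrC ltW// hd//.
    - by rewrite /r -addrA lerDl addr_ge0.
    - by rewrite /r (le_trans sv)// -addrA addrCA lerDl addr_ge0.
    - by rewrite distrC.
    - by rewrite subrr normr0.
  by rewrite -mulrA ler_piMr ?ltW// mulrC ltr_pdivrMr ?ltr_wpDl// mul1r ltrDl.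
apply: (@le_trans _ _ (C * `|v - v'|)); last first.
  by move: vC; rewrite ltr_pdivlMr// mulrC => /ltW.
apply: prim_lipschitz; first exact: jcont_r.
move=> s; rewrite ge_min le_max => /andP[s1 s2].
move: x1 v1; rewrite !ltr_norml => /andP[x1 x2] /andP[v1 v2].
have := ler_norm x; have := ler_norm (- x); have := ler_norm v; have := ler_norm (- v).
rewrite !normrN => *; have v0 := normr_ge0 v; have x0 := normr_ge0 x.
by apply: hC; rewrite ler_norml; apply/andP; split; lra.
Unshelve. all: by end_near. Qed.

(** The difference quotient converges uniformly on compact boxes, hence under the
    integral. *)
Lemma der_prim_param G G1 (x v : R) : jointly_continuous G -> jointly_continuous G1 ->
  (forall x y : R, is_derive x 1 (G ^~ y) (G1 x y)) ->
  is_derive x 1 (fun x => prim (G x) v) (prim (G1 x) v).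
Proof.
move=> cG cG1 hG; apply: der_littleo => e e0.
have e'0 : 0 < e / (`|v| + 1) by rewrite divr_gt0// ltr_wpDl.
have [d d0 hd] := box_uniform_continuous (`|x| + `|v| + 1) cG1 e'0.
exists d => // y yx.
pose g s := G y s - G x s - G1 x s * (y - x).
have cg : continuous g.
  move=> s; apply: cvgB; first by apply: cvgB; exact: jcont_r.
  by apply: cvgM; [exact: jcont_r|exact: cvg_cst].
have hd' (s : R) : is_derive s 1 (fun v => prim (G y) v - prim (G x) v - prim (G1 x) v * (y - x)) (g s).
  apply: derB; first by apply: derB; apply: der_prim; exact: jcont_r.
  by apply: (der_eq (derM (der_prim s (jcont_r cG1)) (der_cst _ _))); rewrite mulr0 add0r mulrC.
have := prim_der v hd' cg; rewrite !prim0 mul0r !subr0 => <-.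
apply: (@le_trans _ _ (e / (`|v| + 1) * `|y - x| * `|v|)).
  apply: prim_norm_le => // s sv; rewrite /g.
  have hG' (z : R) : is_derive z 1 (fun z => G z s - G1 x s * z) (G1 z s - G1 x s).
    by apply: (der_eq (derB (hG z s) (derZ (G1 x s) (der_id z)))); rewrite mulr1.
  have := derive_norm_le (a := x) (b := y) (C := e / (`|v| + 1)) hG'.
  rewrite (_ : G y s - G1 x s * y - _ = G y s - G x s - G1 x s * (y - x)); last by ring.
  apply => z /andP[]; rewrite ge_min le_max => z1 z2.
  apply/ltW/hd; last by rewrite subrr normr0.
  - by rewrite -addrA lerDl addr_ge0.
  - by rewrite (le_trans sv)// -addrA addrCA lerDl addr_ge0.
  - move: yx; rewrite !ltr_norml => /andP[y1 y2]; apply/andP; split.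
      by case/orP: z1 => z1; lra.
    by case/orP: z2 => z2; lra.
rewrite mulrAC ler_wpM2r// -mulrA ler_piMr ?ltW//.
by rewrite mulrC ltr_pdivrMr ?ltr_wpDl// mul1r ltrDl.
Qed.

End primitive_with_parameter.

(** * Lebesgue measure on the plane *)

Section plane_measure.
Context {R : realType}.
Local Notation mu := (@lebesgue_measure R).
Local Notation mu2 := (mu \x mu)%E.
Implicit Types (g : R -> R -> R) (h : R * R -> R).

Lemma ae_imp (P Q : R -> Prop) : (forall x, P x -> Q x) ->
  {ae mu, forall x, P x} -> {ae mu, forall x, Q x}.
Proof. by move=> PQ; apply: (@filterS _ _ (ae_filter_ringOfSetsType mu)). Qed.

Lemma ae2_imp (P Q : R * R -> Prop) : (forall p, P p -> Q p) ->
  {ae mu2, forall p, P p} -> {ae mu2, forall p, Q p}.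
Proof. by move=> PQ; apply: (@filterS _ _ (ae_filter_ringOfSetsType mu2)). Qed.

(** The sigma-algebra of the plane is the product one: preimages of open intervals are
    written as countable unions of rational boxes. *)
Lemma jcont_measurable g : jointly_continuous g ->
  measurable_fun setT (fun p : R * R => g p.1 p.2).
Proof.
move=> cg; apply: (measurability _ (RGenOpens.measurableE R)) => _ [_ [a [b ->] <-]].
rewrite setTI.
pose S := [set q : (rat * rat) * (rat * rat) |
  forall x y : R, ratr q.1.1 < x < ratr q.1.2 -> ratr q.2.1 < y < ratr q.2.2 -> a < g x y < b].
suff -> : (fun p : R * R => g p.1 p.2) @^-1` `]a, b[ =
  \bigcup_(q in S) (`]ratr q.1.1, ratr q.1.2[ `*` `]ratr q.2.1, ratr q.2.2[).
  rewrite bigcup_mkcond; apply: countable_bigcupT_measurable => // q.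
  by case: ifPn => // _; exact: measurableX.
apply/seteqP; split => [[x y] /=|[x y] [q Sq] /=].
  rewrite in_itv/= => /andP[ag gb].
  have m0 : 0 < Num.min (g x y - a) (b - g x y) by rewrite lt_min !subr_gt0 ag gb.
  have [d d0 hd] := jcont_eps x y cg m0.
  have rat_near (z : R) : exists q : rat * rat, [/\ ratr q.1 < z < ratr q.2, z - d < ratr q.1 & ratr q.2 < z + d].
    have /rat_in_itvoo[q1] : z - d < z by rewrite ltrBlDr ltrDl.
    have /rat_in_itvoo[q2] : z < z + d by rewrite ltrDl.
    by rewrite !in_itv/= => /andP[? ?] /andP[? ?]; exists (q1, q2); split => //; apply/andP.
  have [qx [xq xq1 xq2]] := rat_near x; have [qy [yq yq1 yq2]] := rat_near y.
  exists (qx, qy) => /=; last by rewrite !in_itv.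
  move=> x' y' /andP[x1 x2] /andP[y1 y2].
  have : `|g x' y' - g x y| < Num.min (g x y - a) (b - g x y).
    by apply: hd; rewrite ltr_norml; apply/andP; split; lra.
  by rewrite lt_min !ltr_norml => /andP[/andP[? ?] /andP[? ?]]; apply/andP; split; lra.
by rewrite !in_itv/= => -[xq yq]; exact: Sq.
Qed.

Lemma mu2_boxE (r : R) : 0 <= r -> mu2 (box r) = ((r *+ 2) ^+ 2)%:E.
Proof.
move=> r0; rewrite /box product_measure1E//.
rewrite -[LHS]/((mu `[(- r)%R, r] * mu `[(- r)%R, r])%E) !lebesgue_measure_itv/=.
rewrite lte_fin; case: ifPn => [_|]; first by rewrite -EFinB -EFinM/= opprK -mulr2n expr2.
rewrite -leNgt => rr; have -> : r = 0 by apply/eqP; rewrite eq_le r0 andbT; lra.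
by rewrite mul0e/= mul0rn expr0n.
Qed.

Lemma measurable_box (r : R) : measurable (box r).
Proof. by apply: measurableX. Qed.

Lemma box_integrable h (r C : R) : measurable_fun setT h ->
  (forall p, `|h p| <= C) -> (forall p, ~ box r p -> h p = 0) ->
  mu2.-integrable setT (EFin \o h).
Proof.
move=> mh hC hr.
have -> : EFin \o h = (EFin \o h) \_ (box r).
  apply/funext => p; rewrite patchE; case: ifPn => //; rewrite notin_setE => /hr hp.
  by rewrite /= hp.
apply/integrable_restrict => //; first exact: measurable_box.
rewrite setTI.
apply: measurable_bounded_integrable.
- exact: measurable_box.
- have [r0|r0] := leP 0 r; first by rewrite -[ltLHS]/(mu2 (box r)) mu2_boxE// ltry.
  rewrite (_ : box r = set0); first by rewrite measure0.
  apply/seteqP; split => // -[x y] /boxE[xr _].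
  by have := lt_le_trans r0 (le_trans (normr_ge0 x) xr); rewrite ltNge => /negP; apply.
- exact: measurable_funTS.
- exists C; split; first exact: num_real.
  by move=> M CM p _ /=; rewrite (le_trans (hC p))// ltW.
Qed.

(** Bounded measurable functions of bounded support: a class of integrable
    functions that is visibly closed under the operations used below. *)
Definition boxed h := exists r C, [/\ measurable_fun setT h,
  forall p, `|h p| <= C & forall p, ~ box r p -> h p = 0].

Definition I2 h : R := \int[mu2]_p h p.

Lemma boxed_integrable h : boxed h -> mu2.-integrable setT (EFin \o h).
Proof. by move=> [r [C [mh hC hr]]]; exact: (box_integrable mh hC hr). Qed.

Lemma box_mono (r s : R) p : r <= s -> box r p -> box s p.
Proof.
by case: p => x y rs /boxE[xr yr]; apply/boxE; split; exact: le_trans rs.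
Qed.

Lemma boxed_le h k (C : R) : measurable_fun setT h -> boxed k ->
  (forall p, `|h p| <= C * `|k p|) -> boxed h.
Proof.
move=> mh [r [D [mk kD kr]]] hk; exists r, (`|C| * D); split => // p.
  rewrite (le_trans (hk p))// (@le_trans _ _ (`|C| * `|k p|))//.
    by rewrite ler_wpM2r// ler_norm.
  by rewrite ler_wpM2l.
by move=> /kr kp; have := hk p; rewrite kp normr0 mulr0 normr_le0 => /eqP.
Qed.

Lemma boxedD h k : boxed h -> boxed k -> boxed (fun p => h p + k p).
Proof.
move=> [r [C [mh hC hr]]] [s [D [mk kD ks]]].
exists (Num.max r s), (C + D); split.
- exact: measurable_funD.
- by move=> p; rewrite (le_trans (ler_normD _ _))// lerD.
- move=> p np; rewrite hr ?ks ?addr0// => bp; apply: np; apply: box_mono bp.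
    by rewrite le_max lexx orbT.
  by rewrite le_max lexx.
Qed.

Lemma boxedM h k : measurable_fun setT h -> boxed k ->
  (exists C, forall p, k p != 0 -> `|h p| <= C) -> boxed (fun p => h p * k p).
Proof.
move=> mh bk [C hC]; apply: (@boxed_le _ k C) => //.
  by apply: measurable_funM => //; case: bk => ? [? []].
move=> p; have [->|kp] := eqVneq (k p) 0; first by rewrite mulr0 normr0 mulr0.
by rewrite normrM ler_wpM2r// hC.
Qed.

Lemma boxedZ (c : R) h : boxed h -> boxed (fun p => c * h p).
Proof. by move=> bh; apply: boxedM => //; exists `|c|. Qed.

Lemma boxedN h : boxed h -> boxed (fun p => - h p).
Proof.
move=> /(boxedZ (-1)) bh; rewrite (_ : (fun p => - h p) = (fun p => -1 * h p))//.
by apply/funext => p; rewrite mulN1r.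
Qed.

Lemma boxedB h k : boxed h -> boxed k -> boxed (fun p => h p - k p).
Proof. by move=> bh bk; apply: boxedD => //; exact: boxedN. Qed.

Lemma boxed_norm h : boxed h -> boxed (fun p => `|h p|).
Proof.
move=> bh; apply: (@boxed_le _ h 1) => //.
  by apply: measurableT_comp => //; case: bh => ? [? []].
by move=> p; rewrite normr_id mul1r.
Qed.

Lemma boxed_indic (r : R) : boxed (\1_(box r)).
Proof.
exists r, 1; split; first exact: measurable_indic (measurable_box r).
  by move=> p; rewrite indicE; case: (_ \in _); rewrite ?normr1 ?normr0.
by move=> p np; rewrite indicE memNset.
Qed.

Lemma I2D h k : boxed h -> boxed k -> I2 (fun p => h p + k p) = I2 h + I2 k.
Proof. by move=> /boxed_integrable ih /boxed_integrable ik; rewrite /I2 RintegralD. Qed.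

Lemma I2B h k : boxed h -> boxed k -> I2 (fun p => h p - k p) = I2 h - I2 k.
Proof. by move=> /boxed_integrable ih /boxed_integrable ik; rewrite /I2 RintegralB. Qed.

Lemma I2Z (c : R) h : boxed h -> I2 (fun p => c * h p) = c * I2 h.
Proof. by move=> /boxed_integrable ih; rewrite /I2 RintegralZl. Qed.

Lemma I2N h : boxed h -> I2 (fun p => - h p) = - I2 h.
Proof.
move=> bh; rewrite -mulN1r -I2Z//; congr I2; apply/funext => p; by rewrite mulN1r.
Qed.

Lemma le_I2 h k : boxed h -> boxed k -> (forall p, h p <= k p) -> I2 h <= I2 k.
Proof. by move=> /boxed_integrable ih /boxed_integrable ik hk; apply: le_Rintegral => // p _. Qed.

Lemma I2_ge0 h : (forall p, 0 <= h p) -> 0 <= I2 h.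
Proof. by move=> h0; apply: Rintegral_ge0. Qed.

Lemma I2_norm h : boxed h -> `|I2 h| <= I2 (fun p => `|h p|).
Proof. by move=> /boxed_integrable ih; apply: le_normr_Rintegral. Qed.

Lemma I2_bound h (r C : R) : boxed h -> 0 <= r -> (forall p, `|h p| <= C * \1_(box r) p) ->
  `|I2 h| <= C * (r *+ 2) ^+ 2.
Proof.
move=> bh r0 hC; apply: (le_trans (I2_norm bh)).
apply: (@le_trans _ _ (I2 (fun p => C * \1_(box r) p))).
  by apply: le_I2 => //; [exact: boxed_norm|apply: boxedZ; exact: boxed_indic].
rewrite I2Z; last exact: boxed_indic.
rewrite /I2 /Rintegral integral_indic//; last exact: measurable_box.
by rewrite setIT -[X in fine X]/(mu2 (box r)) mu2_boxE.
Qed.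

Lemma eq_I2 h k : h =1 k -> I2 h = I2 k.
Proof. by move=> /funext ->. Qed.

Lemma I2_half h : \int[mu2]_(p in half_plane) h p = I2 (h \_ half_plane).
Proof. exact: Rintegral_mkcond. Qed.

Lemma measurable_half_plane : measurable (half_plane : set (R * R)).
Proof.
rewrite (_ : half_plane = [set: R] `*` `[0, +oo[); first exact: measurableX.
by apply/seteqP; split => -[x t] /=; rewrite in_itv/= andbT => //; case.
Qed.

Definition boxed1 (h : R -> R) := exists r C, [/\ measurable_fun setT h,
  forall x, `|h x| <= C & forall x, r < `|x| -> h x = 0].

Lemma boxed1_integrable (h : R -> R) : boxed1 h -> mu.-integrable setT (EFin \o h).
Proof.
move=> [r [C [mh hC hr]]].
have -> : EFin \o h = (EFin \o h) \_ `[- r, r].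
  apply/funext => p; rewrite patchE; case: ifPn => //; rewrite notin_setE/= in_itv/= -ler_norml.
  by move=> /negP; rewrite -ltNge => /hr ->.
apply/integrable_restrict => //; rewrite setTI.
apply: measurable_bounded_integrable => //.
- by rewrite /= lebesgue_measure_itv/=; case: ifP => // _; rewrite -EFinB ltry.
- exact: measurable_funTS.
- exists C; split; first exact: num_real.
  by move=> M CM p _ /=; rewrite (le_trans (hC p))// ltW.
Qed.

Lemma boxed_slice1 h t : boxed h -> boxed1 (fun x => h (x, t)).
Proof.
move=> [r [C [mh hC hr]]]; exists r, C; split => //.
  by apply: (measurableT_comp mh); exact: measurable_fun_pair.
by move=> x rx; apply: hr => /boxE[xr _]; move: (lt_le_trans rx xr); rewrite ltxx.
Qed.

Lemma boxed_slice2 h x : boxed h -> boxed1 (fun t => h (x, t)).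
Proof.
move=> [r [C [mh hC hr]]]; exists r, C; split => //.
  by apply: (measurableT_comp mh); exact: measurable_fun_pair.
by move=> t rt; apply: hr => /boxE[_ tr]; move: (lt_le_trans rt tr); rewrite ltxx.
Qed.

Lemma I2_fubini12 h : boxed h -> I2 h = \int[mu]_x \int[mu]_t h (x, t).
Proof.
move=> bh; rewrite /I2 /Rintegral; congr fine.
rewrite -(integral12_prod_meas1 (boxed_integrable bh)); apply: eq_integral => x _.
rewrite fineK//; apply: integrable_fin_num => //.
exact: (boxed1_integrable (boxed_slice2 x bh)).
Qed.

Lemma I2_fubini21 h : boxed h -> I2 h = \int[mu]_t \int[mu]_x h (x, t).
Proof.
move=> bh; rewrite /I2 /Rintegral; congr fine.
rewrite -(integral21_prod_meas1 (boxed_integrable bh)); apply: eq_integral => t _.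
rewrite fineK//; apply: integrable_fin_num => //.
exact: (boxed1_integrable (boxed_slice1 t bh)).
Qed.

Lemma measurable_Rintegral_param d (T : measurableType d) (k : T * R -> R) :
  measurable_fun setT k -> (forall p, boxed1 (fun y => k (p, y))) ->
  measurable_fun setT (fun p => \int[mu]_y k (p, y)).
Proof.
move=> mk bk.
have mE : measurable_fun setT (EFin \o k) by exact/measurable_EFinP.
have mp : measurable_fun setT (fubini_F mu (EFin \o k)^\+%E).
  by apply: measurable_fun_fubini_tonelli_F => //; exact: measurable_funepos.
have mn : measurable_fun setT (fubini_F mu (EFin \o k)^\-%E).
  by apply: measurable_fun_fubini_tonelli_F => //; exact: measurable_funeneg.
have -> : (fun p => \int[mu]_y k (p, y)) =
    (fun p => fine (fubini_F mu (EFin \o k)^\+%E p) - fine (fubini_F mu (EFin \o k)^\-%E p)).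
  apply/funext => p; rewrite /Rintegral integralE fineB.
  - by rewrite /fubini_F; congr (fine _ - fine _); apply: eq_integral => y _; rewrite ?funeposE ?funenegE.
  - apply: integrable_fin_num => //; apply: integrable_funepos => //.
    exact: boxed1_integrable.
  - apply: integrable_fin_num => //; apply: integrable_funeneg => //.
    exact: boxed1_integrable.
by apply: measurable_funB; exact: measurableT_comp.
Qed.

End plane_measure.

(** * Smooth test functions and mollification *)

Section test_functions.
Context {R : realType}.
Local Notation mu := (@lebesgue_measure R).
Local Notation mu2 := (mu \x mu)%E.
Implicit Types (K phi : R -> R -> R) (g : R * R -> R).

Lemma taylor1 (h dh ddh : R -> R) (C a b : R) :
  (forall x : R, is_derive x 1 h (dh x)) -> (forall x : R, is_derive x 1 dh (ddh x)) ->
  (forall x, `|ddh x| <= C) -> `|h b - h a - dh a * (b - a)| <= C * (b - a) ^+ 2.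
Proof.
move=> h1 h2 hC.
have hd (z : R) : is_derive z 1 (fun z => h z - dh a * z) (dh z - dh a).
  by apply: (der_eq (derB (h1 z) (derZ (dh a) (der_id z)))); rewrite mulr1.
rewrite (_ : h b - h a - _ = (h b - dh a * b) - (h a - dh a * a)); last by ring.
rewrite -real_normK ?num_real// expr2 mulrA.
apply: (derive_norm_le hd) => x xab.
apply: (le_trans (derive_norm_le h2 (fun z _ => hC z))).
have C0 : 0 <= C := le_trans (normr_ge0 _) (hC a).
rewrite ler_wpM2l// ler_norml; have := ler_norm (b - a); have := ler_norm (a - b).
rewrite (distrC a b) => ? ?.
by move: xab; have [ab|ab] := leP a b => /andP[? ?]; apply/andP; split; lra.
Qed.

Definition testfun K := smooth K /\ exists r, forall x y, ~ box r (x, y) -> K x y = 0.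

Lemma testfun_smooth K n : testfun K -> Ck n K.
Proof. by case. Qed.

Lemma smooth_intro K K1 K2 : jointly_continuous K ->
  (forall x y : R, is_derive x 1 (K ^~ y) (K1 x y)) ->
  (forall x y : R, is_derive y 1 (K x) (K2 x y)) ->
  smooth K1 -> smooth K2 -> smooth K.
Proof.
move=> cK h1 h2 s1 s2 [|n]; first by split.
exact: (Ck_intro cK h1 h2 (s1 n) (s2 n)).
Qed.

Lemma smooth_d1 K : smooth K -> smooth (d1 K).
Proof. by move=> sK n; have [_ []] := sK n.+1. Qed.

Lemma smooth_d2 K : smooth K -> smooth (d2 K).
Proof. by move=> sK n; have [_ []] := sK n.+1. Qed.

Lemma boxN (r x y : R) : ~ box r (x, y) <-> (r < `|x|) || (r < `|y|).
Proof.
split=> [nb|+ /boxE[xr yr]]; last by rewrite !ltNge xr yr.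
by apply/negPn/negP; rewrite negb_or -!leNgt => /andP[? ?]; apply: nb; apply/boxE.
Qed.

Lemma near_norm_gt (r x : R) : r < `|x| -> \forall y \near x, r < `|y|.
Proof.
move=> rx; have d0 : 0 < `|x| - r by rewrite subr_gt0.
near=> y; have : `|x - y| < `|x| - r by near: y; exact: (@cvgr_dist_lt _ _ _ _ _ id x).
have := ler_normD (x - y) y; rewrite subrK => h1 h2; lra.
Unshelve. all: by end_near. Qed.

Lemma testfun_d1 K : testfun K -> testfun (d1 K).
Proof.
move=> [sK [r hr]]; split; first exact: smooth_d1.
exists r => x y nb; apply: is_derive_derive1.
apply: (near_eq_is_derive (f := fun _ : R => 0 : R)).
move/boxN: nb => /orP[rx|ry].
  near=> z; rewrite hr//; apply/boxN/orP; left; near: z; exact: near_norm_gt.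
by near=> z; rewrite hr//; apply/boxN; rewrite ry orbT.
Unshelve. all: by end_near. Qed.

Lemma testfun_d2 K : testfun K -> testfun (d2 K).
Proof.
move=> [sK [r hr]]; split; first exact: smooth_d2.
exists r => x y nb; apply: is_derive_derive1.
apply: (near_eq_is_derive (f := fun _ : R => 0 : R)).
move/boxN: nb => /orP[rx|ry].
  by near=> z; rewrite hr//; apply/boxN; rewrite rx.
near=> z; rewrite hr//; apply/boxN/orP; right; near: z; exact: near_norm_gt.
Unshelve. all: by end_near. Qed.

Lemma testfun_bounded K : testfun K -> exists2 C, 0 < C & forall x y, `|K x y| <= C.
Proof.
move=> [sK [r hr]]; have [C C0 hC] := box_bounded r (Ck_jcont (sK 0%N)).
exists C => // x y; have [[xr yr]|nb] := pselect (`|x| <= r /\ `|y| <= r); first exact: hC.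
by rewrite hr ?normr0 ?ltW// => /boxE.
Qed.

Lemma jcont_shift K (a b : R) : jointly_continuous K ->
  jointly_continuous (fun x y => K (x - a) (y - b)).
Proof.
move=> cK p.
apply: (@continuous_comp _ _ _ (fun p : R * R => (p.1 - a, p.2 - b)) (fun p => K p.1 p.2)); last exact: cK.
apply: (@cvg_pair _ _ _ _ (nbhs (p.1 - a)) (nbhs (p.2 - b))); apply: cvgB; try exact: cvg_cst.
  exact: cvg_fst.
exact: cvg_snd.
Qed.

Lemma der_shift (c x : R) : is_derive x 1 (fun x => x - c) 1.
Proof. by apply: (der_eq (derB (der_id x) (der_cst c x))); rewrite subr0. Qed.

Lemma der1_shift K (a b x y : R) : Ck 1 K ->
  is_derive x 1 ((fun x y => K (x - a) (y - b)) ^~ y) (d1 K (x - a) (y - b)).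
Proof.
by move=> sK; apply: (der_eq (der_comp (h := K ^~ (y - b)) (Ck_d1 sK _ _) (der_shift a x))); rewrite mulr1.
Qed.

Lemma der2_shift K (a b x y : R) : Ck 1 K ->
  is_derive y 1 ((fun x y => K (x - a) (y - b)) x) (d2 K (x - a) (y - b)).
Proof.
by move=> sK; apply: (der_eq (der_comp (h := K (x - a)) (Ck_d2 sK _ _) (der_shift b y))); rewrite mulr1.
Qed.

Lemma smooth_shift K (a b : R) : smooth K -> smooth (fun x y => K (x - a) (y - b)).
Proof.
move=> sK n; elim: n K sK => [|n IH] K sK; first by split => //; exact: jcont_shift (Ck_jcont (sK 0%N)).
apply: (@Ck_intro _ _ _ (fun x y => d1 K (x - a) (y - b)) (fun x y => d2 K (x - a) (y - b))).
- exact: jcont_shift (Ck_jcont (sK 0%N)).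
- by move=> x y; exact: der1_shift.
- by move=> x y; exact: der2_shift.
- exact: IH (smooth_d1 sK).
- exact: IH (smooth_d2 sK).
Qed.

Lemma testfun_shift K (a b : R) : testfun K -> testfun (fun x y => K (x - a) (y - b)).
Proof.
move=> [sK [r hr]]; split; first exact: smooth_shift.
exists (r + `|a| + `|b|) => x y nb; apply: hr => /boxE[xr yr]; apply: nb; apply/boxE.
have := normr_ge0 a; have := normr_ge0 b.
have := ler_normD (x - a) a; have := ler_normD (y - b) b; rewrite !subrK => *.
by split; lra.
Qed.

Lemma boxed_testfun K : testfun K -> boxed (fun p => K p.1 p.2).
Proof.
move=> kK; have [C _ hC] := testfun_bounded kK; have [sK [r hr]] := kK.
exists r, C; split; first exact: jcont_measurable (Ck_jcont (sK 0%N)).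
  by move=> p; exact: hC.
by move=> [x y]; exact: hr.
Qed.

(** Differentiation under the integral sign, with a quadratic error term. *)
Lemma der_I2 (k : R -> R * R -> R) dk (x r C : R) : 0 <= r -> 0 <= C ->
  (forall y, boxed (k y)) -> boxed dk ->
  (forall y p, `|y - x| <= 1 ->
     `|k y p - k x p - (y - x) * dk p| <= C * (y - x) ^+ 2 * \1_(box r) p) ->
  is_derive x 1 (fun y => I2 (k y)) (I2 dk).
Proof.
move=> r0 C0 bk bdk hk; apply: der_littleo => e e0.
pose A := C * (r *+ 2) ^+ 2 + 1.
have A0 : 0 < A by rewrite ltr_wpDl// mulr_ge0// exprn_ge0// mulrn_wge0.
exists (Num.min 1 (e / A)); first by rewrite lt_min ltr01 divr_gt0.
move=> y; rewrite lt_min => /andP[y1 yA].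
have bd : boxed (fun p => (y - x) * dk p) by exact: boxedZ.
rewrite mulrC -I2Z// -I2B// -I2B//; last exact: boxedB.
apply: (@le_trans _ _ (C * (y - x) ^+ 2 * (r *+ 2) ^+ 2)).
  apply: I2_bound => //; first by do 2 apply: boxedB => //.
  by move=> p; exact: hk (ltW y1).
rewrite -[(y - x) ^+ 2]real_normK ?num_real// expr2 mulrACA -mulrA.
rewrite [X in X <= _](_ : _ = (C * (r *+ 2) ^+ 2 * `|y - x|) * `|y - x|); last by ring.
rewrite ler_wpM2r// (@le_trans _ _ (A * `|y - x|))//; first by rewrite ler_wpM2r// lerDl.
by rewrite mulrC -ler_pdivlMr// ltW.
Qed.

(** Correlation rather than convolution: [K] is evaluated at [p - (x, t)], so that a kernel
    supported in the positive quadrant only sees later times. *)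
Definition mol K g x t : R := I2 (fun p => g p * K (p.1 - x) (p.2 - t)).

Section mol.
Variables (g : R * R -> R) (G : R).
Hypotheses (mg : measurable_fun setT g) (gG : forall p, `|g p| <= G).

Let G0 : 0 <= G. Proof. exact: le_trans (normr_ge0 _) (gG (0, 0)). Qed.

Lemma boxed_mol K x t : testfun K -> boxed (fun p => g p * K (p.1 - x) (p.2 - t)).
Proof.
move=> /(testfun_shift x t)/boxed_testfun bK; apply: boxedM => //.
by exists G => p _.
Qed.

Lemma mol_bounded K (r : R) : testfun K ->
  exists C, forall x t, `|x| <= r -> `|t| <= r -> `|mol K g x t| <= C.
Proof.
move=> kK; have [C C0 hC] := testfun_bounded kK; have [sK [s hs]] := kK.
exists (G * C * ((`|r| + `|s|) *+ 2) ^+ 2) => x t xr tr.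
apply: I2_bound => //; [exact: boxed_mol|move=> [y z] /=].
rewrite normrM; have [bp|nb] := pselect (box (`|r| + `|s|) (y, z)).
  by rewrite indicE mem_set// mulr1 ler_pM.
rewrite indicE memNset// mulr0 hs ?normr0 ?mulr0//.
move=> /boxE[h1 h2]; apply: nb; apply/boxE.
have := ler_normD (y - x) x; have := ler_normD (z - t) t; rewrite !subrK => *.
have := ler_norm r; have := ler_norm s => *.
by split; lra.
Qed.

Lemma der1_mol K (x t : R) : testfun K ->
  is_derive x 1 (mol K g ^~ t) (- mol (d1 K) g x t).
Proof.
move=> kK; have [C C0 hC] := testfun_bounded (testfun_d1 (testfun_d1 kK)).
have [sK [s hs]] := kK; have [_ [s' hs']] := testfun_d1 kK.
rewrite /mol -I2N; last exact: (boxed_mol _ _ (testfun_d1 kK)).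
pose r := `|x| + `|t| + `|s| + `|s'| + 1.
have r0 : 0 <= r by rewrite !addr_ge0.
apply: (@der_I2 (fun y p => g p * K (p.1 - y) (p.2 - t)) _ x r (G * C)) => //.
- by rewrite mulr_ge0// ltW.
- by move=> y; exact: boxed_mol.
- by apply: boxedN; exact: (boxed_mol _ _ (testfun_d1 kK)).
move=> y [a b] yx /=.
rewrite [X in `|X|](_ : _ = g (a, b) * (K (a - y) (b - t) - K (a - x) (b - t)
   - d1 K (a - x) (b - t) * ((a - y) - (a - x)))); last by ring.
have := ler_norm s; have := ler_norm s'; have := normr_ge0 s; have := normr_ge0 s'.
have := normr_ge0 x; have := normr_ge0 t => *.
have [bp|nb] := pselect (box r (a, b)).
  rewrite indicE mem_set// mulr1 normrM -mulrA ler_pM// (_ : (y - x) ^+ 2 = (a - y - (a - x)) ^+ 2); last by ring.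
  apply: (@taylor1 (K ^~ (b - t)) (d1 K ^~ (b - t)) (d1 (d1 K) ^~ (b - t))).
  - by move=> z; exact: (Ck_d1 (sK 1%N)).
  - by move=> z; exact: (Ck_d1 (smooth_d1 sK 1%N)).
  - by move=> z; exact: hC.
have out (z u : R) : `|z| <= `|x| + 1 -> u <= `|s| + `|s'| -> ~ box u (a - z, b - t).
  move=> zx us /boxE[h1 h2]; apply: nb; apply/boxE; rewrite /r.
  by have := ler_normD (a - z) z; have := ler_normD (b - t) t; rewrite !subrK => *; split; lra.
have yx1 : `|y| <= `|x| + 1 by have := ler_normD (y - x) x; rewrite subrK => *; lra.
have e1 : K (a - y) (b - t) = 0 by apply/hs/out; lra.
have e2 : K (a - x) (b - t) = 0 by apply/hs/out; lra.
have e3 : d1 K (a - x) (b - t) = 0 by apply/hs'/out; lra.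
by rewrite e1 e2 e3 mul0r !subr0 mulr0 normr0 indicE memNset// mulr0.
Qed.

Lemma der2_mol K (x t : R) : testfun K ->
  is_derive t 1 (mol K g x) (- mol (d2 K) g x t).
Proof.
move=> kK; have [C C0 hC] := testfun_bounded (testfun_d2 (testfun_d2 kK)).
have [sK [s hs]] := kK; have [_ [s' hs']] := testfun_d2 kK.
rewrite /mol -I2N; last exact: (boxed_mol _ _ (testfun_d2 kK)).
pose r := `|x| + `|t| + `|s| + `|s'| + 1.
have r0 : 0 <= r by rewrite !addr_ge0.
apply: (@der_I2 (fun y p => g p * K (p.1 - x) (p.2 - y)) _ t r (G * C)) => //.
- by rewrite mulr_ge0// ltW.
- by move=> y; exact: boxed_mol.
- by apply: boxedN; exact: (boxed_mol _ _ (testfun_d2 kK)).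
move=> y [a b] yt /=.
rewrite [X in `|X|](_ : _ = g (a, b) * (K (a - x) (b - y) - K (a - x) (b - t)
   - d2 K (a - x) (b - t) * ((b - y) - (b - t)))); last by ring.
have := ler_norm s; have := ler_norm s'; have := normr_ge0 s; have := normr_ge0 s'.
have := normr_ge0 x; have := normr_ge0 t => *.
have [bp|nb] := pselect (box r (a, b)).
  rewrite indicE mem_set// mulr1 normrM -mulrA ler_pM// (_ : (y - t) ^+ 2 = (b - y - (b - t)) ^+ 2); last by ring.
  apply: (@taylor1 (K (a - x)) (d2 K (a - x)) (d2 (d2 K) (a - x))).
  - by move=> z; exact: (Ck_d2 (sK 1%N)).
  - by move=> z; exact: (Ck_d2 (smooth_d2 sK 1%N)).
  - by move=> z; exact: hC.
have out (z u : R) : `|z| <= `|t| + 1 -> u <= `|s| + `|s'| -> ~ box u (a - x, b - z).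
  move=> zx us /boxE[h1 h2]; apply: nb; apply/boxE; rewrite /r.
  by have := ler_normD (a - x) x; have := ler_normD (b - z) z; rewrite !subrK => *; split; lra.
have yt1 : `|y| <= `|t| + 1 by have := ler_normD (y - t) t; rewrite subrK => *; lra.
have e1 : K (a - x) (b - y) = 0 by apply/hs/out; lra.
have e2 : K (a - x) (b - t) = 0 by apply/hs/out; lra.
have e3 : d2 K (a - x) (b - t) = 0 by apply/hs'/out; lra.
by rewrite e1 e2 e3 mul0r !subr0 mulr0 normr0 indicE memNset// mulr0.
Qed.

(** Locally bounded partial derivatives make a function locally Lipschitz. *)
Lemma partials_jcont K K1 K2 :
  (forall x y : R, is_derive x 1 (K ^~ y) (K1 x y)) ->
  (forall x y : R, is_derive y 1 (K x) (K2 x y)) ->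
  (forall r, exists C, forall x y, `|x| <= r -> `|y| <= r -> `|K1 x y| <= C) ->
  (forall r, exists C, forall x y, `|x| <= r -> `|y| <= r -> `|K2 x y| <= C) ->
  jointly_continuous K.
Proof.
move=> h1 h2 b1 b2 [x y]; apply/cvgrPdist_le => /= e e0.
pose r := `|x| + `|y| + 1.
have [C1 hC1] := b1 r; have [C2 hC2] := b2 r.
pose C := `|C1| + `|C2| + 1.
have C0 : 0 < C by rewrite ltr_wpDl ?addr_ge0.
have d0 : 0 < e / C / 2 by rewrite !divr_gt0.
near=> p.
have xd : `|x - p.1| < Num.min 1 (e / C / 2).
  near: p; apply: (@cvgr_dist_lt _ _ _ _ _ (fun p : R * R => p.1) x); first exact: cvg_fst.
  by rewrite lt_min ltr01.
have yd : `|y - p.2| < Num.min 1 (e / C / 2).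
  near: p; apply: (@cvgr_dist_lt _ _ _ _ _ (fun p : R * R => p.2) y); first exact: cvg_snd.
  by rewrite lt_min ltr01.
move: xd yd; rewrite !lt_min => /andP[x1 xe] /andP[y1 ye].
rewrite (_ : K x y - _ = (K x y - K p.1 y) + (K p.1 y - K p.1 p.2)); last by ring.
have x0 := normr_ge0 x; have y0 := normr_ge0 y.
have near_le (z z' w : R) : `|z - z'| < 1 -> Num.min z' z <= w <= Num.max z' z -> `|w| <= `|z| + 1.
  rewrite ge_min le_max ltr_norml => /andP[? ?] /andP[w1 w2].
  have := ler_norm z; have := ler_norm (- z); rewrite normrN => *.
  by rewrite ler_norml; apply/andP; split; lra.
have C1C : C1 <= C by rewrite /C; have := ler_norm C1; have := normr_ge0 C2; lra.
have C2C : C2 <= C by rewrite /C; have := ler_norm C2; have := normr_ge0 C1; lra.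
apply: (le_trans (ler_normD _ _)); rewrite [e](_ : _ = C * (e / C / 2) + C * (e / C / 2)); last first.
  by field; rewrite gt_eqF.
apply: lerD.
  apply: (@le_trans _ _ (C * `|x - p.1|)); last by rewrite ler_pM2l// ltW.
  apply: (@derive_norm_le _ (K ^~ y) (K1 ^~ y)) => // z zx; apply: (le_trans (hC1 _ _ _ _)) => //.
    by have := near_le _ _ _ x1 zx; rewrite /r; lra.
  by rewrite /r; lra.
apply: (@le_trans _ _ (C * `|y - p.2|)); last by rewrite ler_pM2l// ltW.
apply: (@derive_norm_le _ (K p.1) (K2 p.1)) => // z zy; apply: (le_trans (hC2 _ _ _ _)) => //.
  have := ler_normD (p.1 - x) x; rewrite subrK distrC /r; lra.
by have := near_le _ _ _ y1 zy; rewrite /r; lra.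
Unshelve. all: by end_near. Qed.

Lemma smooth_mol K : testfun K -> smooth (mol K g).
Proof.
move=> kK n; elim: n K kK => [|n IH] K kK.
  split => //; apply: (partials_jcont (fun x y => der1_mol x y kK) (fun x y => der2_mol x y kK)) => r.
    have [C hC] := mol_bounded r (testfun_d1 kK); exists C => x y xr yr; rewrite normrN; exact: hC.
  by have [C hC] := mol_bounded r (testfun_d2 kK); exists C => x y xr yr; rewrite normrN; exact: hC.
apply: (@Ck_intro _ _ _ (fun x y => - mol (d1 K) g x y) (fun x y => - mol (d2 K) g x y)).
- apply: (partials_jcont (fun x y => der1_mol x y kK) (fun x y => der2_mol x y kK)) => r.
    have [C hC] := mol_bounded r (testfun_d1 kK); exists C => x y xr yr; rewrite normrN; exact: hC.
  by have [C hC] := mol_bounded r (testfun_d2 kK); exists C => x y xr yr; rewrite normrN; exact: hC.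
- by move=> x y; exact: der1_mol.
- by move=> x y; exact: der2_mol.
- by apply: CkN; apply: IH; exact: testfun_d1.
- by apply: CkN; apply: IH; exact: testfun_d2.
Qed.

End mol.

(** Fundamental theorem of calculus on a segment, and for functions of bounded
    support on the line and on the half-line. *)
Lemma Rintegral_deriv (h dh : R -> R) (a b : R) : (forall x : R, is_derive x 1 h (dh x)) ->
  continuous dh -> a <= b -> \int[mu]_(x in `[a, b]) dh x = h b - h a.
Proof.
move=> hd cd ab; pose c := Num.min a 0.
have c0 : c <= 0 by rewrite ge_min lexx orbT.
have ca : c <= a by rewrite ge_min lexx.
have := primE cd c0 (le_trans ca ab); have := primE cd c0 ca.
have := @Rintegral_itvB R dh (BLeft c) (BRight b) a (@continuous_integrable_itv R dh c b cd).
rewrite !bnd_simp => /(_ ca ab); rewrite Rintegral_itv_obnd_cbnd; last first.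
  apply: integrableS (@continuous_integrable_itv _ dh a b cd) => //.
  exact: subset_itv_oc_cc.
by rewrite !(prim_der _ hd cd) => <-; lra.
Qed.

Lemma Rintegral_support (h : R -> R) (a b : R) : (forall x, ~~ (a <= x <= b) -> h x = 0) ->
  \int[mu]_x h x = \int[mu]_(x in `[a, b]) h x.
Proof.
move=> hab; rewrite [RHS]Rintegral_mkcond; apply: eq_Rintegral => x _.
by rewrite patchE; case: ifPn => //; rewrite notin_setE/= in_itv/= => /negP/hab.
Qed.

Lemma Rintegral_deriv_line (h dh : R -> R) (r : R) : (forall x : R, is_derive x 1 h (dh x)) ->
  continuous dh -> (forall x, r < `|x| -> h x = 0) -> (forall x, r < `|x| -> dh x = 0) ->
  \int[mu]_x dh x = 0.
Proof.
move=> hd cd hr dr; have r0 := normr_ge0 r; have rr := ler_norm r.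
rewrite (@Rintegral_support _ (- (`|r| + 1)) (`|r| + 1)); last first.
  by move=> x; rewrite -ler_norml -ltNge => ?; apply: dr; lra.
rewrite (Rintegral_deriv hd cd); last by lra.
by rewrite !hr ?subrr// ?normrN gtr0_norm; lra.
Qed.

Lemma Rintegral_deriv_half (h dh : R -> R) (r : R) : (forall x : R, is_derive x 1 h (dh x)) ->
  continuous dh -> (forall x, r < `|x| -> h x = 0) -> (forall x, r < `|x| -> dh x = 0) ->
  \int[mu]_x (if x < 0 then dh x else 0) = h 0.
Proof.
move=> hd cd hr dr; have r0 := normr_ge0 r; have rr := ler_norm r.
pose a := - (`|r| + 1); have a0 : a <= 0 by rewrite /a; lra.
rewrite (_ : \int[mu]_x _ = \int[mu]_(x in `[a, 0[) dh x); last first.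
  rewrite [RHS]Rintegral_mkcond; apply: eq_Rintegral => x _.
  rewrite patchE mem_setE in_itv/=; case: ifPn => [x0|]; last by rewrite andbF.
  rewrite andbT; case: ifPn => // xa; apply: dr.
  have : x < a by rewrite ltNge.
  by rewrite /a => xa'; rewrite ltr0_norm//; lra.
rewrite Rintegral_itv_bndo_bndc; last first.
  apply: integrableS (@continuous_integrable_itv _ dh a 0 cd) => //.
  exact: subset_itv_co_cc.
rewrite (Rintegral_deriv hd cd)// [h a]hr ?subr0//.
by rewrite /a normrN gtr0_norm; lra.
Qed.

Lemma testfun_slice1 K y : testfun K -> exists r, (forall x, r < `|x| -> K x y = 0) /\ (forall x, r < `|x| -> d1 K x y = 0).
Proof.
move=> kK; have [_ [r hr]] := kK; have [_ [s hs]] := testfun_d1 kK.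
exists (Num.max r s); split => x; rewrite gt_max => /andP[rx sx].
  by apply/hr/boxN; rewrite rx.
by apply/hs/boxN; rewrite sx.
Qed.

Lemma testfun_slice2 K x : testfun K -> exists r, (forall y, r < `|y| -> K x y = 0) /\ (forall y, r < `|y| -> d2 K x y = 0).
Proof.
move=> kK; have [_ [r hr]] := kK; have [_ [s hs]] := testfun_d2 kK.
exists (Num.max r s); split => y; rewrite gt_max => /andP[rx sx].
  by apply/hr/boxN; rewrite rx orbT.
by apply/hs/boxN; rewrite sx orbT.
Qed.

Lemma I2_d1_testfun K : testfun K -> I2 (fun p => d1 K p.1 p.2) = 0.
Proof.
move=> kK; rewrite I2_fubini21; last exact/boxed_testfun/testfun_d1.
transitivity (\int[mu]_(t in setT) (0 : R)); last by rewrite Rintegral_cst// mul0r.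
apply: eq_Rintegral => t _ /=.
have [r [h1 h2]] := testfun_slice1 t kK.
apply: (Rintegral_deriv_line (h := K ^~ t) (r := r)) => //.
  by move=> x; exact: (Ck_d1 (testfun_smooth 1 kK)).
exact: jcont_l (Ck_jcont (testfun_smooth 0 (testfun_d1 kK))).
Qed.

Lemma I2_d2_testfun K : testfun K -> I2 (fun p => d2 K p.1 p.2) = 0.
Proof.
move=> kK; rewrite I2_fubini12; last exact/boxed_testfun/testfun_d2.
transitivity (\int[mu]_(t in setT) (0 : R)); last by rewrite Rintegral_cst// mul0r.
apply: eq_Rintegral => t _ /=.
have [r [h1 h2]] := testfun_slice2 t kK.
apply: (Rintegral_deriv_line (h := K t) (r := r)) => //.
  by move=> x; exact: (Ck_d2 (testfun_smooth 1 kK)).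
exact: jcont_r (Ck_jcont (testfun_smooth 0 (testfun_d2 kK))).
Qed.

Lemma d1_shift K (a b : R) : testfun K ->
  d1 (fun x y => K (x - a) (y - b)) = (fun x y => d1 K (x - a) (y - b)).
Proof.
move=> kK; apply/funext => x; apply/funext => y; apply: is_derive_derive1.
exact: der1_shift (testfun_smooth 1 kK).
Qed.

Lemma d2_shift K (a b : R) : testfun K ->
  d2 (fun x y => K (x - a) (y - b)) = (fun x y => d2 K (x - a) (y - b)).
Proof.
move=> kK; apply/funext => x; apply/funext => y; apply: is_derive_derive1.
exact: der2_shift (testfun_smooth 1 kK).
Qed.

(** Translation invariance of the integral of a test function: its derivatives with
    respect to the translation are integrals of derivatives. *)
Lemma I2_shift K (a b : R) : testfun K ->
  I2 (fun p => K (p.1 - a) (p.2 - b)) = I2 (fun p => K p.1 p.2).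
Proof.
move=> kK; have m1 : measurable_fun setT (cst 1 : R * R -> R) by [].
have b1 (p : R * R) : `|cst 1 p : R| <= 1 by rewrite normr1.
have mol1 K' x t : mol K' (cst 1) x t = I2 (fun p => K' (p.1 - x) (p.2 - t)).
  by apply: eq_I2 => p; rewrite /= mul1r.
rewrite -mol1 (@derive0_cst _ (mol K (cst 1) ^~ b) _ a 0).
  rewrite (@derive0_cst _ (mol K (cst 1) 0) _ b 0) ?mol1.
    by apply: eq_I2 => p; rewrite !subr0.
  move=> t; apply: (der_eq (der2_mol m1 b1 0 t kK)).
  by rewrite mol1; have := I2_d2_testfun (testfun_shift 0 t kK); rewrite d2_shift// => ->; rewrite oppr0.
move=> t; apply: (der_eq (der1_mol m1 b1 t b kK)).
by rewrite mol1; have := I2_d1_testfun (testfun_shift t b kK); rewrite d1_shift// => ->; rewrite oppr0.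
Qed.

Lemma mol_norm_le g (G : R) K x t : measurable_fun setT g -> (forall p, `|g p| <= G) -> testfun K ->
  (forall x y, 0 <= K x y) -> I2 (fun p => K p.1 p.2) = 1 -> `|mol K g x t| <= G.
Proof.
move=> mg gG kK K0 K1; apply: (le_trans (I2_norm (boxed_mol mg gG x t kK))).
apply: (@le_trans _ _ (I2 (fun p => G * K (p.1 - x) (p.2 - t)))).
  apply: le_I2; first exact/boxed_norm/(boxed_mol mg gG x t kK).
    by apply: boxedZ; exact: (boxed_testfun (testfun_shift x t kK)).
  by move=> p; rewrite normrM (ger0_norm (K0 _ _)) ler_wpM2r.
by rewrite I2Z ?I2_shift// ?K1 ?mulr1//; exact: (boxed_testfun (testfun_shift x t kK)).
Qed.

End test_functions.

(** * Approximate identities *)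

Section approximate_identity.
Context {R : realType}.
Local Notation mu := (@lebesgue_measure R).
Local Notation mu2 := (mu \x mu)%E.
Implicit Types (h : R -> R) (g : R * R -> R) (n : nat).

(** The support lies to the right of 0, so that averages around a time [t >= 0]
    only involve later times. *)
Definition raw n (x : R) : R := flatexp ((n.+1%:R : R) * x) * flatexp (1 - (n.+1%:R : R) * x).
Definition mass n : R := \int[mu]_x raw n x.
Definition rho n (x : R) := (mass n)^-1 * raw n x.

Let N0 n : 0 < n.+1%:R :> R. Proof. by rewrite ltr0n. Qed.

Lemma Ck_raw k n : Ck k (fun x _ : R => raw n x).
Proof.
have c : Ck k (fun x _ : R => n.+1%:R * x) by apply: CkM; [exact: Ck_cst|exact: Ck_fst].
by apply: CkM; apply: Ck_flat => //; apply: CkB => //; exact: Ck_cst.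
Qed.

Lemma raw_ge0 n x : 0 <= raw n x.
Proof. by rewrite mulr_ge0 ?flatexp_ge0. Qed.

Lemma raw_le1 n x : raw n x <= 1.
Proof. by rewrite -[leRHS]mulr1 ler_pM ?flatexp_ge0 ?flatexp_le1. Qed.

Lemma raw_support n x : ~~ (0 < x < n.+1%:R^-1) -> raw n x = 0.
Proof.
rewrite negb_and -!leNgt => /orP[x0|Nx]; rewrite /raw.
  by rewrite flatexp_le0 ?mul0r// pmulr_rle0.
by rewrite (@flatexp_le0 _ (1 - _)) ?mulr0// subr_le0 -ler_pdivrMl// mulr1.
Qed.

Lemma continuous_raw n : continuous (raw n).
Proof. exact: jcont_l 0 (Ck_jcont (Ck_raw 0 n)). Qed.

Lemma boxed1_raw n a : boxed1 (fun x => raw n (x - a)).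
Proof.
exists (1 + `|a|), 1; split.
- apply: continuous_measurable_fun => x.
  apply: (@continuous_comp _ _ _ (fun x => x - a) (raw n)); last exact: continuous_raw.
  by apply: cvgB; [exact: cvg_id|exact: cvg_cst].
- by move=> x; rewrite ger0_norm ?raw_ge0// raw_le1.
- move=> x ax; apply: raw_support; apply/negP => /andP[x0 xN].
  have N1 : n.+1%:R^-1 <= 1 :> R by rewrite invf_le1// ler1n.
  have {xN N1} xa1 := lt_le_trans xN N1.
  by have := ler_normD (x - a) a; rewrite subrK (gtr0_norm x0) => ?; lra.
Qed.

Lemma inv_le1 n : n.+1%:R^-1 <= 1 :> R.
Proof. by rewrite invf_le1// ler1n. Qed.

Lemma prim_raw_cst n u v : (forall x, Num.min u v <= x <= Num.max u v -> raw n x = 0) ->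
  prim (raw n) v = prim (raw n) u.
Proof.
move=> uv; apply/eqP; rewrite -subr_eq0 -normr_le0 -(mul0r `|v - u|).
by apply: (prim_lipschitz (@continuous_raw n)) => x /uv ->; rewrite normr0.
Qed.

Lemma mass_shift n a : \int[mu]_x raw n (x - a) = mass n.
Proof.
have shift b : \int[mu]_x raw n (x - b) = prim (raw n) 1.
  pose r := 1 + `|b|; have nb := normr_ge0 b; have bb := ler_norm b.
  have bb' : - b <= `|b| by rewrite -normrN ler_norm.
  rewrite (@Rintegral_support _ _ (- r) r); last first.
    move=> x xr; apply: raw_support; apply/negP => /andP[x0 xN]; move/negP: xr; apply.
    have {xN} xb1 := lt_le_trans xN (inv_le1 n); apply/andP; rewrite /r; split; lra.
  have hd (x : R) : is_derive x 1 (fun x => prim (raw n) (x - b)) (raw n (x - b)).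
    apply: (der_eq (der_comp (h := prim (raw n)) (der_prim _ (@continuous_raw n)) (der_shift b x))).
    by rewrite mulr1.
  rewrite (Rintegral_deriv hd).
  - rewrite [X in _ - X](@prim_raw_cst n 0); last first.
      move=> x /andP[_]; rewrite le_max => x0; apply: raw_support; rewrite negb_and -leNgt.
      by apply/orP; left; case/orP: x0 => //; rewrite /r; lra.
    rewrite prim0 subr0; apply: prim_raw_cst => x /andP[x1 _]; apply: raw_support.
    rewrite negb_and -!leNgt; apply/orP; right; apply: (le_trans (inv_le1 n)).
    by move: x1; rewrite ge_min => /orP[//|]; rewrite /r; lra.
  - move=> x; apply: (@continuous_comp _ _ _ (fun x => x - b) (raw n)); last exact: continuous_raw.
    by apply: cvgB; [exact: cvg_id|exact: cvg_cst].
  - by rewrite /r; lra.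
rewrite shift -(shift 0) /mass; apply: eq_Rintegral => x _; by rewrite subr0.
Qed.

(** The bump is bounded below on the middle half of its support, so [rho n] is at most a
    multiple of [n + 1] and Lebesgue differentiation applies. *)
Lemma mass_gt0 : exists2 B, 0 < B & forall n, B / n.+1%:R <= mass n.
Proof.
pose b := flatexp (4%:R^-1 : R); have b0 : 0 < b by apply: flatexp_gt0; rewrite invr_gt0.
exists (b ^+ 2 / 2) => [|n]; first by rewrite divr_gt0// exprn_gt0.
pose l : R := 4%:R^-1 / n.+1%:R; pose r : R := 3%:R / 4%:R / n.+1%:R.
have lr : l <= r by rewrite /l /r ler_wpM2r ?invr_ge0//; lra.
apply: (@le_trans _ _ (\int[mu]_(x in `[l, r]) b ^+ 2)).
  rewrite Rintegral_cst//= lebesgue_measure_itv/= lte_fin.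
  rewrite ifT -?EFinB/=; last by rewrite /l /r ltr_pM2r ?invr_gt0//; lra.
  have -> : r - l = 2^-1 / n.+1%:R by rewrite /l /r; field; rewrite addrC natr1.
  by rewrite mulrA.
rewrite /mass Rintegral_mkcond; apply: le_Rintegral => //.
- rewrite (_ : EFin \o _ = (EFin \o cst (b ^+ 2)) \_ `[l, r]); last by rewrite restrict_EFin.
  apply/integrable_restrict => //; rewrite setTI.
  by apply: continuous_integrable_itv => x; exact: cvg_cst.
- have := boxed1_integrable (boxed1_raw n 0); apply: eq_integrable => // x _ /=; by rewrite subr0.
- move=> x _; rewrite patchE mem_setE in_itv/=; case: ifPn => [/andP[lx xr]|_]; last exact: raw_ge0.
  rewrite expr2 /raw; apply: ler_pM; rewrite ?(ltW b0)//; apply: le_flatexp.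
    by rewrite mulrC -ler_pdivrMr.
  rewrite lerBrDr -lerBrDl mulrC -ler_pdivlMr//; apply: (le_trans xr).
  by rewrite /r ler_wpM2r ?invr_ge0//; lra.
Qed.

Lemma mass_pos n : 0 < mass n.
Proof. by have [B B0 hB] := mass_gt0; apply: lt_le_trans (hB n); rewrite divr_gt0. Qed.

Lemma rho_ge0 n x : 0 <= rho n x.
Proof. by rewrite mulr_ge0 ?raw_ge0// invr_ge0 ltW// mass_pos. Qed.

Lemma rho_support n x : ~~ (0 < x < n.+1%:R^-1) -> rho n x = 0.
Proof. by move=> /raw_support; rewrite /rho => ->; rewrite mulr0. Qed.

Lemma rho_bound : exists2 B, 0 < B & forall n x, rho n x <= B * n.+1%:R.
Proof.
have [B B0 hB] := mass_gt0; exists B^-1 => [|n x]; first by rewrite invr_gt0.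
apply: (@le_trans _ _ (mass n)^-1).
  by rewrite -[leRHS]mulr1 ler_wpM2l ?raw_le1// invr_ge0 ltW// mass_pos.
rewrite -[leRHS]invrK lef_pV2 ?posrE ?mass_pos ?invr_gt0 ?mulr_gt0 ?invr_gt0//.
by rewrite invfM invrK hB.
Qed.

Lemma continuous_rho n : continuous (rho n).
Proof. by move=> x; apply: cvgM; [exact: cvg_cst|exact: continuous_raw]. Qed.

Lemma boxed1_rho n a : boxed1 (fun x => rho n (x - a)).
Proof.
have [r [C [m1 h1 h2]]] := boxed1_raw n a.
exists r, ((mass n)^-1 * C); split; first exact: measurable_funM.
  by move=> x; rewrite normrM gtr0_norm ?invr_gt0 ?mass_pos// ler_wpM2l// invr_ge0 ltW// mass_pos.
by move=> x /h2; rewrite /rho => ->; rewrite mulr0.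
Qed.

Lemma rho_shift n a : \int[mu]_x rho n (x - a) = 1.
Proof.
rewrite /rho RintegralZl//; last exact: boxed1_integrable (boxed1_raw n a).
by rewrite mass_shift mulVf// gt_eqF// mass_pos.
Qed.

Definition avg n h x : R := \int[mu]_y (rho n (y - x) * h y).

Section avg1.
Variables (h : R -> R) (G : R).
Hypotheses (mh : measurable_fun setT h) (hG : forall x, `|h x| <= G).

Let G0 : 0 <= G. Proof. exact: le_trans (normr_ge0 _) (hG 0). Qed.

Lemma boxed1_avg n x : boxed1 (fun y => rho n (y - x) * h y).
Proof.
have [r [C [m1 h1 h2]]] := boxed1_rho n x.
exists r, (C * G); split; first exact: measurable_funM.
  by move=> y; rewrite normrM ler_pM.
by move=> y /h2 ->; rewrite mul0r.
Qed.

Lemma avg_norm_le n x : `|avg n h x| <= G.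
Proof.
apply: (le_trans (le_normr_Rintegral _ (boxed1_integrable (boxed1_avg n x)))) => //.
apply: (@le_trans _ _ (\int[mu]_y (rho n (y - x) * G))).
  apply: le_Rintegral => //.
  - have [r [C [m1 h1 h2]]] := boxed1_avg n x.
    apply: boxed1_integrable; exists r, C; split; first exact: measurableT_comp.
      by move=> y; rewrite normr_id.
    by move=> y /h2 ->; rewrite normr0.
  - have [r [C [m1 h1 h2]]] := boxed1_rho n x.
    apply: boxed1_integrable; exists r, (C * G); split; first exact: measurable_funM.
      by move=> y; rewrite normrM ler_pM// ger0_norm.
    by move=> y /h2 ->; rewrite mul0r.
  - by move=> y _; rewrite normrM ger0_norm ?rho_ge0// ler_wpM2l ?rho_ge0.
by rewrite RintegralZr// ?rho_shift ?mul1r//; exact: boxed1_integrable (boxed1_rho n x).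
Qed.

Lemma avg_lebesgue_pt x : lebesgue_pt h x -> avg n h x @[n --> \oo] --> h x.
Proof.
move=> hx; have [B B0 hB] := rho_bound.
have bound n : `|h x - avg n h x| <= 2 * B * fine (davg h x n.+1%:R^-1).
  have N1 : 0 < n.+1%:R^-1 :> R by rewrite invr_gt0.
  have bb : boxed1 (fun y => rho n (y - x) * (h y - h x)).
    have [r [C [m1 h1 h2]]] := boxed1_rho n x.
    exists r, (C * (G + G)); split; first by apply: measurable_funM => //; exact: measurable_funB.
      by move=> y; rewrite normrM ler_pM// (le_trans (ler_normB _ _))// lerD.
    by move=> y /h2 ->; rewrite mul0r.
  have -> : h x - avg n h x = - \int[mu]_y (rho n (y - x) * (h y - h x)).
    under eq_Rintegral do rewrite mulrBr.
    rewrite RintegralB//; [|exact: boxed1_integrable (boxed1_avg n x)|].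
      by rewrite RintegralZr ?rho_shift ?mul1r ?opprB//; exact: boxed1_integrable (boxed1_rho n x).
    have [r [C [m1 h1 h2]]] := boxed1_rho n x.
    apply: boxed1_integrable; exists r, (C * G); split; first exact: measurable_funM.
      by move=> y; rewrite normrM ler_pM.
    by move=> y /h2 ->; rewrite mul0r.
  rewrite normrN.
  apply: (le_trans (le_normr_Rintegral _ (boxed1_integrable bb))) => //.
  have mball : measurable (ball x n.+1%:R^-1) by exact: measurable_ball.
  pose k y := B * n.+1%:R * `|h y - h x|.
  have bk : boxed1 (k \_ (ball x n.+1%:R^-1)).
    exists (1 + `|x|), (B * n.+1%:R * (G + G)); split.
    - apply/(measurable_restrictT _ mball)/measurable_funTS; apply: measurable_funM => //.
      by apply: measurableT_comp => //; exact: measurable_funB.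
    - have k0 : 0 <= B * n.+1%:R by rewrite mulr_ge0// ltW.
      move=> y; rewrite patchE; case: ifPn => _; last by rewrite normr0 mulr_ge0// addr_ge0.
      rewrite normrM normr_id (ger0_norm k0) ler_wpM2l//.
      by rewrite (le_trans (ler_normB _ _))// lerD.
    - move=> y xy; rewrite patchE memNset// /ball/= => yx.
      have {}yx := lt_le_trans yx (inv_le1 n).
      by have := ler_normD (y - x) x; rewrite subrK distrC => ?; lra.
  apply: (@le_trans _ _ (\int[mu]_y (k \_ (ball x n.+1%:R^-1)) y)).
    apply: le_Rintegral => //.
    - have [r [C [m1 h1 h2]]] := bb.
      apply: boxed1_integrable; exists r, C; split; first exact: measurableT_comp.
        by move=> y; rewrite normr_id.
      by move=> y /h2 ->; rewrite normr0.
    - exact: boxed1_integrable.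
    - move=> y _; rewrite patchE; case: ifPn => [_|].
        by rewrite normrM ger0_norm ?rho_ge0// /k ler_wpM2r.
      rewrite notin_setE /ball/= => /negP; rewrite -leNgt => yx.
      rewrite rho_support ?mul0r ?normr0// negb_and -!leNgt.
      move: yx; have [xy|xy] := leP x y; last by rewrite subr_le0 (ltW xy).
      by rewrite distrC ger0_norm ?subr_ge0// => ->; rewrite orbT.
  rewrite -Rintegral_mkcond /k /davg /iavg.
  have intb : mu.-integrable (ball x n.+1%:R^-1) (EFin \o (fun y => `|h y - h x|)).
    apply: measurable_bounded_integrable => //.
    - by rewrite /= lebesgue_measure_ball ?ltry// ltW.
    - by apply/measurable_funTS/measurableT_comp => //; exact: measurable_funB.
    - exists (G + G); split; first exact: num_real.
      move=> M GM y _ /=; rewrite normr_id (le_trans _ (ltW GM))//.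
      by rewrite (le_trans (ler_normB _ _))// lerD.
  rewrite RintegralZl// lebesgue_measure_ball ?(ltW N1)//.
  rewrite inver mulrn_eq0/= gt_eqF// fineM//=; last first.
    exact: integrable_fin_num intb.
  rewrite -[X in _ <= 2 * B * (_ * X)]/(\int[mu]_(y in ball x n.+1%:R^-1) `|h y - h x|).
  rewrite mulrA ler_wpM2r ?Rintegral_ge0//.
  rewrite (_ : 2 * B * _ = B * n.+1%:R)//.
  by rewrite -[X in X^-1]mulr_natr invfM invrK; field.
have h0 : fine (davg h x r) @[r --> 0^'+] --> (0 : R) by exact: fine_cvg hx.
apply/cvgrPdist_le => /= e e0.
have e'0 : 0 < e / (2 * B) by rewrite divr_gt0// mulr_gt0.
move/cvgrPdist_le: h0 => /(_ _ e'0)[d /= d0 hd].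
near=> n; apply: (le_trans (bound n)).
have N1 : 0 < n.+1%:R^-1 :> R by rewrite invr_gt0.
have /hd/(_ N1) : `|0 - n.+1%:R^-1| < d.
  by rewrite sub0r normrN gtr0_norm//; near: n; exact: near_infty_natSinv_lt (PosNum d0).
rewrite sub0r normrN => /(le_trans (ler_norm _)).
by rewrite ler_pdivlMr ?mulr_gt0// mulrC.
Unshelve. all: by end_near. Qed.

End avg1.

Lemma boxed1_dct (k : nat -> R -> R) (r C : R) : (forall n, measurable_fun setT (k n)) ->
  (forall n x, `|k n x| <= C) -> (forall n x, r < `|x| -> k n x = 0) ->
  {ae mu, forall x, k n x @[n --> \oo] --> (0 : R)} ->
  \int[mu]_x k n x @[n --> \oo] --> (0 : R).
Proof.
move=> mk kC kr k0.
have C0 : 0 <= C := le_trans (normr_ge0 _) (kC 0%N 0).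
pose b : R -> R := (cst C) \_ `[- r, r].
have bb : boxed1 b.
  exists r, C; split.
  - have mI : measurable (`[- r, r] : set R) by [].
    by apply/(measurable_restrictT _ mI).
  - by move=> x; rewrite /b patchE; case: ifPn; rewrite ?normr0 ?ger0_norm.
  - by move=> x rx; rewrite /b patchE memNset//= in_itv/= -ler_norml => xr; move: (lt_le_trans rx xr); rewrite ltxx.
have mE n : measurable_fun setT (EFin \o k n) by exact/measurable_EFinP.
have k0E : {ae mu, forall x, setT x -> (EFin \o k n) x @[n --> \oo] --> (cst 0%E x : \bar R)}.
  by move: k0; apply: ae_imp => x kx _; apply: cvg_EFin => //; exact: nearW.
have kb : {ae mu, forall x n, setT x -> (`|(EFin \o k n) x| <= (EFin \o b) x)%E}.
  apply: aeW => x n _ /=; rewrite lee_fin /b patchE; case: ifPn => [_|]; first exact: kC.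
  rewrite notin_setE/= in_itv/= -ler_norml => /negP; rewrite -ltNge => /kr ->.
  by rewrite normr0.
have m0 : measurable_fun [set: R] (cst 0%E : R -> \bar R) by exact: measurable_cst.
have [_ _] := @dominated_convergence _ _ R mu setT measurableT (fun n => EFin \o k n) (cst 0%E) (EFin \o b)
  mE m0 k0E (boxed1_integrable bb) kb.
rewrite integral0; exact: fine_cvg.
Qed.

Lemma ae_avg (h : R -> R) (G : R) : measurable_fun setT h -> (forall x, `|h x| <= G) ->
  {ae mu, forall x, avg n h x @[n --> \oo] --> h x}.
Proof.
move=> mh hG; have lh : locally_integrable setT h.
  split => //; first exact: openT.
  move=> K _ cK.
  have mK := compact_measurable cK.
  have : mu.-integrable K (EFin \o h).
    apply: measurable_bounded_integrable => //; first exact: compact_finite_measure.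
      exact: measurable_funTS.
    exists G; split; first exact: num_real.
    by move=> M GM y _ /=; rewrite (le_trans _ (ltW GM)).
  by move=> /integrableP[_].
have := lebesgue_differentiation lh; apply: ae_imp => x.
exact: (avg_lebesgue_pt mh hG).
Qed.

Lemma boxed1_bound h (r C : R) : 0 <= r -> 0 <= C -> measurable_fun setT h ->
  (forall x, `|h x| <= C) -> (forall x, r < `|x| -> h x = 0) ->
  `|\int[mu]_x h x| <= C * (r *+ 2).
Proof.
move=> r0 C0 mh hC hr.
have bh : boxed1 h by exists r, C.
rewrite (@Rintegral_support _ _ (- r) r); last first.
  by move=> x; rewrite -ler_norml -ltNge; exact: hr.
have ih : mu.-integrable `[- r, r] (EFin \o h).
  exact: integrableS (boxed1_integrable bh).
apply: (le_trans (le_normr_Rintegral _ ih)) => //.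
apply: (@le_trans _ _ (\int[mu]_(x in `[- r, r]) C)).
  apply: le_Rintegral => //.
  - have [r' [C' [m1 h1 h2]]] := bh.
    apply: (integrableS (E := setT)) => //; apply: boxed1_integrable.
    exists r', C'; split; first exact: measurableT_comp.
      by move=> y; rewrite normr_id.
    by move=> y /h2 ->; rewrite normr0.
  - by apply: continuous_integrable_itv => x; exact: cvg_cst.
rewrite Rintegral_cst//= lebesgue_measure_itv/= lte_fin; case: ifPn => [_|_].
  by rewrite -EFinB/= opprK mulr2n.
by rewrite mulr0 mulr_ge0// mulrn_wge0.
Qed.

Definition avgx n g (p : R * R) : R := avg n (fun y => g (y, p.2)) p.1.

Section avgx.
Variables (g : R * R -> R) (G : R).
Hypotheses (mg : measurable_fun setT g) (gG : forall p, `|g p| <= G).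

Let G0 : 0 <= G. Proof. exact: le_trans (normr_ge0 _) (gG (0, 0)). Qed.

Let mg1 t : measurable_fun setT (fun y => g (y, t)).
Proof. by apply: (measurableT_comp mg); exact: measurable_fun_pair. Qed.

Lemma avgx_norm_le n p : `|avgx n g p| <= G.
Proof. by apply: (avg_norm_le (mg1 p.2)). Qed.

Lemma measurable_avgx n : measurable_fun setT (avgx n g).
Proof.
apply: (@measurable_Rintegral_param R _ (R * R)%type (fun q : (R * R) * R => rho n (q.2 - q.1.1) * g (q.2, q.1.2))).
  apply: measurable_funM.
    apply: (measurableT_comp (f := rho n)).
      by apply: continuous_measurable_fun; exact: continuous_rho.
    by apply: measurable_funB => //; apply: (measurableT_comp measurable_fst).
  apply: (measurableT_comp mg); apply: measurable_fun_pair => //.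
  exact: (measurableT_comp measurable_snd).
by move=> p; apply: (boxed1_avg (mg1 p.2)).
Qed.

Lemma boxed_err (k : R * R -> R) (r : R) : measurable_fun setT k -> (forall p, `|k p| <= G) ->
  boxed (fun p => `|g p - k p| * \1_(box r) p).
Proof.
move=> mk kG; apply: boxedM; last 2 first.
- exact: boxed_indic.
- exists (G + G) => p _; rewrite normr_id (le_trans (ler_normB _ _))// lerD//.
- by apply: measurableT_comp => //; exact: measurable_funB.
Qed.

(** Almost every point of almost every line is a Lebesgue point of the restriction of [g]
    to that line; Fubini's theorem and dominated convergence do the rest. *)
Lemma avgx_L1 (r : R) : 0 <= r ->
  I2 (fun p => `|g p - avgx n g p| * \1_(box r) p) @[n --> \oo] --> (0 : R).
Proof.
move=> r0.
have be n := boxed_err r (measurable_avgx n) (avgx_norm_le n).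
have eb n p : `| (`|g p - avgx n g p| * \1_(box r) p) | <= G + G.
  rewrite normrM normr_id -[leRHS]mulr1 ler_pM//.
    by rewrite (le_trans (ler_normB _ _))// lerD// avgx_norm_le.
  by rewrite indicE; case: (_ \in _); rewrite ?normr1 ?normr0.
have es n x t : (r < `|x|) || (r < `|t|) -> `|g (x, t) - avgx n g (x, t)| * \1_(box r) (x, t) = 0.
  by move=> /boxN xt; rewrite indicE memNset// mulr0.
rewrite (_ : (fun n => I2 _) = (fun n => \int[mu]_t \int[mu]_x (`|g (x, t) - avgx n g (x, t)| * \1_(box r) (x, t)))); last first.
  by apply/funext => n; exact: I2_fubini21 (be n).
apply: (@boxed1_dct _ r ((G + G) * (r *+ 2))).
- move=> n; apply: (@measurable_Rintegral_param R _ R (fun q : R * R => `|g (q.2, q.1) - avgx n g (q.2, q.1)| * \1_(box r) (q.2, q.1))).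
    have [? [? [m _ _]]] := be n.
    apply: (measurableT_comp m); exact: measurable_swap.
  by move=> t; exact: (boxed_slice1 t (be n)).
- move=> n t; apply: boxed1_bound => //; first exact: addr_ge0.
    by have [? [? [m _ _]]] := boxed_slice1 t (be n).
  by move=> x rx; apply: es; rewrite rx.
- move=> n t rt; transitivity (\int[mu]_(x in setT) (0 : R)); last by rewrite Rintegral_cst// mul0r.
  by apply: eq_Rintegral => x _; apply: es; rewrite rt orbT.
- apply: aeW => t; apply: (@boxed1_dct _ r (G + G)).
  + by move=> n; have [? [? [m _ _]]] := boxed_slice1 t (be n).
  + by move=> n x; exact: eb.
  + by move=> n x rx; apply: es; rewrite rx.
  + have := ae_avg (mg1 t) (fun y => gG (y, t)); apply: ae_imp => x hx.
    rewrite -(mul0r (\1_(box r) (x, t))); apply: cvgM; last exact: cvg_cst.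
    rewrite -(normr0 R) -(subrr (g (x, t))); apply: cvg_norm; apply: cvgB; first exact: cvg_cst.
    exact: hx.
Qed.

End avgx.

Lemma boxed_swap g : boxed g -> boxed (g \o swap_pair).
Proof.
move=> [r [C [mg gC gr]]]; exists r, C; split.
- by apply: (measurableT_comp mg); exact: measurable_swap.
- by move=> p; exact: gC.
- move=> [x y] nb; apply: gr => /= /boxE[? ?]; apply: nb; exact/boxE.
Qed.

Lemma I2_swap g : boxed g -> I2 (g \o swap_pair) = I2 g.
Proof. by move=> bg; rewrite (I2_fubini21 (boxed_swap bg)) (I2_fubini12 bg). Qed.

Definition avgt n g (p : R * R) : R := avg n (fun s => g (p.1, s)) p.2.

Section avgt.
Variables (g : R * R -> R) (G : R).
Hypotheses (mg : measurable_fun setT g) (gG : forall p, `|g p| <= G).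

Let ms : measurable_fun setT (g \o swap_pair).
Proof. by apply: (measurableT_comp mg); exact: measurable_swap. Qed.

Let sG p : `|(g \o swap_pair) p| <= G. Proof. exact: gG. Qed.

Let avgtE n : avgt n g = avgx n (g \o swap_pair) \o swap_pair.
Proof. by apply/funext => -[x y]. Qed.

Lemma avgt_norm_le n p : `|avgt n g p| <= G.
Proof. by rewrite avgtE /=; exact: (avgx_norm_le ms sG). Qed.

Lemma measurable_avgt n : measurable_fun setT (avgt n g).
Proof.
by rewrite avgtE; apply: (measurableT_comp (measurable_avgx ms sG n)); exact: measurable_swap.
Qed.

Lemma avgt_L1 (r : R) : 0 <= r ->
  I2 (fun p => `|g p - avgt n g p| * \1_(box r) p) @[n --> \oo] --> (0 : R).
Proof.
move=> r0; suff -> : (fun n => I2 (fun p => `|g p - avgt n g p| * \1_(box r) p)) =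
    (fun n => I2 (fun p => `|(g \o swap_pair) p - avgx n (g \o swap_pair) p| * \1_(box r) p)).
  exact: (avgx_L1 ms sG r0).
apply/funext => n; rewrite -[LHS]I2_swap; last first.
  exact: (boxed_err mg gG r (measurable_avgt n) (avgt_norm_le n)).
apply: eq_I2 => -[x y] /=; rewrite avgtE/=; congr (_ * _).
rewrite !indicE; congr (_%:R); congr (nat_of_bool _).
by apply/idP/idP; rewrite !inE => /boxE[? ?]; apply/boxE.
Qed.

End avgt.

End approximate_identity.

(** * Mollified conservation laws and their potentials *)

Section mollifier.
Context {R : realType}.
Local Notation mu := (@lebesgue_measure R).
Local Notation mu2 := (mu \x mu)%E.
Implicit Types (g : R * R -> R) (n m : nat).

Definition moll n m (x t : R) : R := rho n x * rho m t.

Lemma Ck_rho1 k n : Ck k (fun x _ : R => rho n x).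
Proof. by apply: CkM; [exact: Ck_cst|exact: Ck_raw]. Qed.

Lemma Ck_rho2 k n : Ck k (fun _ t : R => rho n t).
Proof.
apply: CkM; first exact: Ck_cst.
have c : Ck k (fun _ t : R => (n.+1%:R : R) * t) by apply: CkM; [exact: Ck_cst|exact: Ck_snd].
by apply: CkM; apply: Ck_flat => //; apply: CkB => //; exact: Ck_cst.
Qed.

Lemma moll_support n m x t : ~~ ((0 < x < n.+1%:R^-1) && (0 < t < m.+1%:R^-1)) -> moll n m x t = 0.
Proof. by rewrite negb_and => /orP[]/rho_support h; rewrite /moll h ?mul0r ?mulr0. Qed.

Lemma testfun_moll n m : testfun (moll n m).
Proof.
split; first by move=> k; apply: CkM; [exact: Ck_rho1|exact: Ck_rho2].
exists 1 => x t nb; apply: moll_support; apply/negP => /andP[/andP[x0 x1] /andP[t0 t1]].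
apply/nb/boxE; rewrite !gtr0_norm//.
by split; apply: ltW; [exact: lt_le_trans x1 (inv_le1 n)|exact: lt_le_trans t1 (inv_le1 m)].
Qed.

Lemma moll_ge0 n m x t : 0 <= moll n m x t.
Proof. by rewrite mulr_ge0 ?rho_ge0. Qed.

Lemma mol_avg g (G : R) n m x t : measurable_fun setT g -> (forall p, `|g p| <= G) ->
  mol (moll n m) g x t = avgt m (avgx n g) (x, t).
Proof.
move=> mg gG; rewrite /mol I2_fubini21; last exact: (boxed_mol mg gG x t (testfun_moll n m)).
apply: eq_Rintegral => s _ /=; rewrite /avgx /avg/= -RintegralZl//; last first.
  apply: boxed1_integrable; apply: (@boxed1_avg _ _ G) => [|y]; last exact: gG.
  by apply: (measurableT_comp mg); exact: measurable_fun_pair.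
by apply: eq_Rintegral => y _; rewrite /moll; ring.
Qed.

Lemma I2_moll n m : I2 (fun p => moll n m p.1 p.2) = 1.
Proof.
have m1 : measurable_fun setT (cst 1 : R * R -> R) by [].
have c1 (p : R * R) : `|cst 1 p : R| <= 1 by rewrite normr1.
have h := mol_avg n m 0 0 m1 c1; rewrite /mol in h.
transitivity (I2 (fun p : R * R => cst 1 p * moll n m (p.1 - 0) (p.2 - 0))).
  by apply: eq_I2 => p; rewrite /= mul1r !subr0.
rewrite h.
have avg1 k x : avg k (cst 1) x = 1.
  by rewrite /avg; under eq_Rintegral do rewrite /= mulr1; exact: rho_shift.
rewrite /avgt /avgx/= (_ : (fun s => avg n (fun y => cst 1 (y, s)) 0) = cst 1) ?avg1//.
by apply/funext => s; exact: avg1.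
Qed.

(** Averaging first in [x], then in [t]: [n] is chosen for the first average and then [m],
    depending on [n], for the second. *)
Lemma mol_L1 (g1 g2 : R * R -> R) (G r e : R) (N : nat) :
  measurable_fun setT g1 -> (forall p, `|g1 p| <= G) ->
  measurable_fun setT g2 -> (forall p, `|g2 p| <= G) -> 0 <= r -> 0 < e ->
  exists n m, [/\ (N <= n)%N, (N <= m)%N,
    I2 (fun p => `|g1 p - mol (moll n m) g1 p.1 p.2| * \1_(box r) p) <= e &
    I2 (fun p => `|g2 p - mol (moll n m) g2 p.1 p.2| * \1_(box r) p) <= e].
Proof.
move=> m1 G1 m2 G2 r0 e0; have e20 : 0 < e / 2 by rewrite divr_gt0.
have cvx g : measurable_fun setT g -> (forall p, `|g p| <= G) ->
    \forall n \near \oo, I2 (fun p => `|g p - avgx n g p| * \1_(box r) p) <= e / 2.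
  move=> mg gG; have /cvgrPdist_le/(_ _ e20) := avgx_L1 mg gG r0.
  by apply: filterS => n; rewrite sub0r normrN; exact/le_trans/ler_norm.
have cvt g : measurable_fun setT g -> (forall p, `|g p| <= G) ->
    \forall n \near \oo, I2 (fun p => `|g p - avgt n g p| * \1_(box r) p) <= e / 2.
  move=> mg gG; have /cvgrPdist_le/(_ _ e20) := avgt_L1 mg gG r0.
  by apply: filterS => n; rewrite sub0r normrN; exact/le_trans/ler_norm.
have [n [Nn a1 a2]] : exists n, [/\ (N <= n)%N, I2 (fun p => `|g1 p - avgx n g1 p| * \1_(box r) p) <= e / 2 &
    I2 (fun p => `|g2 p - avgx n g2 p| * \1_(box r) p) <= e / 2].
  apply: (@filter_ex _ \oo _); apply: filterS3 (nbhs_infty_ge N) (cvx g1 m1 G1) (cvx g2 m2 G2).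
  by move=> n; split.
have [m [Nm b1 b2]] : exists m, [/\ (N <= m)%N, I2 (fun p => `|avgx n g1 p - avgt m (avgx n g1) p| * \1_(box r) p) <= e / 2 &
    I2 (fun p => `|avgx n g2 p - avgt m (avgx n g2) p| * \1_(box r) p) <= e / 2].
  apply: (@filter_ex _ \oo _).
  apply: filterS3 (nbhs_infty_ge N) (cvt _ (measurable_avgx m1 G1 n) (avgx_norm_le m1 G1 n))
    (cvt _ (measurable_avgx m2 G2 n) (avgx_norm_le m2 G2 n)).
  by move=> m; split.
exists n, m.
have tri g (mg : measurable_fun setT g) (gG : forall p, `|g p| <= G) :
    I2 (fun p => `|g p - avgx n g p| * \1_(box r) p) <= e / 2 ->
    I2 (fun p => `|avgx n g p - avgt m (avgx n g) p| * \1_(box r) p) <= e / 2 ->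
    I2 (fun p => `|g p - mol (moll n m) g p.1 p.2| * \1_(box r) p) <= e.
  move=> h1 h2.
  have ma := measurable_avgx mg gG n; have aG := avgx_norm_le mg gG n.
  have mt := measurable_avgt ma aG m; have tG := avgt_norm_le ma aG m.
  have be1 := boxed_err mg gG r ma aG; have be2 := boxed_err ma aG r mt tG.
  rewrite [e]splitr (le_trans _ (lerD h1 h2))// -I2D//; apply: le_I2.
  - rewrite (_ : (fun p => _) = (fun p => `|g p - avgt m (avgx n g) p| * \1_(box r) p)).
      exact: (boxed_err mg gG r mt tG).
    by apply/funext => -[x t]; rewrite (mol_avg n m x t mg gG).
  - exact: boxedD.
  - move=> [x t]; rewrite (mol_avg n m x t mg gG) -mulrDl ler_wpM2r//.
    rewrite (_ : g (x, t) - _ = (g (x, t) - avgx n g (x, t)) + (avgx n g (x, t) - avgt m (avgx n g) (x, t))).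
      exact: ler_normD.
    by rewrite addrA subrK.
split => //; [exact: (tri g1 m1 G1)|exact: (tri g2 m2 G2)].
Qed.

End mollifier.

Section potential.
Context {R : realType}.

Lemma jcont_swap (K : R -> R -> R) : jointly_continuous K -> jointly_continuous (fun t x => K x t).
Proof.
move=> cK p; apply: (@continuous_comp _ _ _ (fun q : R * R => (q.2, q.1)) (fun q => K q.1 q.2)); last exact: cK.
exact: (cvg_pair (@cvg_snd _ _ _ _ _) (@cvg_fst _ _ _ _ _)).
Qed.

Variables (V G : R -> R -> R).
Hypotheses (sV : smooth V) (sG : smooth G).
Hypothesis conservation : forall x t, d2 V x t = - d1 G x t.

(** The integral of the closed form [V dx - G dt] from [(x0, t0)] to [(x, t)], first along
    the line [x0] and then along the line [t]. *)
Definition potential (x0 t0 x t : R) : R :=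
  (prim (V ^~ t) x - prim (V ^~ t) x0) - (prim (G x0) t - prim (G x0) t0).

Lemma potential_base x0 t0 : potential x0 t0 x0 t0 = 0.
Proof. by rewrite /potential !subrr. Qed.

Lemma der1_potential (x0 t0 x t : R) : is_derive x 1 (potential x0 t0 ^~ t) (V x t).
Proof.
have cV := Ck_jcont (sV 0%N).
have h := derB (derB (der_prim x (@jcont_l _ _ t cV)) (der_cst (prim (V ^~ t) x0) x))
  (der_cst (prim (G x0) t - prim (G x0) t0) x).
by apply: (der_eq h); rewrite !subr0.
Qed.

(** The conservation law turns the time derivative of the horizontal integral into a
    difference of fluxes. *)
Lemma der2_potential (x0 t0 x t : R) : is_derive t 1 (potential x0 t0 x) (- G x t).
Proof.
have cG := Ck_jcont (sG 0%N); have cG1 := Ck_jcont (smooth_d1 sG 0%N).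
have swapV := jcont_swap (Ck_jcont (sV 0%N)).
have swapV2 := jcont_swap (Ck_jcont (smooth_d2 sV 0%N)).
have dp y : is_derive t 1 (fun t => prim (V ^~ t) y) (prim ((d2 V) ^~ t) y).
  by apply: (der_prim_param (G := fun t x => V x t) (G1 := fun t x => d2 V x t)) => // s z;
    exact: (Ck_d2 (sV 1%N)).
have pE y : prim ((d2 V) ^~ t) y = - G y t + G 0 t.
  rewrite (_ : (d2 V) ^~ t = (fun x => - d1 G x t)); last first.
    by apply/funext => z; exact: conservation.
  have hd (z : R) : is_derive z 1 (fun x => - G x t) (- d1 G z t).
    by apply: derN; exact: (Ck_d1 (sG 1%N)).
  rewrite (prim_der y hd) ?opprK// => z; apply: cvgN; exact: (@jcont_l _ _ t cG1 z).
have h := derB (derB (dp x) (dp x0)) (derB (der_prim t (@jcont_r _ _ x0 cG)) (der_cst (prim (G x0) t0) t)).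
by apply: (der_eq h); rewrite !pE subr0; ring.
Qed.

Lemma smooth_potential x0 t0 : smooth (potential x0 t0).
Proof.
have bd K (sK : smooth K) r : exists C, forall x y, `|x| <= r -> `|y| <= r -> `|K x y : R| <= C.
  by have [C _ hC] := box_bounded r (Ck_jcont (sK 0%N)); exists C.
apply: (smooth_intro (K1 := V) (K2 := fun x t => - G x t)) => //.
- apply: (partials_jcont (K1 := V) (K2 := fun x t => - G x t)) => [x t|x t|r|r].
  + exact: der1_potential.
  + exact: der2_potential.
  + exact: bd.
  + by apply: bd => n; exact: CkN.
- by move=> x t; exact: der1_potential.
- by move=> x t; exact: der2_potential.
- by move=> n; exact: CkN.
Qed.

End potential.

Section mollified_conservation_law.
Context {R : realType}.
Variables (v F : R * R -> R) (M : R).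
Hypotheses (mv : measurable_fun setT v) (vM : forall p, `|v p| <= M).
Hypotheses (mF : measurable_fun setT F) (FM : forall p, `|F p| <= M).
Hypothesis weak : forall phi, testfun phi ->
  I2 (fun p => v p * d2 phi p.1 p.2 + F p * d1 phi p.1 p.2) = 0.

(** Mollification only tests the weak equation against translates of the kernel. *)
Lemma mol_conservation K x t : testfun K -> d2 (mol K v) x t = - d1 (mol K F) x t.
Proof.
move=> kK; have := weak (testfun_shift x t kK).
rewrite d1_shift// d2_shift// I2D; last 2 first.
- exact: (boxed_mol mv vM x t (testfun_d2 kK)).
- exact: (boxed_mol mF FM x t (testfun_d1 kK)).
move=> h.
have e1 : d2 (mol K v) x t = - mol (d2 K) v x t := is_derive_derive1 (der2_mol mv vM x t kK).
have e2 : d1 (mol K F) x t = - mol (d1 K) F x t := is_derive_derive1 (der1_mol mF FM x t kK).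
have {}h : mol (d2 K) v x t + mol (d1 K) F x t = 0 by exact: h.
by rewrite e1 e2 opprK; move/eqP: h; rewrite addr_eq0 => /eqP ->; rewrite opprK.
Qed.

End mollified_conservation_law.

(** * Bounded representatives of entropy solutions *)

Section essentially_bounded.
Context d (T : measurableType d) {R : realType} (mu : {measure set T -> \bar R}).

Lemma Lfun_ae_bounded (w : T -> R) : w \in Lfun mu +oo%E ->
  measurable_fun setT w /\ exists2 M, 0 <= M & {ae mu, forall x, `|w x| <= M}.
Proof.
move=> hw; have mw : measurable_fun setT w := set_mem (sub_Lfun_mfun hw).
split => //; have /set_mem := sub_Lfun_finLfun hw.
rewrite /= /finite_norm unlock; case: ifPn => [_|].
  have := ess_sup_ge mu (abse \o (EFin \o w)).
  case: (ess_sup mu _) => [r| |] // hr _.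
    exists `|r|; rewrite //; move: hr; apply: (@filterS _ _ (ae_filter_ringOfSetsType mu)) => x /=.
    by rewrite lee_fin => /le_trans; apply; exact: ler_norm.
  exists 0 => //; move: hr; apply: (@filterS _ _ (ae_filter_ringOfSetsType mu)) => x /=.
  by rewrite leeNy_eq.
rewrite -leNgt measure_le0 => /eqP muT _; exists 0 => //.
by exists setT; split.
Qed.

End essentially_bounded.

Section clamping.
Context {R : realType}.

(** Truncation selects a representative that is bounded everywhere. *)
Definition clamp (M v : R) : R := Num.max (- M) (Num.min M v).

Lemma clamp_norm_le (M v : R) : 0 <= M -> `|clamp M v| <= M.
Proof.
move=> M0; rewrite /clamp ler_norml le_max lexx ge_max ge_min lexx andbT/=.
by rewrite (le_trans _ M0)// oppr_le0.
Qed.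

Lemma clamp_id (M v : R) : `|v| <= M -> clamp M v = v.
Proof. by rewrite ler_norml => /andP[h1 h2]; rewrite /clamp min_r// max_r. Qed.

Lemma measurable_clamp d (T : measurableType d) (M : R) (w : T -> R) :
  measurable_fun setT w -> measurable_fun setT (fun x => clamp M (w x)).
Proof.
move=> mw; apply: measurable_maxr; first exact: measurable_cst.
by apply: measurable_minr => //; exact: measurable_cst.
Qed.

End clamping.

Section compactly_supported_test.
Context {R : realType}.
Implicit Types phi : R -> R -> R.

Lemma test_function_box phi (r : R) : smooth phi ->
  (forall x t, 0 <= t -> ~ box r (x, t) -> phi x t = 0) -> test_function phi.
Proof.
move=> sphi hr; split => //; apply: (subclosed_compact _ (@box_compact R r)).
  exact: closed_closure.
have cb : closed (box r : set (R * R)).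
  by apply: compact_closed; [exact: norm_hausdorff|exact: box_compact].
rewrite [X in _ `<=` X](closure_id _).1//; apply: closure_subset.
move=> [x t] [/= t0 ne]; apply: contrapT => nb; move/eqP: ne; apply.
exact: hr.
Qed.

End compactly_supported_test.

Section plane_solutions.
Context {R : realType}.
Local Notation mu := (@lebesgue_measure R).
Local Notation mu2 := (mu \x mu)%E.
Implicit Types (f : R -> R -> R) (v : R * R -> R).

Definition flux_of f v (p : R * R) : R := if 0 <= p.2 then f p.1 (v p) else 0.

(** The integrand of the entropy inequality, source term included. *)
Definition entropy_production f (eta : R -> R) (Q phi : R -> R -> R) v (p : R * R) : R :=
  eta (v p) * d2 phi p.1 p.2 + Q p.1 (v p) * d1 phi p.1 p.2
  - phi p.1 p.2 * (derive1 eta (v p) * d1 f p.1 (v p) - d1 Q p.1 (v p)).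

(** A solution of the Cauchy problem, prolonged to negative times by the initial
    datum with zero flux: the Cauchy problem becomes a conservation law on the
    whole plane. *)
Record plane_solution f (up um xm xp M : R) v : Prop := PlaneSolution {
  ps_measurable : measurable_fun setT v ;
  ps_bound : forall p, `|v p| <= M ;
  ps_left : forall x t, t < 0 -> x < xm -> v (x, t) = um ;
  ps_right : forall x t, t < 0 -> xp < x -> v (x, t) = up ;
  ps_static : forall x t s, t < 0 -> s < 0 -> v (x, t) = v (x, s) ;
  ps_weak : forall phi, testfun phi ->
    I2 (fun p => v p * d2 phi p.1 p.2 + flux_of f v p * d1 phi p.1 p.2) = 0 ;
  ps_entropy : forall eta Q phi r, entropy_pair f eta Q -> continuous (derive1 eta) ->
    jointly_continuous Q -> smooth phi ->
    (forall x t, 0 <= t -> 0 <= phi x t) -> (forall x, phi x 0 = 0) ->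
    (forall x t, 0 <= t -> ~ box r (x, t) -> [/\ phi x t = 0, d1 phi x t = 0 & d2 phi x t = 0]) ->
    0 <= I2 ((entropy_production f eta Q phi v) \_ half_plane) }.

Lemma measurable_jcont_comp (g : R -> R -> R) v : jointly_continuous g ->
  measurable_fun setT v -> measurable_fun setT (fun p : R * R => g p.1 (v p)).
Proof.
move=> cg mv.
exact: (measurableT_comp (jcont_measurable cg) (measurable_fun_pair (@measurable_fst _ _ R R) mv)).
Qed.

Lemma flux_of_measurable f v : jointly_continuous f -> measurable_fun setT v ->
  measurable_fun setT (flux_of f v).
Proof.
move=> cf mv; apply: measurable_fun_ifT; last exact: measurable_cst.
  apply: measurable_fun_ler; first exact: measurable_cst.
  exact: measurable_snd.
exact: measurable_jcont_comp.
Qed.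

Lemma boxed_half (h : R * R -> R) (r C : R) : measurable_fun setT h ->
  (forall x t, 0 <= t -> box r (x, t) -> `|h (x, t)| <= C) ->
  (forall x t, 0 <= t -> ~ box r (x, t) -> h (x, t) = 0) ->
  boxed (h \_ half_plane).
Proof.
move=> mh hC hr; exists r, `|C|; split.
- by apply/(measurable_restrictT _ measurable_half_plane); exact: measurable_funTS.
- move=> [x t]; rewrite patchE; case: ifPn => [|_]; last by rewrite normr0.
  rewrite inE /half_plane/= => t0.
  have [b|nb] := pselect (box r (x, t)).
    by rewrite (le_trans (hC _ _ t0 b))// ler_norm.
  by rewrite hr// normr0.
- move=> [x t] nb; rewrite patchE; case: ifPn => //.
  by rewrite inE /half_plane/= => t0; exact: hr.
Qed.

Lemma ae_eq_half (h k : R * R -> R) : measurable_fun setT h -> measurable_fun setT k ->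
  {ae mu2, forall p, half_plane p -> h p = k p} ->
  \int[mu2]_(p in half_plane) h p = \int[mu2]_(p in half_plane) k p.
Proof.
move=> mh mk hk; congr fine; apply: ae_eq_integral.
- exact: measurable_half_plane.
- by apply/measurable_EFinP; exact: measurable_funTS.
- by apply/measurable_EFinP; exact: measurable_funTS.
- by move: hk; apply: ae2_imp => p hp /hp ->.
Qed.

Section extension.
Variables (f : R -> R -> R) (up um xm xp : R) (u0 : R -> R) (u : R -> R -> R).
Hypotheses (f2 : Ck 2 f) (hx : xm < xp) (hu0 : u0 \in Lfun mu +oo%E).
Hypotheses (hu0m : {ae mu, forall x, x < xm -> u0 x = um})
           (hu0p : {ae mu, forall x, xp < x -> u0 x = up}).
Hypothesis hu : entropy_solution f u0 u.

(** The prolonged equation holds across [t = 0] because the integral over negative times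
    of [u0 * d2 phi] is the initial term of the weak formulation. *)
Lemma plane_solution_exists : exists M v, [/\ 0 < M, `|um| <= M, `|up| <= M,
  plane_solution f up um xm xp M v &
  {ae mu2, forall p, half_plane p -> u p.1 p.2 = v p}].
Proof.
have [mu0 [M0 M00 bu0]] := Lfun_ae_bounded hu0.
have [mw [M1 M10 bw]] := Lfun_ae_bounded (entropy_solution_bounded hu).
set w := (X in measurable_fun _ X) in mw; rewrite -/w in bw.
pose M := M0 + M1 + `|um| + `|up| + 1.
have umM : `|um| <= M by rewrite /M; have := normr_ge0 up; lra.
have upM : `|up| <= M by rewrite /M; have := normr_ge0 um; lra.
have M0M : M0 <= M by rewrite /M; have := normr_ge0 um; have := normr_ge0 up; lra.
have M1M : M1 <= M by rewrite /M; have := normr_ge0 um; have := normr_ge0 up; lra.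
have MM : 0 < M by rewrite /M; have := normr_ge0 um; have := normr_ge0 up; lra.
pose v0 x := if x < xm then um else if xp < x then up else clamp M (u0 x).
pose v (p : R * R) := if 0 <= p.2 then clamp M (w p) else v0 p.1.
have mv0 : measurable_fun setT v0.
  apply: measurable_fun_ifT; [exact: measurable_fun_ltr| exact: measurable_cst|].
  apply: measurable_fun_ifT; [exact: measurable_fun_ltr| exact: measurable_cst|].
  exact: measurable_clamp.
have mv : measurable_fun setT v.
  apply: measurable_fun_ifT.
  - by apply: measurable_fun_ler; [exact: measurable_cst|exact: measurable_snd].
  - exact: measurable_clamp.
  - by apply: (measurableT_comp mv0); exact: measurable_fst.
have vM p : `|v p| <= M.
  rewrite /v; case: ifPn => _; first exact/clamp_norm_le/ltW.
  rewrite /v0; case: ifPn => // _; case: ifPn => // _; exact/clamp_norm_le/ltW.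
have uv : {ae mu2, forall p, half_plane p -> u p.1 p.2 = v p}.
  move: bw; apply: ae2_imp => p; rewrite /w patchE => + hp.
  by rewrite mem_set// /v ifT// => h; rewrite clamp_id /w ?patchE ?mem_set// (le_trans h).
have u0v0 : {ae mu, forall x, u0 x = v0 x}.
  move: hu0m hu0p bu0; apply: (@filterS3 _ _ (ae_filter_ringOfSetsType mu)) => x hm hp hb.
  rewrite /v0; case: ifPn => [/hm//|_]; case: ifPn => [/hp//|_].
  by rewrite clamp_id// (le_trans hb).
have half_eq (Psi : R * R -> R -> R) :
    (forall z : R * R -> R, measurable_fun setT z -> measurable_fun setT (fun p => Psi p (z p))) ->
    \int[mu2]_(p in half_plane) Psi p (u p.1 p.2) = I2 ((fun p => Psi p (v p)) \_ half_plane).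
  move=> mPsi; rewrite -I2_half.
  transitivity (\int[mu2]_(p in half_plane) Psi p (w p)).
    by apply: eq_Rintegral => p hp; rewrite /w patchE hp.
  apply: ae_eq_half; [exact: mPsi|exact: mPsi|].
  by move: uv; apply: ae2_imp => p hp hhp; rewrite /w patchE mem_set// hp.
have cf := Ck_jcont f2; have cf1 : jointly_continuous (d1 f) by case: f2 => _ [_ _ c1 _]; exact: (@Ck_jcont _ 1 _ c1).
have md (phi : R -> R -> R) : jointly_continuous phi -> measurable_fun setT (fun p : R * R => phi p.1 p.2).
  exact: jcont_measurable.
exists M, v; split => //; split => //.
- by move=> x t t0 xxm; rewrite /v /v0 /= leNgt t0/= xxm.
- by move=> x t t0 xxp; rewrite /v /v0 /= leNgt t0/= xxp ltNge (ltW (lt_trans hx xxp)).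
- by move=> x t s t0 s0; rewrite /v /= !leNgt t0 s0.
- move=> phi kphi; have [sphi [r hr]] := kphi.
  have tphi : test_function phi by apply: (test_function_box sphi) => x t _; exact: hr.
  have := entropy_solution_weak hu tphi.
  rewrite (half_eq (fun p z => z * d2 phi p.1 p.2 + f p.1 z * d1 phi p.1 p.2)); last first.
    move=> z mz; apply: measurable_funD; apply: measurable_funM => //.
    + exact: md (Ck_jcont (smooth_d2 sphi 0%N)).
    + exact: measurable_jcont_comp.
    + exact: md (Ck_jcont (smooth_d1 sphi 0%N)).
  set A := (X in X \_ half_plane); set k := (X in _ -> I2 X = 0).
  have bv2 : boxed (fun p => v p * d2 phi p.1 p.2).
    by apply: boxedM => //; [exact: (boxed_testfun (testfun_d2 kphi))|exists M].
  have bF1 : boxed (fun p => flux_of f v p * d1 phi p.1 p.2).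
    apply: boxedM; [exact: flux_of_measurable|exact: (boxed_testfun (testfun_d1 kphi))|].
    have [s hs] := (testfun_d1 kphi).2.
    have [C C0 hC] := box_bounded (Num.max s M) cf; exists C => -[x t] /= ne.
    rewrite /flux_of; case: ifPn => _; last by rewrite normr0 ltW.
    have /boxE[xs ts] : box s (x, t) by apply: contrapT => nb; move/eqP: ne; apply; exact: hs.
    by apply: hC; rewrite /= le_max ?xs ?vM ?orbT.
  pose B (p : R * R) := if p.2 < 0 then v0 p.1 * d2 phi p.1 p.2 else 0.
  have bB : boxed B.
    apply: (boxed_le (k := fun p => v p * d2 phi p.1 p.2) (C := 1)) => //.
      apply: measurable_fun_ifT; last exact: measurable_cst.
        by apply: measurable_fun_ltr; [exact: measurable_snd|exact: measurable_cst].
      apply: measurable_funM; last exact: md (Ck_jcont (smooth_d2 sphi 0%N)).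
      by apply: (measurableT_comp mv0); exact: measurable_fst.
    move=> p; rewrite mul1r /B; case: ifPn => p0; last by rewrite normr0.
    have nh : (0 <= p.2) = false by rewrite leNgt p0.
    by rewrite /v nh.
  have -> : I2 (A \_ half_plane) = I2 k - I2 B.
    rewrite -I2B//; last exact: boxedD.
    apply: eq_I2 => p; rewrite patchE /k /A /B /flux_of; case: ifPn.
      by rewrite inE /half_plane/= => p0; rewrite ltNge p0 subr0.
    rewrite notin_setE /half_plane/= => /negP; rewrite -ltNge => p0.
    have nh : (0 <= p.2) = false by rewrite leNgt p0.
    by rewrite p0 /v nh mul0r addr0 subrr.
  have -> : I2 B = \int[mu]_x (v0 x * phi x 0).
    rewrite I2_fubini12//; apply: eq_Rintegral => x _.
    have [r' [h1 h2]] := testfun_slice2 x kphi.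
    have hd (t : R) : is_derive t 1 (fun t => v0 x * phi x t) (v0 x * d2 phi x t).
      by apply: derZ; exact: (Ck_d2 (sphi 1%N)).
    apply: (@Rintegral_deriv_half _ _ _ r' hd).
    - move=> t; apply: cvgM; first exact: cvg_cst.
      exact: (@jcont_r _ _ x (Ck_jcont (smooth_d2 sphi 0%N))).
    - by move=> t /h1 ->; rewrite mulr0.
    - by move=> t /h2 ->; rewrite mulr0.
  have -> : \int[mu]_x (u0 x * phi x 0) = \int[mu]_x (v0 x * phi x 0).
    have mphi : measurable_fun setT (phi ^~ 0).
      by apply: continuous_measurable_fun; exact: (@jcont_l _ _ 0 (Ck_jcont (sphi 0%N))).
    congr fine; apply: ae_eq_integral => //.
    - by apply/measurable_EFinP; exact: measurable_funM.
    - by apply/measurable_EFinP; exact: measurable_funM.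
    - by move: u0v0; apply: ae_imp => x -> _.
  by rewrite subrK.
- move=> eta Q phi r ep ceta' cQ sphi phi0 phit0 hr.
  have [_ deta dQ dQ1 cQ1] := ep.
  have ceta : continuous eta.
    by move=> z; apply: differentiable_continuous; apply/derivable1_diffP; exact: deta.
  have jeta : jointly_continuous (fun _ z : R => eta z).
    by move=> p; apply: (@continuous_comp _ _ _ (fun p : R * R => p.2) eta); [exact: cvg_snd|exact: ceta].
  have jeta' : jointly_continuous (fun _ z : R => derive1 eta z).
    by move=> p; apply: (@continuous_comp _ _ _ (fun p : R * R => p.2) (derive1 eta)); [exact: cvg_snd|exact: ceta'].
  have tphi : test_function phi.
    by apply: (test_function_box (r := r) sphi) => x t t0 nb; have [] := hr x t t0 nb.
  have := entropy_solution_entropy hu ep tphi phi0.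
  rewrite (_ : \int[mu]_x (eta (u0 x) * phi x 0) = 0) ?addr0; last first.
    transitivity (\int[mu]_(x in setT) (0 : R)); last by rewrite Rintegral_cst// mul0r.
    by apply: eq_Rintegral => x _; rewrite phit0 mulr0.
  pose S (x z : R) := derive1 eta z * d1 f x z - d1 Q x z.
  have cS : jointly_continuous S.
    by move=> p; apply: cvgB; [apply: cvgM; [exact: jeta'|exact: cf1]|exact: cQ1].
  have c0 := Ck_jcont (sphi 0%N); have c1 := Ck_jcont (smooth_d1 sphi 0%N).
  have c2 := Ck_jcont (smooth_d2 sphi 0%N).
  have m1 z : measurable_fun setT z -> measurable_fun setT (fun p : R * R => phi p.1 p.2 * S p.1 (z p)).
    by move=> mz; apply: measurable_funM; [exact: md|exact: measurable_jcont_comp].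
  have m2 z : measurable_fun setT z -> measurable_fun setT
      (fun p : R * R => eta (z p) * d2 phi p.1 p.2 + Q p.1 (z p) * d1 phi p.1 p.2).
    move=> mz; apply: measurable_funD; apply: measurable_funM; try exact: md.
      exact: (measurable_jcont_comp jeta).
    exact: measurable_jcont_comp.
  rewrite (half_eq (fun p z => phi p.1 p.2 * S p.1 z))//.
  rewrite (half_eq (fun p z => eta z * d2 phi p.1 p.2 + Q p.1 z * d1 phi p.1 p.2))//.
  have bdd g : jointly_continuous g -> exists2 C, 0 < C & forall x t z, box r (x, t) -> `|z| <= M -> `|g x z| <= C.
    move=> cg; have [C C0 hC] := box_bounded (Num.max r M) cg; exists C => // x t z /boxE[xr tr] zM.
    by apply: hC; rewrite le_max ?xr ?zM ?orbT.
  have [E E0 hE] := bdd _ jeta; have [D D0 hD] := bdd _ cQ; have [L L0 hL] := bdd _ cS.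
  have [B0 _ hB0] := box_bounded r c0; have [B1 _ hB1] := box_bounded r c1; have [B2 _ hB2] := box_bounded r c2.
  rewrite -subr_ge0 -I2B.
  + move=> /le_trans; apply; rewrite le_eqVlt; apply/orP; left; apply/eqP/eq_I2 => p.
    rewrite !patchE; case: ifPn => //= _; last by rewrite subrr.
  + apply: (@boxed_half _ r (E * B2 + D * B1)); first exact: m2.
      move=> x t t0 b; have /boxE[xr tr] := b.
      rewrite (le_trans (ler_normD _ _))// !normrM lerD// ler_pM//.
      * exact: (hE x t).
      * exact: hB2.
      * exact: (hD x t).
      * exact: hB1.
    by move=> x t t0 nb /=; have [_ -> ->] := hr x t t0 nb; rewrite !mulr0 addr0.
  + apply: (@boxed_half _ r (B0 * L)); first exact: m1.
      move=> x t t0 b; have /boxE[xr tr] := b; rewrite normrM ler_pM//; [exact: hB0|exact: (hL x t)].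
    by move=> x t t0 nb /=; have [-> _ _] := hr x t t0 nb; rewrite mul0r.
Qed.

End extension.
End plane_solutions.

(** * Smooth approximations of the potential *)

Section convexity.
Context {R : realType}.

Lemma convex_tangent (g dg ddg : R -> R) (alpha w z : R) :
  (forall x : R, is_derive x 1 g (dg x)) -> (forall x : R, is_derive x 1 dg (ddg x)) ->
  (forall x, alpha <= ddg x) ->
  g w + dg w * (z - w) + alpha / 2 * (z - w) ^+ 2 <= g z.
Proof.
move=> h1 h2 ha.
pose k x := g x - dg w * x - alpha / 2 * (x - w) ^+ 2.
pose dk x := dg x - dg w - alpha * (x - w).
have kd (x : R) : is_derive x 1 k (dk x).
  have s := der_shift w x.
  have := derB (derB (h1 x) (derZ (dg w) (der_id x))) (derZ (alpha / 2) (derM s s)).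
  by rewrite /k => h; apply: (der_eq h); rewrite /dk !mulr1; field.
have incr a b : a <= b -> alpha * (b - a) <= dg b - dg a.
  by move=> ab; apply: (derive_ge ab (fun x _ => h2 x)).
suff : k w <= k z by rewrite /k subrr expr0n mulr0 subr0 => ?; lra.
rewrite -subr_ge0; have [wz|/ltW zw] := leP w z.
  rewrite -(mul0r (z - w)); apply: (derive_ge wz (fun x _ => kd x)) => x /andP[wx _].
  by rewrite /dk; have := incr _ _ wx; lra.
rewrite -oppr_le0 opprB -(mul0r (w - z)); apply: (derive_le zw (fun x _ => kd x)) => x /andP[_ xw].
by rewrite /dk; have := incr _ _ xw; lra.
Qed.

End convexity.

Section near_potential.
Context {R : realType}.
Local Notation mu := (@lebesgue_measure R).
Variables (f : R -> R -> R) (up um xm xp M C : R) (v : R * R -> R).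
Hypotheses (f2 : Ck 2 f) (hx : xm < xp).
Hypotheses (umM : `|um| <= M) (upM : `|up| <= M).
Hypothesis fC : forall x z, `|z| <= M -> `|f x z| <= C.
Hypothesis convex : forall x z, 0 <= d2 (d2 f) x z.
Hypothesis sol : plane_solution f up um xm xp M v.

(** The smooth substitute for the potential of the solution.  [V] and [G] are averages of
    [v] and of the flux; [ap_tangent] is what averaging leaves of the convexity of the flux,
    and [I] is the increment of the potential across the transition zone
    [[xm - 1, xp]], which does not depend on the precision [e]. *)
Record near_potential (I r e : R) (V G W : R -> R -> R) : Prop := NearPotential {
  ap_smooth : smooth W ;
  ap_smoothV : smooth V ;
  ap_smoothG : smooth G ;
  ap_d1 : forall x t : R, is_derive x 1 (W ^~ t) (V x t) ;
  ap_d2 : forall x t : R, is_derive t 1 (W x) (- G x t) ;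
  ap_V : forall x t, `|V x t| <= M ;
  ap_G : forall x t, `|G x t| <= C ;
  ap_L1v : I2 (fun p => `|v p - V p.1 p.2| * \1_(box r) p) <= e ;
  ap_L1F : I2 (fun p => `|flux_of f v p - G p.1 p.2| * \1_(box r) p) <= e ;
  ap_tangent : forall w x t, w = um \/ w = up -> `|x| <= r -> 0 <= t ->
    f x w + d2 f x w * (V x t - w) - e <= G x t ;
  ap_left : forall x, x <= xm - 1 -> `|W x 0 - um * (x - (xm - 1))| <= e ;
  ap_right : forall x, xp <= x -> `|W x 0 - (I + up * (x - xp))| <= e ;
  ap_mid : forall x, xm - 1 <= x <= xp -> `|W x 0| <= M * (xp - (xm - 1)) + e }.

Hypothesis stat : forall w x y, w = um \/ w = up -> f x w = f y w.

Let mv := ps_measurable sol.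
Let vM := ps_bound sol.
Let M0 : 0 <= M. Proof. exact: le_trans (normr_ge0 _) umM. Qed.
Let C0 : 0 <= C. Proof. exact: le_trans (normr_ge0 _) (fC 0 umM). Qed.
Let mF := flux_of_measurable (Ck_jcont f2) mv.
Let FC p : `|flux_of f v p| <= C.
Proof. by rewrite /flux_of; case: ifPn => _; rewrite ?normr0 ?fC. Qed.

Let d2f : Ck 1 (d2 f). Proof. by case: f2 => _ []. Qed.

Let tangent x w z : f x w + d2 f x w * (z - w) <= f x z.
Proof.
have := @convex_tangent _ (f x) (d2 f x) (d2 (d2 f) x) 0 w z
  (Ck_d2 (CkS f2) x) (Ck_d2 d2f x) (convex x).
by rewrite mul0r mul0r addr0.
Qed.

(** The mollifier has mass one, so that one-sided bounds of [g] on its translated support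
    pass to the average. *)
Let mol_ge (g : R * R -> R) (D c x t : R) (n m : nat) : measurable_fun setT g -> (forall p, `|g p| <= D) ->
  (forall y s, x < y < x + n.+1%:R^-1 -> t < s < t + m.+1%:R^-1 -> c <= g (y, s)) ->
  c <= mol (moll n m) g x t.
Proof.
move=> mg gD hc.
have bK : boxed (fun p => moll n m (p.1 - x) (p.2 - t)).
  exact: (boxed_testfun (testfun_shift x t (testfun_moll n m))).
have <- : I2 (fun p => c * moll n m (p.1 - x) (p.2 - t)) = c.
  by rewrite I2Z// I2_shift ?I2_moll ?mulr1//; exact: testfun_moll.
apply: le_I2; [exact: boxedZ|exact: (boxed_mol mg gD x t (testfun_moll n m))|].
move=> [y s] /=.
have [|ns] := boolP ((0 < y - x < n.+1%:R^-1) && (0 < s - t < m.+1%:R^-1)).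
  move=> /andP[/andP[y1 y2] /andP[s1 s2]]; apply: ler_wpM2r; first exact: moll_ge0.
  by apply: hc; rewrite -ltrBlDl ?y2 ?s2 -subr_gt0 ?y1 ?s1.
by rewrite (moll_support ns) !mulr0.
Qed.

Let mol_cst (g : R * R -> R) (D c x t : R) (n m : nat) : measurable_fun setT g -> (forall p, `|g p| <= D) ->
  (forall y s, x < y < x + n.+1%:R^-1 -> t < s < t + m.+1%:R^-1 -> g (y, s) = c) ->
  mol (moll n m) g x t = c.
Proof.
move=> mg gD hc; apply/eqP; rewrite eq_le; apply/andP; split; last first.
  by apply: (mol_ge mg gD) => y s h1 h2; rewrite hc.
have mNg : measurable_fun setT (fun p => - g p) by exact: measurableT_comp.
have NgD p : `|- g p| <= D by rewrite normrN.
have E : mol (moll n m) (fun p => - g p) x t = - mol (moll n m) g x t.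
  rewrite /mol -I2N; last exact: (boxed_mol mg gD x t (testfun_moll n m)).
  by apply: eq_I2 => p; rewrite mulNr.
suff : - c <= mol (moll n m) (fun p => - g p) x t by rewrite E lerN2.
by apply: (mol_ge mNg NgD) => y s h1 h2; rewrite hc.
Qed.

Let shift_lt (y x h c : R) : y < x + h -> x <= c - 1 -> h <= 1 -> y < c.
Proof. by move=> *; lra. Qed.

Let ar1 (a b c k w e : R) : k - c * w - e <= a - c * b -> k + c * (b - w) - e <= a.
Proof. by move=> *; lra. Qed.

Let ar2 (B a w : R) : a <= B -> w <= B -> a + w <= 2 * B + 1.
Proof. by move=> *; lra. Qed.

Let ar3 (k c c' z w h e : R) : k + c' * (z - w) <= h -> - e <= (c' - c) * (z - w) ->
  k - c * w - e <= h - c * z.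
Proof. by move=> *; lra. Qed.

Let ar4 (a b c e : R) : 0 < e -> c <= a + b -> a <= e / 4 -> b <= e / 4 + e / 4 -> c <= e.
Proof. by move=> *; lra. Qed.

Let ar5 (a b c k e : R) : 0 < e -> c <= a + b -> a <= e / 4 -> b <= k -> c <= k + e.
Proof. by move=> *; lra. Qed.

Let ar6 (r x t : R) : 0 < r -> xm - 1 <= x -> x <= xp -> -2%:R <= t -> t <= -1 ->
  `|x| <= r + `|xm - 1| + `|xp| + 2 /\ `|t| <= r + `|xm - 1| + `|xp| + 2.
Proof.
have := ler_norm (xm - 1); have := ler_norm (- (xm - 1)); have := ler_norm xp; have := ler_norm (- xp).
rewrite !normrN; have := normr_ge0 (xm - 1); have := normr_ge0 xp => *.
by split; rewrite ler_norml; apply/andP; split; lra.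
Qed.

Let ar7 : xm - 1 <= xp.
Proof. by move: hx => *; lra. Qed.

(** [W] is the potential of the mollified solution based at [(xm - 1, -1)].  Before time 0
    the prolonged solution is static with zero flux, so [W] is affine at time [-1] on both
    outer regions; between [-1] and 0 the flux is seen only during the last [1/m], which
    moves [W] by at most [C / m]. *)
Lemma near_potential_exists : exists I, forall r e, 0 < r -> 0 < e ->
  exists V G W, near_potential I r e V G W.
Proof.
pose x0 := xm - 1.
exists (\int[mu]_(x in `[x0, xp]) v (x, -1)) => r e r0 e0.
pose e' := e / 4; have e'0 : 0 < e' by rewrite divr_gt0.
have D0 : 0 < e / (2 * M + 1) by rewrite divr_gt0// ltr_wpDl// mulr_ge0.
have [d d0 hd] := box_uniform_continuous (Num.max r M) (Ck_jcont d2f) D0.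
have [N1 _ hN1] := near_infty_natSinv_lt (PosNum d0).
have eC0 : 0 < e' / (C + 1) by rewrite divr_gt0// ltr_wpDl.
have [N2 _ hN2] := near_infty_natSinv_lt (PosNum eC0).
pose r' := r + `|x0| + `|xp| + 2.
have r'0 : 0 <= r' by rewrite /r' !addr_ge0// ltW.
have [||n [m [Nn Nm L1 L2]]] := @mol_L1 _ v (flux_of f v) (M + C) r' e' (maxn N1 N2) mv _ mF _ r'0 e'0.
- by move=> p; rewrite (le_trans (vM p))// lerDl.
- by move=> p; rewrite (le_trans (FC p))// lerDr.
have m1 : m.+1%:R^-1 <= 1 :> R := inv_le1 m.
have n1 : n.+1%:R^-1 <= 1 :> R := inv_le1 n.
have [mi mE] : exists mi : R, m.+1%:R^-1 = mi by eexists.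
have [ni nE] : exists ni : R, n.+1%:R^-1 = ni by eexists.
have mi0 : 0 < mi by rewrite -mE invr_gt0.
rewrite mE in m1; rewrite nE in n1.
have nd : n.+1%:R^-1 < d.
  by apply: hN1; rewrite /= (leq_trans _ Nn)// leq_maxl.
have me : C * mi <= e'.
  have mC : mi < e' / (C + 1).
    rewrite -mE.
    by apply: hN2; rewrite /= (leq_trans _ Nm)// leq_maxr.
  rewrite (@le_trans _ _ ((C + 1) * (e' / (C + 1))))//.
    by rewrite ler_pM ?lerDl// ltW.
  by rewrite mulrCA divff ?mulr1// gt_eqF// ltr_wpDl.
pose K := @moll R n m; have kK : testfun K := testfun_moll n m.
pose V := mol K v; pose G := mol K (flux_of f v).
have sV : smooth V := smooth_mol mv vM kK.
have sG : smooth G := smooth_mol mF FC kK.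
have cons x t : d2 V x t = - d1 G x t.
  apply: (@mol_conservation _ v (flux_of f v) (M + C) mv _ mF _ (ps_weak sol)) => //.
  - by move=> p; rewrite (le_trans (vM p))// lerDl.
  - by move=> p; rewrite (le_trans (FC p))// lerDr.
pose W := potential V G x0 (-1).
have W1 (x t : R) : is_derive x 1 (W ^~ t) (V x t) by exact: der1_potential.
have W2 (x t : R) : is_derive t 1 (W x) (- G x t) by exact: der2_potential.
have W0 : W x0 (-1) = 0 by exact: potential_base.
have sW : smooth W by exact: smooth_potential.
have VM x t : `|V x t| <= M.
  exact: (mol_norm_le x t mv vM kK (moll_ge0 n m) (I2_moll n m)).
have GC x t : `|G x t| <= C.
  exact: (mol_norm_le x t mF FC kK (moll_ge0 n m) (I2_moll n m)).
have Vleft x t : x <= x0 -> t <= -1 -> V x t = um.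
  move=> xx t1; apply: (mol_cst mv vM) => y s; rewrite mE nE => /andP[_ yx] /andP[_ st].
  by apply: (ps_left sol); [apply: (shift_lt st _ m1); rewrite sub0r|exact: (shift_lt yx xx n1)].
have Vright x t : xp <= x -> t <= -1 -> V x t = up.
  move=> xx t1; apply: (mol_cst mv vM) => y s; rewrite mE nE => /andP[xy _] /andP[_ st].
  by apply: (ps_right sol); [apply: (shift_lt st _ m1); rewrite sub0r|exact: le_lt_trans xx xy].
have G0 x t : t <= - mi -> G x t = 0.
  move=> t1; apply: (mol_cst mF FC) => y s _; rewrite mE => /andP[_ st].
  by rewrite /flux_of /= leNgt (lt_le_trans st)// -lerBrDr sub0r.
(* The tangent inequality at each point, averaged; the slope [d2 f y w] at the point of
   averaging is replaced by [d2 f x w] by uniform continuity. *)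
have tang w x t : w = um \/ w = up -> `|x| <= r -> 0 <= t ->
    f x w + d2 f x w * (V x t - w) - e <= G x t.
  move=> hw xr t0.
  have wM : `|w| <= M by case: hw => ->.
  pose g p := flux_of f v p - d2 f x w * v p.
  have mg : measurable_fun setT g by apply: measurable_funB => //; exact: measurable_funM.
  have gB p : `|g p| <= C + `|d2 f x w| * M.
    by rewrite (le_trans (ler_normB _ _))// lerD// normrM ler_wpM2l.
  have E : mol K g x t = G x t - d2 f x w * V x t.
    have b1 := boxed_mol mF FC x t kK; have b2 := boxed_mol mv vM x t kK.
    rewrite /G /V /mol -I2Z// -I2B//; last exact: boxedZ.
    by apply: eq_I2 => p; rewrite /g mulrBl mulrA.
  suff : f x w - d2 f x w * w - e <= mol K g x t by rewrite E; exact: ar1.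
  apply: (mol_ge mg gB) => y s /andP[xy yx] /andP[ts _].
  have s0 : 0 <= s by exact: le_trans t0 (ltW ts).
  rewrite /g /flux_of/= s0 (stat x y hw).
  have h := tangent y w (v (y, s)).
  have : `|d2 f y w - d2 f x w| < e / (2 * M + 1).
    apply: hd; rewrite ?le_max ?xr ?wM ?orbT ?subrr ?normr0// gtr0_norm ?subr_gt0//.
    by rewrite ltrBlDl (lt_trans yx)// ltrD2l.
  rewrite ltr_pdivlMr ?ltr_wpDl ?mulr_ge0// => hdd.
  have : `|(d2 f y w - d2 f x w) * (v (y, s) - w)| <= e.
    rewrite normrM (le_trans _ (ltW hdd))// ler_wpM2l//.
    by rewrite (le_trans (ler_normB _ _))//; exact: ar2.
  by rewrite ler_norml => /andP[hh _]; exact: ar3 h hh.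
have bv : boxed (fun p => `|v p - V p.1 p.2| * \1_(box r') p).
  apply: (boxed_err mv vM); first exact: jcont_measurable (Ck_jcont (sV 0%N)).
  by move=> p; exact: VM.
have bF : boxed (fun p => `|flux_of f v p - G p.1 p.2| * \1_(box r') p).
  apply: (boxed_err mF FC); first exact: jcont_measurable (Ck_jcont (sG 0%N)).
  by move=> p; exact: GC.
move: L1 L2; rewrite -/K -/V -/G => L1 L2.
have W00 x : `|W x 0 - W x (-1)| <= e'.
  have h1 : W x (- mi) = W x (-1).
    apply/eqP; rewrite -subr_eq0 -normr_le0 -(mul0r `|- mi - -1|).
    apply: (derive_norm_le (W2 x)) => s /andP[_]; rewrite le_max => sm.
    rewrite G0 ?oppr0 ?normr0//; case/orP: sm => // sm; apply: (le_trans sm); by rewrite lerN2.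
  rewrite -h1 (le_trans _ me)//.
  have := derive_norm_le (a := - mi) (b := 0) (C := C) (W2 x).
  rewrite sub0r opprK (gtr0_norm mi0); apply => s _; rewrite normrN; exact: GC.
have ap_at0 x c : `|W x (-1) - c| <= e' + e' -> `|W x 0 - c| <= e.
  move=> h; rewrite (_ : W x 0 - c = (W x 0 - W x (-1)) + (W x (-1) - c)); last by rewrite addrA subrK.
  exact: ar4 e0 (ler_normD _ _) (W00 x) h.
have aff (a b c : R) : (forall x, Num.min a b <= x <= Num.max a b -> V x (-1) = c) ->
    W b (-1) = W a (-1) + c * (b - a).
  move=> hc; apply/eqP; rewrite -subr_eq0 -normr_le0 -(mul0r `|b - a|).
  have hd' (x : R) : is_derive x 1 (fun x => W x (-1) - c * x) (V x (-1) - c).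
    by apply: (der_eq (derB (W1 x (-1)) (derZ c (der_id x)))); rewrite mulr1.
  rewrite (_ : _ - _ = (W b (-1) - c * b) - (W a (-1) - c * a)); last by ring.
  by apply: (derive_norm_le hd') => x /hc ->; rewrite subrr normr0.
(* The pointwise value at [xp] is recovered from the [L^1] estimate by integrating over
   [[-2, -1]], where everything is independent of time. *)
have Wright : `|W xp (-1) - \int[mu]_(x in `[x0, xp]) v (x, -1)| <= e'.
  have static x t : t <= -1 -> V x t = V x (-1).
    move=> t1; apply/eqP; rewrite -subr_eq0 -normr_le0 -(mul0r `|t - -1|).
    apply: (derive_norm_le (fun s => Ck_d2 (sV 1%N) x s)) => s /andP[_]; rewrite le_max => s1.
    have {}s1 : s <= - mi by case/orP: s1 => s1; apply: (le_trans s1); rewrite ?lerN2// (le_trans t1)// lerN2.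
    rewrite cons /d1 (_ : G ^~ s = cst 0) ?derive1_cst ?oppr0 ?normr0//.
    by apply/funext => y; exact: G0.
  pose A : set (R * R) := `[x0, xp] `*` `[-2%:R, -1].
  have mA : measurable A by apply: measurableX.
  pose h (p : R * R) := (v p - V p.1 p.2) * \1_A p.
  have hle p : `|h p| <= `|v p - V p.1 p.2| * \1_(box r') p.
    case: p => x t; rewrite /h normrM ler_wpM2l// !indicE.
    have [|_] := boolP ((x, t) \in A); last by rewrite normr0.
    rewrite inE => -[/=]; rewrite !in_itv/= => /andP[x1 x2] /andP[t1 t2].
    rewrite normr1 mem_set//; apply/boxE; exact: ar6.
  have bh : boxed h.
    apply: (boxed_le (C := 1) _ bv).
      apply: measurable_funM; last exact: measurable_indic.
      by apply: measurable_funB => //; exact: jcont_measurable (Ck_jcont (sV 0%N)).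
    move=> p; rewrite mul1r [X in _ <= X]ger0_norm ?hle// mulr_ge0//.
  have x0xp : x0 <= xp by rewrite /x0; exact: ar7.
  have Ih : I2 h = (\int[mu]_(x in `[x0, xp]) v (x, -1)) - W xp (-1).
    rewrite I2_fubini21//.
    rewrite (_ : \int[mu]_t _ = \int[mu]_(t in `[-2%:R, -1]) ((\int[mu]_(x in `[x0, xp]) v (x, -1)) - W xp (-1))); last first.
      rewrite [RHS]Rintegral_mkcond; apply: eq_Rintegral => t _.
      rewrite patchE; case: ifPn => [|]; last first.
        rewrite notin_setE => nt; transitivity (\int[mu]_(x in setT) (0 : R)); last by rewrite Rintegral_cst// mul0r.
        by apply: eq_Rintegral => x _; rewrite /h indicE memNset ?mulr0// => -[].
      rewrite inE/= in_itv/= => /andP[t1 t2].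
      rewrite (_ : \int[mu]_x h (x, t) = \int[mu]_(x in `[x0, xp]) (v (x, -1) - V x (-1))); last first.
        rewrite [RHS]Rintegral_mkcond; apply: eq_Rintegral => x _.
        have vt : v (x, t) = v (x, -1).
          by apply: (ps_static sol); [exact: le_lt_trans t2 (ltrN10 _)|exact: ltrN10].
        rewrite patchE /h /= (static x t t2) vt.
        rewrite indicE; case: ifPn => [xx|xx].
          by rewrite mem_set ?mulr1//; split; [exact: set_mem|rewrite /= in_itv/= t1 t2].
        by rewrite memNset ?mulr0// => -[+ _]; move: xx; rewrite notin_setE.
      have cV1 : continuous (V ^~ (-1)) by exact: (@jcont_l _ _ (-1) (Ck_jcont (sV 0%N))).
      rewrite RintegralB//.
      + rewrite (Rintegral_deriv (h := W ^~ (-1)) (fun x => W1 x (-1)) cV1 x0xp) W0 subr0//.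
      + apply: measurable_bounded_integrable => //.
        * by rewrite /= lebesgue_measure_itv/=; case: ifP => // _; rewrite -EFinB ltry.
        * apply: measurable_funTS; apply: (measurableT_comp mv); exact: measurable_fun_pair.
        * exists M; split; first exact: num_real.
          by move=> B MB x _ /=; rewrite (le_trans (vM _))// ltW.
      + exact: continuous_integrable_itv.
    rewrite Rintegral_cst//= lebesgue_measure_itv/= lte_fin ifT ?ltrN2 ?ltr1n//.
    by rewrite -EFinB/= (_ : -1 - - 2%:R = 1 :> R) ?mulr1//; ring.
  rewrite distrC -Ih (le_trans (I2_norm bh))// (le_trans _ L1)//.
  by apply: le_I2 => //; exact: boxed_norm.
have rr' : r <= r' by rewrite /r' -!addrA lerDl !addr_ge0.
have indr p : \1_(box r) p <= \1_(box r') p :> R.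
  rewrite !indicE; have [|_] := boolP (p \in box r); last by case: (_ \in _).
  by rewrite inE => /(box_mono rr') b; rewrite mem_set.
exists V, G, W; split => //.
- apply: le_trans (le_trans L1 _); last by rewrite /e' ler_pdivrMr// ler_pMr// ler1n.
  apply: le_I2 => //; last by move=> p; rewrite ler_wpM2l.
  apply: (boxed_err mv vM); first exact: jcont_measurable (Ck_jcont (sV 0%N)).
  by move=> p; exact: VM.
- apply: le_trans (le_trans L2 _); last by rewrite /e' ler_pdivrMr// ler_pMr// ler1n.
  apply: le_I2 => //; last by move=> p; rewrite ler_wpM2l.
  apply: (boxed_err mF FC); first exact: jcont_measurable (Ck_jcont (sG 0%N)).
  by move=> p; exact: GC.
- move=> x xx; apply: ap_at0; rewrite (aff x0 x um) ?W0 ?add0r ?subrr ?normr0.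
    by rewrite addr_ge0// ltW.
  move=> y /andP[_]; rewrite le_max => yx; apply: Vleft => //.
  by case/orP: yx => // yx; exact: le_trans yx xx.
- move=> x xx; apply: ap_at0; rewrite (aff xp x up); last first.
    move=> y /andP[+ _]; rewrite ge_min => yx; apply: Vright => //.
    by case/orP: yx => // yx; exact: le_trans xx yx.
  rewrite opprD addrACA subrr addr0 (le_trans Wright)// lerDl ltW//.
- move=> x /andP[x1 x2].
  have h1 : `|W x (-1)| <= M * (xp - x0).
    rewrite -[W x _]subr0 -W0 (le_trans (derive_norm_le (C := M) (fun x => W1 x (-1)) _))//.
      by rewrite ler_wpM2l// ger0_norm ?subr_ge0// lerD2r.
  have := W00 x; have := ler_normD (W x 0 - W x (-1)) (W x (-1)); rewrite subrK.
  by move=> h2 h3; exact: ar5 e0 h2 h3 h1.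
Qed.

End near_potential.

(** * The entropy *)

Section kruzhkov.
Context {R : realType}.
Implicit Types (g : R -> R) (a b c z B w : R).

(** Three-point form of uniform convexity: unlike the bound on the second derivative, it
    is invariant under [z |-> - z] at sight and gives the chord inequalities directly. *)
Definition strongly_convex (alpha : R) g := forall a b c, a <= b -> b <= c ->
  (c - a) * g b + alpha / 2 * (b - a) * (c - b) * (c - a) <= (c - b) * g a + (b - a) * g c.

Lemma strongly_convexP (alpha : R) (g dg ddg : R -> R) :
  (forall x : R, is_derive x 1 g (dg x)) -> (forall x : R, is_derive x 1 dg (ddg x)) ->
  (forall x, alpha <= ddg x) -> strongly_convex alpha g.
Proof.
move=> h1 h2 ha a b c ab bc.
have ta := convex_tangent b a h1 h2 ha; have tc := convex_tangent b c h1 h2 ha.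
have {}ta : (c - b) * (g b + dg b * (a - b) + alpha / 2 * (a - b) ^+ 2) <= (c - b) * g a.
  by rewrite ler_wpM2l// subr_ge0.
have {}tc : (b - a) * (g b + dg b * (c - b) + alpha / 2 * (c - b) ^+ 2) <= (b - a) * g c.
  by rewrite ler_wpM2l// subr_ge0.
apply: le_trans (lerD ta tc); rewrite le_eqVlt; apply/orP; left; apply/eqP.
by field.
Qed.

Definition pospart z := Num.max 0 z.

(** The kink at the mean state [m] serves the intermediate barrier; the kinks at [um] and
    [up], with a large weight [w], penalise the states outside [[up, um]], where the other
    terms may have the wrong sign; the constant [B] keeps the entropy positive. *)
Definition kruzhkov_eta (up um B w z : R) :=
  let m := (up + um) / 2 in
  B + pospart (z - m) + pospart (m - z) + w * pospart (z - um) + w * pospart (up - z).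

Definition kruzhkov_jump g k z := if k < z then g z - g k else 0.

(** The matching entropy flux, normalised by [B] times the shock speed so that the chord of
    [g] between the two states appears in the sign conditions. *)
Definition kruzhkov_Q g (up um B w z : R) :=
  let m := (up + um) / 2 in
  B * ((g um - g up) / (um - up)) + kruzhkov_jump g m z
    - kruzhkov_jump (g \o -%R) (- m) (- z)
    + w * kruzhkov_jump g um z - w * kruzhkov_jump (g \o -%R) (- up) (- z).

Lemma kruzhkov_etaN up um B w z : kruzhkov_eta (- um) (- up) B w (- z) = kruzhkov_eta up um B w z.
Proof.
rewrite /kruzhkov_eta /= (_ : (- um - up) / 2 = - ((up + um) / 2)); last by ring.
by rewrite !opprK !(addrC (- z)) !(addrC _ z); ring.
Qed.

Lemma kruzhkov_QN g up um B w z :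
  kruzhkov_Q (g \o -%R) (- um) (- up) B w (- z) = - kruzhkov_Q g up um B w z.
Proof.
rewrite /kruzhkov_Q /= (_ : (- um - up) / 2 = - ((up + um) / 2)); last by ring.
rewrite !opprK (_ : (g \o -%R) \o -%R = g); last by apply/funext => y; rewrite /= opprK.
rewrite (addrC (- up) um) -(opprB (g um)) mulNr; ring.
Qed.

Lemma pospart_id z : 0 <= z -> pospart z = z.
Proof. exact: max_r. Qed.

Lemma pospart0 z : z <= 0 -> pospart z = 0.
Proof. exact: max_l. Qed.

Section inequality.
Variables (g : R -> R) (up um M Theta alpha B w eps : R).
Let m := (up + um) / 2.
Let D := um - up.
Let c := alpha * D ^+ 2 / 16.
Let sigma := (g um - g up) / D.
Hypotheses (upum : up < um) (upM : `|up| <= M) (umM : `|um| <= M).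
Hypotheses (alpha0 : 0 < alpha) (B0 : 0 <= B) (w0 : 0 <= w) (eps0 : 0 <= eps) (Theta0 : 0 <= Theta).
Hypothesis gL : forall y z, `|y| <= M -> `|z| <= M -> `|g y - g z| <= Theta * `|y - z|.
Hypothesis gconv : strongly_convex alpha g.
Hypothesis BTheta : 2 * B * Theta <= c.
Hypothesis wlarge : 2 * B * Theta + 4 * M * Theta <= w * eps.

Let D0 : 0 < D. Proof. by rewrite subr_gt0. Qed.

Let sigmaD : sigma * D = g um - g up.
Proof. by rewrite /sigma divfK// gt_eqF. Qed.

Let gLb y z : y <= z -> `|y| <= M -> `|z| <= M ->
  - (Theta * (z - y)) <= g z - g y /\ g z - g y <= Theta * (z - y).
Proof.
move=> yz yM zM; have := gL zM yM; rewrite ler_norml => /andP[h1 h2].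
by move: h1 h2; rewrite ger0_norm ?subr_ge0.
Qed.

Let sigmaT : - Theta <= sigma /\ sigma <= Theta.
Proof.
have [h1 h2] := gLb (ltW upum) upM umM; rewrite -sigmaD -/D in h1 h2.
by split; rewrite -(ler_pM2r D0) ?mulNr.
Qed.

(** At the fast state the defect [eps] of the barrier pays for states above [um]
    through the heavy kink at [um]. *)
Lemma kruzhkov_fast z : `|z| <= M ->
  kruzhkov_eta up um B w z * (g z - (g um + eps)) + kruzhkov_Q g up um B w z * (um - z)
    <= - (B * eps).
Proof.
move=> zM; have [sT1 sT2] := sigmaT.
have mup : up <= m by rewrite /m; move: upum; lra.
have mum : m <= um by rewrite /m; move: upum; lra.
have zMb : - M <= z /\ z <= M by move: zM; rewrite ler_norml => /andP[].
rewrite /kruzhkov_eta /kruzhkov_Q /kruzhkov_jump /= -/m -/D -/sigma !opprK !ltrN2.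
have zmE : z <= m -> (if z < m then g z - g m else 0) = g z - g m.
  by rewrite le_eqVlt => /predU1P[->|->//]; rewrite ltxx subrr.
have chord : up <= z -> z <= um -> B * (g z - g um + sigma * (um - z)) <= 0.
  move=> upz zum; apply: mulr_ge0_le0 => //; rewrite -(pmulr_rle0 _ D0).
  have T := gconv upz zum.
  have : 0 <= alpha / 2 * (z - up) * (um - z) * (um - up) by rewrite !mulr_ge0 ?subr_ge0// ltW.
  rewrite (_ : D * _ = D * (g z - g um) + sigma * D * (um - z)); last by ring.
  by rewrite sigmaD /D; move: T; lra.
have [zum|umz] := leP z um.
  rewrite (pospart0 (_ : z - um <= 0)) ?subr_le0//.
  have [zm|mz] := leP z m.
    rewrite (pospart0 (_ : z - m <= 0)) ?subr_le0// (pospart_id (_ : 0 <= m - z)) ?subr_ge0// zmE//.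
    have T1 := gconv zm mum; have ka : 0 <= alpha / 2 * (m - z) * (um - m) * (um - z).
      by rewrite !mulr_ge0 ?subr_ge0// ltW.
    have e1 : 0 <= (m - z) * eps by rewrite mulr_ge0 ?subr_ge0.
    have [upz|zup] := leP up z.
      rewrite (pospart0 (_ : up - z <= 0)) ?subr_le0//.
      by move: (chord upz zum) T1 ka e1; lra.
    rewrite (pospart_id (_ : 0 <= up - z)); last by rewrite subr_ge0 ltW.
    have T2 : 0 <= w * ((um - up) * g z + (up - z) * g um - (um - z) * g up).
      apply: mulr_ge0 => //; have T := gconv (ltW zup) (ltW upum).
      have : 0 <= alpha / 2 * (up - z) * (um - up) * (um - z).
        by rewrite !mulr_ge0 ?subr_ge0 ?invr_ge0// ltW.
      by move: T; lra.
    have e2 : 0 <= w * ((up - z) * eps) by rewrite !mulr_ge0 ?subr_ge0// ltW.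
    have BB : B * (g z - g um + sigma * (um - z)) <= c * (up - z).
      apply: (@le_trans _ _ (2 * B * Theta * (up - z))); last by rewrite ler_wpM2r ?subr_ge0// ltW.
      rewrite [leRHS](_ : _ = B * (2 * Theta * (up - z))); last by ring.
      rewrite ler_wpM2l// (_ : g z - g um + _ = (g z - g up) + sigma * (up - z) + (sigma * D - (g um - g up))); last by rewrite /D; ring.
      rewrite sigmaD subrr addr0; have [h1 h2] := gLb (ltW zup) zM upM.
      have : sigma * (up - z) <= Theta * (up - z) by rewrite ler_wpM2r ?subr_ge0// ltW.
      by move: h1; lra.
    have kc : 4 * c * (up - z) <= alpha / 2 * (m - z) * (um - m) * (um - z).
      rewrite [leLHS](_ : _ = alpha / 2 * ((up - z) * ((um - m) * D))); last by rewrite /c /m /D; field.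
      rewrite [leRHS](_ : _ = alpha / 2 * ((m - z) * ((um - m) * (um - z)))); last by ring.
      rewrite ler_wpM2l ?divr_ge0 ?(ltW alpha0)//.
      apply: ler_pM; [by rewrite subr_ge0 ltW|by rewrite mulr_ge0 ?subr_ge0// ltW|by rewrite lerD2r|].
      by rewrite ler_wpM2l ?subr_ge0// /D lerD2l lerN2 ltW.
    have cz : 0 <= c * (up - z) by rewrite mulr_ge0 ?subr_ge0 ?(ltW zup)// /c divr_ge0// mulr_ge0 ?sqr_ge0// ltW.
    move: BB T1 ka e1 T2 e2 kc cz; lra.
  rewrite [if z < m then _ else _]ifF ?(lt_gtF mz)//.
  have upz : up <= z by exact: le_trans mup (ltW mz).
  rewrite (pospart0 (_ : up - z <= 0)) ?subr_le0// [if z < up then _ else _]ifF ?ltNge ?upz//.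
  rewrite (pospart_id (_ : 0 <= z - m)) ?subr_ge0 ?(ltW mz)// (pospart0 (_ : m - z <= 0)) ?subr_le0 ?(ltW mz)//.
  have T1 := gconv (ltW mz) zum; have ka : 0 <= alpha / 2 * (z - m) * (um - z) * (um - m).
    by rewrite !mulr_ge0 ?subr_ge0// ltW.
  have e1 : 0 <= (z - m) * eps by rewrite mulr_ge0 ?subr_ge0// ltW.
  by move: (chord upz zum) T1 ka e1; lra.
have upz : up < z by exact: lt_trans upum umz.
have mz : m < z by exact: le_lt_trans mum umz.
rewrite [if z < m then _ else _]ifF ?(lt_gtF mz)// [if z < up then _ else _]ifF ?(lt_gtF upz)// .
rewrite (pospart0 (_ : up - z <= 0)) ?subr_le0 ?(ltW upz)// (pospart0 (_ : m - z <= 0)) ?subr_le0 ?(ltW mz)//.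
rewrite (pospart_id (_ : 0 <= z - m)) ?subr_ge0 ?(ltW mz)// (pospart_id (_ : 0 <= z - um)) ?subr_ge0 ?(ltW umz)//.
rewrite [if m < z then _ else _]ifT//.
have [gu1 gu2] := gLb (ltW umz) umM zM.
have zmM : z - m <= 2 * M by move: umM upM; rewrite !ler_norml /m => /andP[? ?] /andP[? ?]; move: zMb => [? ?]; lra.
have mM : `|m| <= M.
  move: umM upM; rewrite !ler_norml /m => /andP[? ?] /andP[? ?]; apply/andP; split; lra.
have [gm1 gm2] := gLb (ltW mz) mM zM.
have zu0 : 0 <= z - um by rewrite subr_ge0 ltW.
have f1 : B * (g z - g um - sigma * (z - um)) <= B * (2 * Theta * (z - um)).
  rewrite ler_wpM2l//; have : - Theta * (z - um) <= sigma * (z - um) by rewrite ler_wpM2r.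
  by move: gu2; lra.
have f2 : (z - m) * (g z - g um) <= 2 * M * Theta * (z - um).
  apply: (@le_trans _ _ ((z - m) * (Theta * (z - um)))); first by rewrite ler_wpM2l// subr_ge0 ltW.
  by rewrite -mulrA ler_wpM2r// mulr_ge0.
have f3 : (g m - g z) * (z - um) <= 2 * M * Theta * (z - um).
  rewrite ler_wpM2r//; have : Theta * (z - m) <= Theta * (2 * M) by rewrite ler_wpM2l.
  by move: gm1; lra.
have f4 : (2 * B * Theta + 4 * M * Theta) * (z - um) <= w * eps * (z - um) by rewrite ler_wpM2r.
have f5 : 0 <= (z - m) * eps by rewrite mulr_ge0// subr_ge0 ltW.
by move: f1 f2 f3 f4 f5; lra.
Qed.

(** Strictly between the two states convexity alone gives the defect [c]. *)
Lemma kruzhkov_mid z : `|z| <= M ->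
  kruzhkov_eta up um B w z * (g z - ((g up + g um) / 2 - c)) + kruzhkov_Q g up um B w z * (m - z)
    <= - (B * c).
Proof.
move=> zM; have [sT1 sT2] := sigmaT.
have mup : up <= m by rewrite /m; move: upum; lra.
have mum : m <= um by rewrite /m; move: upum; lra.
have mM : `|m| <= M.
  move: umM upM; rewrite !ler_norml /m => /andP[? ?] /andP[? ?]; apply/andP; split; lra.
have c0 : 0 <= c by rewrite /c divr_ge0// mulr_ge0 ?sqr_ge0// ltW.
have gm : g m <= (g up + g um) / 2 - 2 * c.
  have := gconv mup mum; rewrite (_ : um - m = D / 2); last by rewrite /m /D; field.
  rewrite (_ : m - up = D / 2); last by rewrite /m /D; field.
  rewrite -/D => T; rewrite -(ler_pM2l D0).
  rewrite (_ : D * (_ - 2 * c) = D / 2 * g up + D / 2 * g um - alpha / 2 * (D / 2) * (D / 2) * D); last first.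
    by rewrite /c; field.
  by move: T; lra.
set h := (g up + g um) / 2 - c.
have gmh : g m - h <= - c by rewrite /h; move: gm; lra.
have norm_kink : B * (g z - h + sigma * (m - z)) + `|z - m| * (g m - h) <= - (B * c).
  have d0 := normr_ge0 (z - m).
  have h1 : `|z - m| * (g m - h) <= `|z - m| * - c by rewrite ler_wpM2l.
  have h2 : g z - g m <= Theta * `|z - m| by apply: le_trans (ler_norm _) (gL zM mM).
  have h3 : sigma * (m - z) <= Theta * `|z - m|.
    rewrite (le_trans (ler_norm _))// normrM distrC ler_wpM2r// ler_norml; apply/andP; split=> //.
  have h4 : B * (g z - h + sigma * (m - z)) <= B * (2 * Theta * `|z - m| - c).
    by rewrite ler_wpM2l//; move: h2 h3 gmh; lra.
  have h5 : 2 * B * Theta * `|z - m| <= c * `|z - m| by rewrite ler_wpM2r.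
  by move: h1 h4 h5; lra.
have right : um < z -> w * ((z - um) * (g z - h) + (g z - g um) * (m - z)) <= 0.
  move=> umz; apply: mulr_ge0_le0 => //; have T := gconv (ltW upum) (ltW umz).
  have zu : 0 <= z - um by rewrite subr_ge0 ltW.
  have k0 : 0 <= alpha / 4 * (um - up) * (z - um) * (z - um).
    by rewrite !mulr_ge0 ?invr_ge0 ?(ltW alpha0)//; exact: ltW D0.
  have k1 : 0 <= alpha * 3 / 16 * (um - up) ^+ 2 * (z - um).
    apply: mulr_ge0 => //; apply: mulr_ge0; last exact: sqr_ge0.
    by move: alpha0; lra.
  by rewrite /h /m /c /D; move: T k0 k1; lra.
have left : z < up -> w * ((up - z) * (g z - h) + (g up - g z) * (m - z)) <= 0.
  move=> zup; apply: mulr_ge0_le0 => //; have T := gconv (ltW zup) (ltW upum).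
  have zu : 0 <= up - z by rewrite subr_ge0 ltW.
  have k0 : 0 <= alpha / 4 * (um - up) * (up - z) * (up - z).
    by rewrite !mulr_ge0 ?invr_ge0 ?(ltW alpha0)//; exact: ltW D0.
  have k1 : 0 <= alpha * 3 / 16 * (um - up) ^+ 2 * (up - z).
    apply: mulr_ge0 => //; apply: mulr_ge0; last exact: sqr_ge0.
    by move: alpha0; lra.
  by rewrite /h /m /c /D; move: T k0 k1; lra.
rewrite /kruzhkov_eta /kruzhkov_Q /kruzhkov_jump /= -/m -/D -/sigma !opprK !ltrN2.
have zmE : z <= m -> (if z < m then g z - g m else 0) = g z - g m.
  by rewrite le_eqVlt => /predU1P[->|->//]; rewrite ltxx subrr.
move: norm_kink; have [zm|mz] := leP z m.
  rewrite (pospart0 (_ : z - m <= 0)) ?subr_le0// (pospart_id (_ : 0 <= m - z)) ?subr_ge0// zmE//.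
  have zum : z <= um := le_trans zm mum.
  rewrite ler0_norm ?subr_le0// (pospart0 (_ : z - um <= 0)) ?subr_le0// [if um < z then _ else _]ifF ?ltNge ?zum//.
  have [zup|upz] := ltP z up.
    rewrite (pospart_id (_ : 0 <= up - z)) ?subr_ge0 ?(ltW zup)//.
    by move: (left zup) => /=; lra.
  by rewrite (pospart0 (_ : up - z <= 0)) ?subr_le0//=; lra.
have upz : up <= z := le_trans mup (ltW mz).
rewrite [if z < m then _ else _]ifF ?(lt_gtF mz)// [if z < up then _ else _]ifF ?ltNge ?upz//.
rewrite ger0_norm ?subr_ge0 ?(ltW mz)//.
rewrite (pospart0 (_ : up - z <= 0)) ?subr_le0 // (pospart0 (_ : m - z <= 0)) ?subr_le0 ?(ltW mz)//.
rewrite (pospart_id (_ : 0 <= z - m)) ?subr_ge0 ?(ltW mz)//.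
have [umz|zum] := ltP um z.
  rewrite (pospart_id (_ : 0 <= z - um)) ?subr_ge0 ?(ltW umz)//.
  by move: (right umz) => /=; lra.
by rewrite (pospart0 (_ : z - um <= 0)) ?subr_le0//=; lra.
Qed.

End inequality.

Lemma strongly_convexN alpha g : strongly_convex alpha g -> strongly_convex alpha (g \o -%R).
Proof.
move=> gc a b c ab bc /=; have := gc (- c) (- b) (- a); rewrite !lerN2 => /(_ bc ab); lra.
Qed.

(** The reflection [z |-> - z] exchanges the two states and turns [Q] into [- Q]. *)
Lemma kruzhkov_slow g up um M Theta alpha B w eps z : up < um ->
  `|up| <= M -> `|um| <= M -> 0 < alpha -> 0 <= B -> 0 <= w -> 0 <= eps -> 0 <= Theta ->
  (forall y z, `|y| <= M -> `|z| <= M -> `|g y - g z| <= Theta * `|y - z|) ->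
  strongly_convex alpha g -> 2 * B * Theta <= alpha * (um - up) ^+ 2 / 16 ->
  2 * B * Theta + 4 * M * Theta <= w * eps -> `|z| <= M ->
  kruzhkov_eta up um B w z * (g z - (g up + eps)) + kruzhkov_Q g up um B w z * (up - z)
    <= - (B * eps).
Proof.
move=> upum upM umM a0 B0 w0 e0 T0 gL gc BT wl zM.
have := @kruzhkov_fast (g \o -%R) (- um) (- up) M Theta alpha B w eps.
rewrite ltrN2 !normrN => /(_ upum umM upM a0 B0 w0 e0 T0).
have gL' y x : `|y| <= M -> `|x| <= M -> `|(g \o -%R) y - (g \o -%R) x| <= Theta * `|y - x|.
  move=> yM xM /=; rewrite (_ : y - x = - (- y - - x)); last by ring.
  by rewrite normrN gL ?normrN.
have gc' := strongly_convexN gc.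
move=> /(_ gL' gc'); rewrite (_ : - up - - um = um - up); last by ring.
move=> /(_ BT wl (- z)); rewrite normrN => /(_ zM).
rewrite kruzhkov_etaN kruzhkov_QN /= !opprK.
by lra.
Qed.

End kruzhkov.

Section smoothed_kinks.
Context {R : realType}.
Implicit Types (F dF : R -> R) (k m v z M Theta nu w : R).

(** The derivative of a kink smoothed at scale [nu]: entropies have to be differentiable. *)
Definition ramp nu z := Num.max 0 (Num.min 1 (z / nu)).

Lemma ramp_ge0 nu z : 0 <= ramp nu z.
Proof. by rewrite le_max lexx. Qed.

Lemma ramp_le1 nu z : ramp nu z <= 1.
Proof. by rewrite ge_max ler01/= ge_min lexx. Qed.

Lemma ramp0 nu z : 0 < nu -> z <= 0 -> ramp nu z = 0.
Proof. by move=> n0 z0; apply: max_l; rewrite ge_min pmulr_lle0 ?invr_gt0// z0 orbT. Qed.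

Lemma ramp1 nu z : 0 < nu -> nu <= z -> ramp nu z = 1.
Proof. by move=> n0 nz; rewrite /ramp min_l ?ler_pdivlMr ?mul1r// max_r. Qed.

Lemma le_ramp nu y z : 0 < nu -> y <= z -> ramp nu y <= ramp nu z.
Proof.
move=> n0 yz; rewrite /ramp ge_max !le_max lexx/=; apply/orP; right.
by rewrite le_min !ge_min lexx/= ler_pM2r ?invr_gt0// yz orbT.
Qed.

Lemma continuous_ramp nu : continuous (ramp nu).
Proof.
move=> z; apply: (@continuous_max _ _ (cst 0) (fun z => Num.min 1 (z / nu)) z).
  exact: cvg_cst.
apply: (@continuous_min _ _ (cst 1) (fun z => z / nu) z); first exact: cvg_cst.
by apply: (@cvgM _ _ _ _ id (cst nu^-1)); [exact: cvg_id|exact: cvg_cst].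
Qed.

Lemma prim_cst (g : R -> R) u v : continuous g ->
  (forall x, Num.min u v <= x <= Num.max u v -> g x = 0) -> prim g v = prim g u.
Proof.
move=> cg uv; apply/eqP; rewrite -subr_eq0 -normr_le0 -(mul0r `|v - u|).
by apply: (prim_lipschitz cg) => x /uv ->; rewrite normr0.
Qed.

Section one_kink.
Variables (F dF : R -> R) (Theta nu M : R).
Hypotheses (hF : forall x : R, is_derive x 1 F (dF x)) (cdF : continuous dF).
Hypotheses (nu0 : 0 < nu) (T0 : 0 <= Theta).
Hypothesis dFT : forall x, `|x| <= M -> `|dF x| <= Theta.

Let cu k : continuous (fun z => ramp nu (z - k) * dF z).
Proof.
move=> z; apply: cvgM; last exact: cdF.
apply: (@continuous_comp _ _ _ (fun z => z - k) (ramp nu)); last exact: continuous_ramp.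
by apply: cvgB; [exact: cvg_id|exact: cvg_cst].
Qed.

Let cd k : continuous (fun z => ramp nu (k - z) * dF z).
Proof.
move=> z; apply: cvgM; last exact: cdF.
apply: (@continuous_comp _ _ _ (fun z => k - z) (ramp nu)); last exact: continuous_ramp.
by apply: cvgB; [exact: cvg_cst|exact: cvg_id].
Qed.

(** The smoothed and the sharp jump only drift apart within distance [nu] of the kink. *)
Let short (D dD : R -> R) a b : (forall x : R, is_derive x 1 D (dD x)) ->
  (forall x, Num.min a b <= x <= Num.max a b -> `|dD x| <= Theta) ->
  (forall x, Num.min a b <= x <= Num.max a b -> nu <= `|x - a| -> dD x = 0) ->
  `|D b - D a| <= nu * Theta.
Proof.
move=> hD h1 h2; have [ba|/ltW ba] := leP `|b - a| nu.
  by rewrite (le_trans (derive_norm_le hD h1))// mulrC ler_wpM2r.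
have [c [ca cb]] : exists c, [/\ `|c - a| <= nu,
    forall x, Num.min a c <= x <= Num.max a c -> Num.min a b <= x <= Num.max a b &
    forall x, Num.min c b <= x <= Num.max c b ->
      Num.min a b <= x <= Num.max a b /\ nu <= `|x - a|].
  move: nu0 ba => n0; have [ab|ab] := leP a b => ba.
    exists (a + nu); move: ba; rewrite ger0_norm ?subr_ge0// => ba.
    have [ac cb] : a <= a + nu /\ a + nu <= b by lra.
    rewrite (min_l ac) (max_r ac) (min_l cb) (max_r cb) addrAC subrr add0r; split.
    - by rewrite gtr0_norm.
    - by move=> x /andP[-> /le_trans ->].
    - move=> x /andP[cx ->]; rewrite (le_trans ac cx) ger0_norm; first by move: cx; lra.
      by move: cx; lra.
  exists (a - nu); move: ba; rewrite ltr0_norm ?subr_lt0// => ba.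
  have [ac cb] : a - nu <= a /\ b <= a - nu by lra.
  rewrite (min_r ac) (max_l ac) (min_r cb) (max_l cb) addrAC subrr add0r; split.
  - by rewrite normrN gtr0_norm.
  - by move=> x /andP[cx ->]; rewrite (le_trans cb cx).
  - move=> x /andP[-> xc]; rewrite (le_trans xc ac) ler0_norm; first by move: xc; lra.
    by move: xc; lra.
move=> acb; have -> : D b = D c.
  apply/eqP; rewrite -subr_eq0 -normr_le0 -(mul0r `|b - c|).
  by apply: (derive_norm_le hD) => x /acb[xab xa]; rewrite h2 ?normr0.
rewrite (le_trans (derive_norm_le hD (C := Theta) _))//; last by rewrite mulrC ler_wpM2r.
by move=> x /cb; exact: h1.
Qed.

Lemma ramp_up_bound m k v : m <= k -> `|k| <= M -> `|v| <= M ->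
  `|prim (fun z => ramp nu (z - k) * dF z) v - prim (fun z => ramp nu (z - k) * dF z) m
    - kruzhkov_jump F k v| <= nu * Theta.
Proof.
move=> mk kM vM; have c := @cu k.
have zero a b : a <= k -> b <= k -> prim (fun z => ramp nu (z - k) * dF z) b =
    prim (fun z => ramp nu (z - k) * dF z) a.
  move=> ak bk; apply: (prim_cst c) => x /andP[_]; rewrite le_max => xk.
  by rewrite ramp0 ?mul0r// subr_le0; case/orP: xk => /le_trans; apply.
rewrite /kruzhkov_jump; case: ifPn => [kv|]; last first.
  by rewrite -leNgt => vk; rewrite (zero m v)// subrr subr0 normr0 mulr_ge0// ltW.
rewrite (zero k m)//.
have hD (x : R) : is_derive x 1 (fun z => prim (fun z => ramp nu (z - k) * dF z) z - F z)
    (ramp nu (x - k) * dF x - dF x) by apply: derB => //; exact: der_prim.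
rewrite [X in `|X|](_ : _ = (prim (fun z => ramp nu (z - k) * dF z) v - F v)
   - (prim (fun z => ramp nu (z - k) * dF z) k - F k)); last by ring.
apply: (short hD); rewrite min_l ?max_r ?ltW// => x /andP[kx xv].
  rewrite -{2}(mul1r (dF x)) -mulrBl normrM -[leRHS]mul1r ler_pM//; last first.
    apply: dFT; move: kM vM; rewrite !ler_norml => /andP[? ?] /andP[? ?].
    by apply/andP; split; lra.
  by rewrite ler_norml; have := ramp_ge0 nu (x - k); have := ramp_le1 nu (x - k) => *; apply/andP; split; lra.
by rewrite ger0_norm ?subr_ge0// => nx; rewrite ramp1// mul1r subrr.
Qed.

Lemma ramp_down_bound m k v : k <= m -> `|k| <= M -> `|v| <= M ->
  `|prim (fun z => ramp nu (k - z) * dF z) v - prim (fun z => ramp nu (k - z) * dF z) m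
    - kruzhkov_jump (F \o -%R) (- k) (- v)| <= nu * Theta.
Proof.
move=> mk kM vM; have c := @cd k.
have zero a b : k <= a -> k <= b -> prim (fun z => ramp nu (k - z) * dF z) b =
    prim (fun z => ramp nu (k - z) * dF z) a.
  move=> ak bk; apply: (prim_cst c) => x /andP[+ _]; rewrite ge_min => xk.
  by rewrite ramp0 ?mul0r// subr_le0; case/orP: xk; exact: le_trans.
rewrite /kruzhkov_jump /= !opprK ltrN2; case: ifPn => [kv|]; last first.
  by rewrite -leNgt => vk; rewrite (zero m v)// subrr subr0 normr0 mulr_ge0// ltW.
rewrite (zero k m)//.
have hD (x : R) : is_derive x 1 (fun z => prim (fun z => ramp nu (k - z) * dF z) z - F z)
    (ramp nu (k - x) * dF x - dF x) by apply: derB => //; exact: der_prim.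
rewrite [X in `|X|](_ : _ = (prim (fun z => ramp nu (k - z) * dF z) v - F v)
   - (prim (fun z => ramp nu (k - z) * dF z) k - F k)); last by ring.
apply: (short hD); rewrite min_r ?max_l ?ltW// => x /andP[vx xk].
  rewrite -{2}(mul1r (dF x)) -mulrBl normrM -[leRHS]mul1r ler_pM//; last first.
    apply: dFT; move: kM vM; rewrite !ler_norml => /andP[? ?] /andP[? ?].
    by apply/andP; split; lra.
  by rewrite ler_norml; have := ramp_ge0 nu (k - x); have := ramp_le1 nu (k - x) => *; apply/andP; split; lra.
by rewrite ler0_norm ?subr_le0// opprB => nx; rewrite ramp1// mul1r subrr.
Qed.

End one_kink.

Section entropy_slope.
Variables (up um w nu : R).
Let m := (up + um) / 2.
Hypotheses (upum : up < um) (w0 : 0 <= w) (nu0 : 0 < nu).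

Definition entropy_slope z :=
  ramp nu (z - m) - ramp nu (m - z) + w * ramp nu (z - um) - w * ramp nu (up - z).

Let cup k : continuous (fun z => ramp nu (z - k)).
Proof.
move=> z; apply: (@continuous_comp _ _ _ (fun z => z - k) (ramp nu)); last exact: continuous_ramp.
by apply: cvgB; [exact: cvg_id|exact: cvg_cst].
Qed.

Let cdown k : continuous (fun z => ramp nu (k - z)).
Proof.
move=> z; apply: (@continuous_comp _ _ _ (fun z => k - z) (ramp nu)); last exact: continuous_ramp.
by apply: cvgB; [exact: cvg_cst|exact: cvg_id].
Qed.

Lemma continuous_entropy_slope : continuous entropy_slope.
Proof.
move=> z; apply: cvgB; last by apply: cvgM; [exact: cvg_cst|exact: (@cdown up z)].
apply: cvgD; last by apply: cvgM; [exact: cvg_cst|exact: (@cup um z)].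
by apply: cvgB; [exact: (@cup m z)|exact: (@cdown m z)].
Qed.

Lemma le_entropy_slope y z : y <= z -> entropy_slope y <= entropy_slope z.
Proof.
move=> yz.
have r k : ramp nu (y - k) <= ramp nu (z - k) by rewrite le_ramp ?lerD2r.
have d k : ramp nu (k - z) <= ramp nu (k - y) by rewrite le_ramp ?lerD2l ?lerN2.
have := r m; have := d m; have := ler_wpM2l w0 (r um); have := ler_wpM2l w0 (d up).
by rewrite /entropy_slope; lra.
Qed.

Lemma entropy_slope_le z : `|entropy_slope z| <= 2 + 2 * w.
Proof.
have r k : 0 <= ramp nu k <= 1 by rewrite ramp_ge0 ramp_le1.
have wr k : 0 <= w * ramp nu k <= w by rewrite mulr_ge0 ?ramp_ge0// ler_piMr ?ramp_le1.
move: (r (z - m)) (r (m - z)) (wr (z - um)) (wr (up - z)) w0.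
by rewrite /entropy_slope ler_norml => /andP[? ?] /andP[? ?] /andP[? ?] /andP[? ?] ?;
  apply/andP; split; lra.
Qed.

Lemma entropy_slope_mid : entropy_slope m = 0.
Proof.
rewrite /entropy_slope subrr !ramp0//; first by rewrite !mulr0; ring.
  by rewrite subr_le0 /m; move: upum; lra.
by rewrite subr_le0 /m; move: upum; lra.
Qed.

Section entropy_primitive.
Variables (F dF : R -> R) (Theta M : R).
Hypotheses (upM : `|up| <= M) (umM : `|um| <= M).
Hypotheses (hF : forall x : R, is_derive x 1 F (dF x)) (cdF : continuous dF).
Hypotheses (T0 : 0 <= Theta).
Hypothesis dFT : forall x, `|x| <= M -> `|dF x| <= Theta.

(** With [dF = 1] this gives the smooth entropy, with [dF = d2 f x] its flux. *)
Definition entropy_primitive v :=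
  prim (fun z => entropy_slope z * dF z) v - prim (fun z => entropy_slope z * dF z) m.

Let mM : `|m| <= M.
Proof.
move: umM upM; rewrite !ler_norml /m => /andP[? ?] /andP[? ?]; apply/andP; split; lra.
Qed.

Let cS : continuous (fun z => entropy_slope z * dF z).
Proof. by move=> z; apply: cvgM; [exact: continuous_entropy_slope|exact: cdF]. Qed.

Let cu k : continuous (fun z => ramp nu (z - k) * dF z).
Proof. by move=> z; apply: cvgM; [exact: (@cup k z)|exact: cdF]. Qed.

Let cd k : continuous (fun z => ramp nu (k - z) * dF z).
Proof. by move=> z; apply: cvgM; [exact: (@cdown k z)|exact: cdF]. Qed.

Lemma der_entropy_primitive (v : R) : is_derive v 1 entropy_primitive (entropy_slope v * dF v).
Proof. by apply: (der_eq (derB (der_prim v cS) (der_cst _ _))); rewrite subr0. Qed.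

Lemma entropy_primitive_le v : `|v| <= M -> `|entropy_primitive v| <= (2 + 2 * w) * Theta * (2 * M).
Proof.
move=> vM; have k0 : 0 <= (2 + 2 * w) * Theta by rewrite mulr_ge0// addr_ge0// mulr_ge0.
apply: (@le_trans _ _ ((2 + 2 * w) * Theta * `|v - m|)).
  apply: (prim_lipschitz cS) => x /andP[]; rewrite ge_min le_max => x1 x2.
  rewrite normrM ler_pM ?entropy_slope_le// dFT//.
  move: mM vM; rewrite !ler_norml => /andP[? ?] /andP[? ?].
  by apply/andP; split; [case/orP: x1 => /(le_trans _); exact|case/orP: x2 => /le_trans; exact].
rewrite ler_wpM2l// (le_trans (ler_normB _ _))//.
by rewrite mulr_natl mulr2n lerD.
Qed.

Lemma entropy_primitive_kinks v : `|v| <= M ->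
  `|entropy_primitive v - (kruzhkov_jump F m v - kruzhkov_jump (F \o -%R) (- m) (- v)
    + w * kruzhkov_jump F um v - w * kruzhkov_jump (F \o -%R) (- up) (- v))|
  <= (2 + 2 * w) * (nu * Theta).
Proof.
move=> vM.
pose U k v := prim (fun z => ramp nu (z - k) * dF z) v.
pose D k v := prim (fun z => ramp nu (k - z) * dF z) v.
have mum : m <= um by rewrite /m; move: upum; lra.
have upm : up <= m by rewrite /m; move: upum; lra.
have E y : prim (fun z => entropy_slope z * dF z) y =
    U m y - D m y + w * U um y - w * D up y - (U m 0 - D m 0 + w * U um 0 - w * D up 0).
  apply: (prim_der (h := fun y => U m y - D m y + w * U um y - w * D up y)); last exact: cS.
  move=> x; have := derB (derD (derB (der_prim x (@cu m)) (der_prim x (@cd m)))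
    (derZ w (der_prim x (@cu um)))) (derZ w (der_prim x (@cd up))).
  by move=> h; apply: (der_eq h); rewrite /entropy_slope; ring.
have := ramp_up_bound hF cdF nu0 T0 dFT (lexx m) mM vM.
have := ramp_down_bound hF cdF nu0 T0 dFT (lexx m) mM vM.
have := ramp_up_bound hF cdF nu0 T0 dFT mum umM vM.
have := ramp_down_bound hF cdF nu0 T0 dFT upm upM vM.
rewrite /entropy_primitive !E -/(U m v) -/(U m m) -/(U um v) -/(U um m).
rewrite -/(D m v) -/(D m m) -/(D up v) -/(D up m).
move: (kruzhkov_jump F m v) (kruzhkov_jump F um v).
move: (kruzhkov_jump (F \o -%R) (- m) (- v)) (kruzhkov_jump (F \o -%R) (- up) (- v)).
move: (U m v) (U m m) (U um v) (U um m) (D m v) (D m m) (D up v) (D up m).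
move: (U m 0) (U um 0) (D m 0) (D up 0) => u1 u2 d1 d2 a1 a2 a3 a4 a5 a6 a7 a8 j1 j2 j3 j4 b1 b2 b3 b4.
rewrite [X in `|X|](_ : _ = (a1 - a2 - j3) - (a5 - a6 - j1) + w * (a3 - a4 - j4) - w * (a7 - a8 - j2)); last first.
  by ring.
rewrite (le_trans (ler_normB _ _))// (le_trans (lerD (ler_normD _ _) (lexx _)))//.
rewrite (le_trans (lerD (lerD (ler_normB _ _) (lexx _)) (lexx _)))//.
rewrite !normrM (ger0_norm w0); have := ler_wpM2l w0 b1; have := ler_wpM2l w0 b2.
by move: b3 b4; lra.
Qed.

End entropy_primitive.
End entropy_slope.
End smoothed_kinks.

(** What the lower bound needs of the entropy: a positive lower bound, by which the decay
    of the cut-off in time dominates its slope in space, and one sign condition for each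
    of the three barriers. *)
Record barrier_entropy {R : realType} (f : R -> R -> R) (up um M c eps B C : R)
    (eta : R -> R) (Q : R -> R -> R) : Prop := BarrierEntropy {
  be_pair : entropy_pair f eta Q ;
  be_slope : continuous (derive1 eta) ;
  be_flux : jointly_continuous Q ;
  be_ge : forall v, B <= eta v ;
  be_eta_le : forall v, `|v| <= M -> `|eta v| <= C ;
  be_flux_le : forall x v, `|v| <= M -> `|Q x v| <= C ;
  be_fast : forall x v, `|v| <= M ->
    eta v * (f x v - (f 0 um + eps)) + Q x v * (um - v) <= 0 ;
  be_slow : forall x v, `|v| <= M ->
    eta v * (f x v - (f 0 up + eps)) + Q x v * (up - v) <= 0 ;
  be_mid : forall x v, `|v| <= M ->
    eta v * (f x v - ((f 0 up + f 0 um) / 2 - c)) + Q x v * ((up + um) / 2 - v) <= 0 }.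

Section barrier_entropy_exists.
Context {R : realType}.

Lemma convex_of_monotone_slope (g dg : R -> R) : (forall x : R, is_derive x 1 g (dg x)) ->
  (forall x y, x <= y -> dg x <= dg y) -> convex_function (setT : set R^o) g.
Proof.
move=> hg hd.
have tangent w z : g w + dg w * (z - w) <= g z.
  have [wz|/ltW zw] := leP w z.
    have := derive_ge (C := dg w) wz (fun x _ => hg x); move=> H.
    have {}H : dg w * (z - w) <= g z - g w by apply: H => x /andP[wx _]; exact: hd.
    by move: H; lra.
  have := derive_le (C := dg w) zw (fun x _ => hg x); move=> H.
  have {}H : g w - g z <= dg w * (w - z) by apply: H => x /andP[_ xw]; exact: hd.
  by move: H; lra.
move=> t x y _ _.
change (g (t%:num * x + (1 - t%:num) * y) <= t%:num * g x + (1 - t%:num) * g y).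
have t0 : 0 <= t%:num by [].
have t1 : 0 <= 1 - t%:num by rewrite subr_ge0.
move: (t%:num) t0 t1 => s s0 s1.
set z := s * x + (1 - s) * y.
have h1 := ler_wpM2l s0 (tangent z x); have h2 := ler_wpM2l s1 (tangent z y).
have e : s * (dg z * (x - z)) + (1 - s) * (dg z * (y - z)) = 0 by rewrite /z; ring.
move: h1 h2 e.
by move: (g z) (g x) (g y) (dg z * _) (dg z * _) => *; lra.
Qed.

(** Smoothing the kinks of the Kruzhkov entropy costs less than the defect. *)
Lemma smoothing_defect (Ee Qe Ek Qk F P H L P0 d eps : R) :
  Ek * F + Qk * P <= - d -> `|Ee - Ek| <= eps -> `|Qe - Qk| <= eps * L ->
  `|F| <= H -> `|P| <= P0 -> 0 <= eps -> 0 <= L -> eps * (H + L * P0) <= d ->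
  Ee * F + Qe * P <= 0.
Proof.
move=> k he hq hF hP e0 L0 hd.
have : `|(Ee - Ek) * F| <= eps * H by rewrite normrM ler_pM.
have : `|(Qe - Qk) * P| <= eps * L * P0 by rewrite normrM ler_pM.
rewrite !ler_norml => /andP[_ +] /andP[_ +].
by move: k hd; lra.
Qed.

Lemma pospart_jump (k z : R) : kruzhkov_jump id k z = pospart (z - k).
Proof.
rewrite /kruzhkov_jump; case: ifPn => [kz|]; first by rewrite pospart_id// subr_ge0 ltW.
by rewrite -leNgt => zk; rewrite pospart0// subr_le0.
Qed.

Lemma pospart_jumpN (k z : R) : - kruzhkov_jump (id \o -%R) (- k) (- z) = pospart (k - z).
Proof.
rewrite /kruzhkov_jump /= !opprK ltrN2; case: ifPn => [kz|].
  by rewrite pospart_id ?opprB// subr_ge0 ltW.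
by rewrite -leNgt => zk; rewrite pospart0 ?oppr0// subr_le0.
Qed.

Variables (f : R -> R -> R) (up um M alpha Theta eps : R).
Let D := um - up.
Let c := alpha * D ^+ 2 / 16.
Let m := (up + um) / 2.
Hypotheses (f2 : Ck 2 f) (upum : up < um) (upM : `|up| <= M) (umM : `|um| <= M).
Hypotheses (alpha0 : 0 < alpha) (convex : forall x z, alpha <= d2 (d2 f) x z).
Hypotheses (Theta0 : 0 <= Theta) (dfT : forall x z, `|z| <= M -> `|d2 f x z| <= Theta).
Hypotheses (eps0 : 0 < eps) (stat : forall w x y, w = um \/ w = up -> f x w = f y w).

Let D0 : 0 < D. Proof. by rewrite subr_gt0. Qed.
Let c0 : 0 < c. Proof. by rewrite divr_gt0// mulr_gt0// exprn_gt0. Qed.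
Let M0 : 0 <= M. Proof. exact: le_trans (normr_ge0 _) umM. Qed.
Let B := c / (2 * Theta + 1).
Let T1 : 0 < 2 * Theta + 1. Proof. by rewrite ltr_wpDl// mulr_ge0. Qed.
Let B0 : 0 < B. Proof. by rewrite divr_gt0. Qed.
Let w := (c + 4 * M * Theta) / eps.
Let w0 : 0 <= w. Proof. by rewrite divr_ge0 ?(ltW eps0)// addr_ge0 ?(ltW c0)// !mulr_ge0. Qed.
Let H := 2 * M * Theta + eps + c.

Let BT : 2 * B * Theta <= c.
Proof.
rewrite /B (_ : _ * Theta = c * (2 * Theta) / (2 * Theta + 1)); last by field; rewrite gt_eqF.
by rewrite ler_pdivrMr// ler_wpM2l ?(ltW c0)// lerDl.
Qed.

Let wl : 2 * B * Theta + 4 * M * Theta <= w * eps.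
Proof. by rewrite /w divfK ?gt_eqF// lerD2r. Qed.

Let gL x y z : `|y| <= M -> `|z| <= M -> `|f x y - f x z| <= Theta * `|y - z|.
Proof.
move=> yM zM; apply: (derive_norm_le (Ck_d2 (CkS f2) x)) => s /andP[]; rewrite ge_min le_max => x1 x2.
apply: dfT; move: yM zM; rewrite !ler_norml => /andP[? ?] /andP[? ?].
by apply/andP; split; [case/orP: x1 => /(le_trans _); exact|case/orP: x2 => /le_trans; exact].
Qed.

Let d2f : Ck 1 (d2 f). Proof. by case: f2 => _ []. Qed.

Let gconv x : strongly_convex alpha (f x).
Proof. exact: (strongly_convexP (Ck_d2 (CkS f2) x) (Ck_d2 d2f x) (convex x)). Qed.

Let H0 : 0 < H.
Proof. by rewrite /H -addrA ltr_wpDl ?addr_gt0// !mulr_ge0. Qed.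

Let K := H + Theta * (2 * M).
Let K0 : 0 < K. Proof. by rewrite ltr_pwDl// !mulr_ge0. Qed.
Let d := B * Num.min eps c.
Let d0 : 0 < d. Proof. by rewrite mulr_gt0// lt_min eps0. Qed.
Let w2 : 0 < 2 + 2 * w. Proof. by rewrite ltr_pwDl// mulr_ge0. Qed.
Let nu := d / K / (2 + 2 * w).
Let nu0 : 0 < nu. Proof. by rewrite !divr_gt0. Qed.

Let nuE : (2 + 2 * w) * nu = d / K. Proof. by rewrite mulrC /nu divfK// gt_eqF. Qed.

Let eta v := B + entropy_primitive up um w nu (fun=> 1) v.
Let Q x v := B * ((f 0 um - f 0 up) / D) + entropy_primitive up um w nu (d2 f x) v.

Let c1 : continuous (fun _ : R => 1 : R). Proof. by move=> x; exact: cvg_cst. Qed.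
Let cdf x : continuous (d2 f x). Proof. by move=> z; exact: (@jcont_r _ _ x (Ck_jcont d2f)). Qed.

Let der_eta (v : R) : is_derive v 1 eta (entropy_slope up um w nu v).
Proof.
apply: (der_eq (derD (der_cst _ _) (@der_entropy_primitive _ up um w nu _ c1 v))).
by rewrite add0r mulr1.
Qed.

Let mM : `|m| <= M.
Proof.
move: umM upM; rewrite !ler_norml /m => /andP[? ?] /andP[? ?]; apply/andP; split; lra.
Qed.

Let eta_kruzhkov v : `|v| <= M -> `|eta v - kruzhkov_eta up um B w v| <= d / K.
Proof.
move=> vM.
have id1 (x : R) : is_derive x 1 id (1 : R) by exact: der_id.
have one1 (x : R) : `|x| <= M -> `|1 : R| <= 1 by rewrite normr1.
have := entropy_primitive_kinks upum w0 nu0 upM umM id1 c1 ler01 one1 vM.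
rewrite mulr1 nuE; apply: le_trans.
rewrite le_eqVlt; apply/orP; left; apply/eqP; congr (`| _ |).
rewrite /eta /kruzhkov_eta -/m -(pospart_jump m v) -(pospart_jump um v).
rewrite -(pospart_jumpN m v) -(pospart_jumpN up v); ring.
Qed.

Let Q_kruzhkov x v : `|v| <= M -> `|Q x v - kruzhkov_Q (f x) up um B w v| <= d / K * Theta.
Proof.
move=> vM.
have := entropy_primitive_kinks upum w0 nu0 upM umM (Ck_d2 (CkS f2) x) (@cdf x) Theta0 (@dfT x) vM.
rewrite mulrA nuE; apply: le_trans.
rewrite le_eqVlt; apply/orP; left; apply/eqP; congr (`| _ |).
rewrite /Q /kruzhkov_Q -/D (stat x 0 (or_introl erefl)) (stat x 0 (or_intror erefl)); ring.
Qed.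

Let defect x v h p : `|v| <= M -> `|p| <= M -> `|f x v - h| <= H ->
  (exists2 b, Num.min eps c <= b & kruzhkov_eta up um B w v * (f x v - h) + kruzhkov_Q (f x) up um B w v * (p - v) <= - (B * b)) ->
  eta v * (f x v - h) + Q x v * (p - v) <= 0.
Proof.
move=> vM pM hH [b eb kb].
apply: (@smoothing_defect _ _ _ _ _ _ H Theta (2 * M) d (d / K) _ (eta_kruzhkov vM) (Q_kruzhkov x vM)) => //.
- by rewrite (le_trans kb)// lerN2 ler_wpM2l// ltW.
- by rewrite (le_trans (ler_normB _ _))// mulr_natl mulr2n lerD.
- by rewrite ltW// divr_gt0.
- by rewrite -/K divfK ?gt_eqF.
Qed.

Let jcS : jointly_continuous (fun x z : R => entropy_slope up um w nu z).
Proof.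
move=> p; apply: (@continuous_comp _ _ _ snd (entropy_slope up um w nu)); first exact: cvg_snd.
exact: continuous_entropy_slope.
Qed.

Let jcG : jointly_continuous (fun x z => entropy_slope up um w nu z * d2 f x z).
Proof. by apply: jcontM => //; exact: Ck_jcont d2f. Qed.

Let jcG1 : jointly_continuous (fun x z => entropy_slope up um w nu z * d1 (d2 f) x z).
Proof. by apply: jcontM => //; case: d2f => _ [_ _ []]. Qed.

Let jcontB (g k : R -> R -> R) : jointly_continuous g -> jointly_continuous k ->
  jointly_continuous (fun x y => g x y - k x y).
Proof. by move=> cg ck p; apply: cvgB; [exact: cg|exact: ck]. Qed.

Let jc_mid (g : R -> R -> R) : jointly_continuous g -> jointly_continuous (fun x v => g x v - g x m).
Proof.
move=> cg; apply: jcontB => // p.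
apply: (@continuous_comp _ _ _ fst (g ^~ m)); first exact: cvg_fst.
exact: jcont_l.
Qed.

Let jcQ : jointly_continuous Q.
Proof.
have h := jc_mid (jcont_prim jcG).
by move=> p; apply: cvgD; [exact: cvg_cst|exact: h].
Qed.

Let der1Q (x v : R) : is_derive x 1 (Q ^~ v)
  (prim (fun z => entropy_slope up um w nu z * d1 (d2 f) x z) v
   - prim (fun z => entropy_slope up um w nu z * d1 (d2 f) x z) m).
Proof.
have h (x' y : R) : is_derive x' 1 (fun x => entropy_slope up um w nu y * d2 f x y)
    (entropy_slope up um w nu y * d1 (d2 f) x' y).
  exact: derZ (Ck_d1 d2f _ _).
have hd := derD (der_cst (B * ((f 0 um - f 0 up) / D)) x)
  (derB (der_prim_param x v jcG jcG1 h) (der_prim_param x m jcG jcG1 h)).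
by apply: (der_eq hd); rewrite add0r.
Qed.

(** [B] is small enough for the intermediate state, then [w] large enough for the outer
    states, then [nu] small enough for the smoothing to cost less than the slack
    [B * min eps c] left by the sharp inequalities. *)
Lemma barrier_entropy_exists : exists B' C eta' Q', 0 < B' /\
  barrier_entropy f up um M c eps B' C eta' Q'.
Proof.
have slopeE : derive1 eta = entropy_slope up um w nu.
  by apply/funext => v; exact: (is_derive_derive1 (der_eta v)).
have minE : Num.min eps c <= eps by rewrite ge_min lexx.
have minC : Num.min eps c <= c by rewrite ge_min lexx orbT.
have fM x z y : `|z| <= M -> `|y| <= M -> `|f x z - f x y| <= 2 * M * Theta.
  move=> zM yM; rewrite (le_trans (gL x zM yM))// mulrC ler_wpM2r//.
  by rewrite (le_trans (ler_normB _ _))// mulr_natl mulr2n lerD.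
have fu x : f 0 um = f x um by apply: stat; left.
have fp x : f 0 up = f x up by apply: stat; right.
have c0' := ltW c0; have e0' := ltW eps0.
exists B, (B + (2 + 2 * w) * (2 * M) + (B * `|(f 0 um - f 0 up) / D| + (2 + 2 * w) * Theta * (2 * M))), eta, Q.
have k1 : 0 <= (2 + 2 * w) * (2 * M) by rewrite !mulr_ge0// ltW.
have k2 : 0 <= (2 + 2 * w) * Theta * (2 * M) by rewrite !mulr_ge0// ltW.
have k3 : 0 <= B * `|(f 0 um - f 0 up) / D| by rewrite mulr_ge0// ltW.
split; first exact: B0.
split.
- split.
  + by apply: convex_of_monotone_slope der_eta _ => y z; exact: le_entropy_slope.
  + by move=> v; have := der_eta v => h; exact: ex_derive.
  + move=> x v; rewrite slopeE; apply: (der_eq (derD (der_cst _ _) (@der_entropy_primitive _ up um w nu _ (@cdf x) v))).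
    by rewrite add0r.
  + by move=> x v; have := der1Q x v => h; exact: ex_derive.
  + rewrite (_ : d1 Q = fun x v => prim (fun z => entropy_slope up um w nu z * d1 (d2 f) x z) v
       - prim (fun z => entropy_slope up um w nu z * d1 (d2 f) x z) m); first exact: jc_mid (jcont_prim jcG1).
    by apply/funext => x; apply/funext => v; exact: (is_derive_derive1 (der1Q x v)).
- by rewrite slopeE; exact: continuous_entropy_slope.
- exact: jcQ.
- move=> v; rewrite /eta lerDl.
  have E0 : entropy_primitive up um w nu (fun=> 1) m = 0 by rewrite /entropy_primitive subrr.
  have hd (x : R) : is_derive x 1 (entropy_primitive up um w nu (fun=> 1)) (entropy_slope up um w nu x).
    by apply: (der_eq (@der_entropy_primitive _ up um w nu _ c1 x)); rewrite mulr1.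
  have [mv|/ltW vm] := leP m v.
    have := derive_ge (C := 0) mv (fun x _ => hd x); rewrite mul0r E0 subr0; apply => x /andP[mx _].
    by rewrite -(entropy_slope_mid w upum nu0) le_entropy_slope.
  have := derive_le (C := 0) vm (fun x _ => hd x); rewrite mul0r E0 sub0r oppr_le0; apply => x /andP[_ xm].
  by rewrite -(entropy_slope_mid w upum nu0) le_entropy_slope.
- move=> v vM; have one1 (x : R) : `|x| <= M -> `|1 : R| <= 1 by rewrite normr1.
  have := entropy_primitive_le nu w0 upM umM c1 ler01 one1 vM.
  rewrite mulr1 => h; rewrite (le_trans (ler_normD _ _))// (gtr0_norm B0) -addrA lerD2l.
  by rewrite (le_trans h)// lerDl addr_ge0.
- move=> x v vM; have h := entropy_primitive_le nu w0 upM umM (@cdf x) Theta0 (@dfT x) vM.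
  rewrite (le_trans (ler_normD _ _))// normrM (gtr0_norm B0).
  by rewrite (le_trans (lerD (lexx _) h))// lerDr addr_ge0// ltW.
- move=> x v vM; apply: defect => //.
    rewrite (fu x) opprD addrA (le_trans (ler_normB _ _))// (gtr0_norm eps0).
    by have := fM x v um vM umM; rewrite /H; move: c0'; lra.
  exists eps => //; rewrite (fu x).
  exact: (kruzhkov_fast upum upM umM alpha0 (ltW B0) w0 e0' Theta0 (gL x) (gconv x) BT wl vM).
- move=> x v vM; apply: defect => //.
    rewrite (fp x) opprD addrA (le_trans (ler_normB _ _))// (gtr0_norm eps0).
    by have := fM x v up vM upM; rewrite /H; move: c0'; lra.
  exists eps => //; rewrite (fp x).
  exact: (kruzhkov_slow upum upM umM alpha0 (ltW B0) w0 e0' Theta0 (gL x) (gconv x) BT wl vM).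
- move=> x v vM; apply: defect => //; rewrite (fu x) (fp x).
    have := fM x v um vM umM; have := fM x v up vM upM; rewrite /H !ler_norml.
    move=> /andP[? ?] /andP[? ?]; move: c0' e0' => ? ?; apply/andP; split; lra.
  exists c => //.
  exact: (kruzhkov_mid upum upM umM alpha0 (ltW B0) w0 (gL x) (gconv x) BT vM).
Qed.

End barrier_entropy_exists.

(** * The lower bound *)

Section barriers.
Context {R : realType}.
Implicit Types (b : R * R * R) (bs : seq (R * R * R)) (W V G : R -> R -> R).

(** Barriers are triples [(p, h, k)], so that finitely many of them form a sequence. *)
Definition affine b x t : R := b.1.1 * x - b.1.2 * t + b.2.

Lemma der1_affine b (x t : R) : is_derive x 1 ((affine b) ^~ t) b.1.1.
Proof.
have h := derD (derB (derZ b.1.1 (der_id x)) (der_cst (b.1.2 * t) x)) (der_cst b.2 x).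
by apply: (der_eq h); ring.
Qed.

Lemma der2_affine b (x t : R) : is_derive t 1 (affine b x) (- b.1.2).
Proof.
have h := derD (derB (der_cst (b.1.1 * x) t) (derZ b.1.2 (der_id t))) (der_cst b.2 t).
by apply: (der_eq h); ring.
Qed.

Lemma Ck_affine n b : Ck n (affine b).
Proof.
apply: CkD; last exact: Ck_cst.
by apply: CkB; apply: CkM; [exact: Ck_cst|exact: Ck_fst|exact: Ck_cst|exact: Ck_snd].
Qed.

(** Summing exponentials gives a smooth substitute for the maximum of [W - A_b], and every
    term is at most 1 where the sum is. *)
Definition excess tau W b x t := expR ((W x t - affine b x t) / tau).

Definition total_excess tau W bs x t := \sum_(b <- bs) excess tau W b x t.

Variables (tau : R) (W V G : R -> R -> R).
Hypotheses (tau0 : 0 < tau) (sW : smooth W).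
Hypothesis W1 : forall x t : R, is_derive x 1 (W ^~ t) (V x t).
Hypothesis W2 : forall x t : R, is_derive t 1 (W x) (- G x t).

Lemma excess_ge0 b x t : 0 <= excess tau W b x t.
Proof. exact: expR_ge0. Qed.

Lemma Ck_excess n b : Ck n (excess tau W b).
Proof.
apply: Ck_expR; apply: CkM; last exact: Ck_cst.
by apply: CkB; [exact: sW|exact: Ck_affine].
Qed.

Lemma der1_excess b (x t : R) : is_derive x 1 ((excess tau W b) ^~ t)
  (excess tau W b x t * (tau^-1 * (V x t - b.1.1))).
Proof.
have h := derZ tau^-1 (derB (W1 x t) (der1_affine b x t)).
have := der_comp (is_derive_expR _) h.
rewrite (_ : (fun s => expR _) = (excess tau W b) ^~ t).
  by move=> {}h; apply: (der_eq h); rewrite /excess [_ / tau]mulrC.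
by apply/funext => s; rewrite /excess [_ / tau]mulrC.
Qed.

Lemma der2_excess b (x t : R) : is_derive t 1 (excess tau W b x)
  (excess tau W b x t * (tau^-1 * (b.1.2 - G x t))).
Proof.
have h := derZ tau^-1 (derB (W2 x t) (der2_affine b x t)).
have := der_comp (is_derive_expR _) h.
rewrite (_ : (fun s => expR _) = (excess tau W b) x).
  move=> {}h; apply: (der_eq h); rewrite /excess [_ / tau]mulrC opprK.
  by rewrite [- _ + _]addrC.
by apply/funext => s; rewrite /excess [_ / tau]mulrC.
Qed.

Lemma Ck_total n bs : Ck n (total_excess tau W bs).
Proof.
elim: bs => [|b bs IH].
  rewrite (_ : total_excess _ _ _ = fun _ _ => 0); first exact: Ck_cst.
  by apply/funext => x; apply/funext => t; rewrite /total_excess big_nil.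
rewrite (_ : total_excess _ _ _ = fun x t => excess tau W b x t + total_excess tau W bs x t).
  by apply: CkD => //; exact: Ck_excess.
by apply/funext => x; apply/funext => t; rewrite /total_excess big_cons.
Qed.

Lemma der1_total bs (x t : R) : is_derive x 1 ((total_excess tau W bs) ^~ t)
  (\sum_(b <- bs) excess tau W b x t * (tau^-1 * (V x t - b.1.1))).
Proof.
elim: bs => [|b bs IH].
  rewrite (_ : _ ^~ t = fun=> 0); first by rewrite big_nil; exact: der_cst.
  by apply/funext => s; rewrite /total_excess big_nil.
rewrite (_ : _ ^~ t = fun s => excess tau W b s t + total_excess tau W bs s t).
  by rewrite big_cons; exact: derD (der1_excess b x t) IH.
by apply/funext => s; rewrite /total_excess big_cons.
Qed.

Lemma der2_total bs (x t : R) : is_derive t 1 (total_excess tau W bs x)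
  (\sum_(b <- bs) excess tau W b x t * (tau^-1 * (b.1.2 - G x t))).
Proof.
elim: bs => [|b bs IH].
  rewrite (_ : total_excess _ _ _ x = fun=> 0); first by rewrite big_nil; exact: der_cst.
  by apply/funext => s; rewrite /total_excess big_nil.
rewrite (_ : total_excess _ _ _ x = fun s => excess tau W b x s + total_excess tau W bs x s).
  by rewrite big_cons; exact: derD (der2_excess b x t) IH.
by apply/funext => s; rewrite /total_excess big_cons.
Qed.

Lemma excess_le_total b bs x t : b \in bs -> excess tau W b x t <= total_excess tau W bs x t.
Proof.
elim: bs => // b' bs IH; rewrite inE /total_excess big_cons => /predU1P[->|/IH h].
  by rewrite lerDl sumr_ge0// => ? _; exact: excess_ge0.
by rewrite (le_trans h)// lerDr excess_ge0.
Qed.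

Lemma total_excess_ge1 b bs x t : b \in bs -> affine b x t <= W x t ->
  1 <= total_excess tau W bs x t.
Proof.
move=> bbs bW; apply: le_trans (excess_le_total x t bbs).
by rewrite /excess -expR0 ler_expR divr_ge0 ?subr_ge0// ltW.
Qed.

Lemma total_excess_small bs x t (g : R) : (forall b, b \in bs -> W x t + g <= affine b x t) ->
  total_excess tau W bs x t <= (size bs)%:R * expR (- (g / tau)).
Proof.
elim: bs => [|b bs IH] h; first by rewrite /total_excess big_nil mul0r.
rewrite /total_excess big_cons /= -natr1 mulrDl mul1r addrC; apply: lerD.
  by apply: IH => b' b'bs; apply: h; rewrite inE b'bs orbT.
rewrite ler_expR -mulNr ler_pM2r ?invr_gt0//.
by have := h b (mem_head _ _); lra.
Qed.

(** Where the entropy has the right sign at [v], the total excess is a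
    subsolution up to the error committed in replacing [(v, f(x, v))] by [(V, G)]. *)
Lemma total_excess_production bs (Ce eta q F z x t : R) :
  `|eta| <= Ce -> `|q| <= Ce ->
  (forall b, b \in bs -> eta * (F - b.1.2) + q * (b.1.1 - z) <= 0) ->
  total_excess tau W bs x t <= 1 ->
  - (eta * (\sum_(b <- bs) excess tau W b x t * (tau^-1 * (b.1.2 - G x t)))
     + q * (\sum_(b <- bs) excess tau W b x t * (tau^-1 * (V x t - b.1.1))))
  <= Ce / tau * (`|F - G x t| + `|z - V x t|).
Proof.
move=> he hq hb E1.
pose e := `|F - G x t| + `|z - V x t|.
have Ce0 : 0 <= Ce := le_trans (normr_ge0 _) he.
have e0 : 0 <= Ce / tau * e by rewrite mulr_ge0 ?addr_ge0// divr_ge0// ltW.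
apply: (@le_trans _ _ (\sum_(b <- bs) excess tau W b x t * (Ce / tau * e))); last first.
  by rewrite -big_distrl/= -[leRHS]mul1r ler_wpM2r.
rewrite !big_distrr -big_split/= -sumrN !big_seq; apply: ler_sum => b bbs.
rewrite [leLHS](_ : _ = excess tau W b x t * (tau^-1 * (eta * (G x t - b.1.2) + q * (b.1.1 - V x t)))); last first.
  by ring.
rewrite ler_wpM2l ?excess_ge0// [leRHS]mulrAC [leRHS]mulrC ler_wpM2l ?invr_ge0 ?(ltW tau0)//.
have h1 : - (eta * (F - G x t)) <= Ce * `|F - G x t|.
  by rewrite -mulrN (le_trans (ler_norm _))// normrM normrN ler_wpM2r.
have h2 : q * (z - V x t) <= Ce * `|z - V x t|.
  by rewrite (le_trans (ler_norm _))// normrM ler_wpM2r.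
have := hb b bbs; rewrite /e; move: h1 h2; lra.
Qed.

End barriers.

Section cutoff.
Context {R : realType}.
Variables (rho K lam B Ce : R).
Hypotheses (rho0 : 0 < rho) (K0 : 0 < K) (lam0 : 0 <= lam).
Hypothesis BK : 2 * rho * Ce + 1 <= B * K.
Let N := rho ^+ 4 * (lam + 1).
Let N0 : 0 < N. Proof. by rewrite mulr_gt0 ?exprn_gt0// ltr_wpDl. Qed.

Definition paraboloid x t : R := (rho ^+ 2 - (x ^+ 2 + K * t)) / N.

(** A bump over a parabolic cap. Its logarithmic derivative in the direction of the
    entropy flow is below any prescribed [- lam], which absorbs the source term. *)
Definition cutoff x t : R := flatexp (paraboloid x t).

Lemma der1_cutoff (x t : R) : is_derive x 1 (cutoff ^~ t) (- (2 * x / N) * dflatexp (paraboloid x t)).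
Proof.
have E s : paraboloid s t = N^-1 * (rho ^+ 2 - (s * s + K * t)) by rewrite /paraboloid; ring.
have h := derZ N^-1 (derB (der_cst (rho ^+ 2) x)
  (derD (derM (der_id x) (der_id x)) (der_cst (K * t) x))).
have := der_comp (der_flatexp _) h.
rewrite (_ : (fun s => flatexp _) = cutoff ^~ t).
  move=> {}h; apply: (der_eq h); rewrite E mulrC; congr (_ * _); ring.
by apply/funext => s; rewrite /cutoff E.
Qed.

Lemma der2_cutoff (x t : R) : is_derive t 1 (cutoff x) (- (K / N) * dflatexp (paraboloid x t)).
Proof.
have E s : paraboloid x s = N^-1 * (rho ^+ 2 - (x ^+ 2 + K * s)) by rewrite /paraboloid; ring.
have h := derZ N^-1 (derB (der_cst (rho ^+ 2) t)
  (derD (der_cst (x ^+ 2) t) (derZ K (der_id t)))).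
have := der_comp (der_flatexp _) h.
rewrite (_ : (fun s => flatexp _) = cutoff x).
  move=> {}h; apply: (der_eq h); rewrite E mulrC; congr (_ * _); ring.
by apply/funext => s; rewrite /cutoff E.
Qed.

Lemma Ck_cutoff n : Ck n cutoff.
Proof.
apply: Ck_flat; apply: CkM; last exact: Ck_cst.
apply: CkB; first exact: Ck_cst.
by apply: CkD; apply: CkM; [exact: Ck_fst|exact: Ck_fst|exact: Ck_cst|exact: Ck_snd].
Qed.

Lemma cutoff_support x t : 0 <= t -> 0 < paraboloid x t -> `|x| <= rho /\ t <= rho ^+ 2 / K.
Proof.
move=> t0; rewrite /paraboloid pmulr_lgt0 ?invr_gt0// subr_gt0 => h.
have Kt : 0 <= K * t by rewrite mulr_ge0// ltW.
split; last by rewrite ler_pdivlMr// mulrC; have := sqr_ge0 x; move: h; lra.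
rewrite -(ger0_norm (ltW rho0)) -ler_sqr ?nnegrE// !real_normK ?num_real//.
by move: h Kt; lra.
Qed.

Lemma cutoff_production (eta q s x t : R) : 0 <= t -> B <= eta -> `|q| <= Ce ->
  (`|x| <= rho -> - s <= lam) ->
  eta * (- (K / N) * dflatexp (paraboloid x t)) + q * (- (2 * x / N) * dflatexp (paraboloid x t))
    - cutoff x t * s <= - cutoff x t.
Proof.
move=> t0 Be hq hs.
have [p0|p0] := leP (paraboloid x t) 0.
  by rewrite /cutoff flatexp_le0// dflatexp_le0//; lra.
have [xr _] := cutoff_support t0 p0; have {}hs := hs xr.
rewrite dflatexpE// -/(cutoff x t); set p := paraboloid x t in p0 *.
have z0 : 0 <= cutoff x t by exact: flatexp_ge0.
have pN : p <= rho ^+ 2 / N.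
  by rewrite /p ler_pM2r ?invr_gt0// gerBl addr_ge0 ?sqr_ge0// mulr_ge0// ltW.
have pl : lam + 1 <= p ^- 2 / N.
  rewrite ler_pdivlMr// -(ler_pM2r (exprn_gt0 2 p0)) mulVf ?expf_neq0 ?gt_eqF//.
  apply: (@le_trans _ _ ((lam + 1) * N * (rho ^+ 2 / N) ^+ 2)).
    apply: ler_wpM2l; first by rewrite mulr_ge0 ?(ltW N0) ?addr_ge0.
    by rewrite ler_sqr ?nnegrE ?(ltW p0)// divr_ge0 ?sqr_ge0 ?(ltW N0).
  rewrite (_ : _ * _ = 1)// /N; field.
  by rewrite !gt_eqF ?ltr_wpDl.
have side : - (q * (2 * x)) <= 2 * rho * Ce.
  rewrite -mulrN (le_trans (ler_norm _))// normrM normrN normrM (ger0_norm (ler0n _ 2)).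
  by rewrite mulrC -!mulrA ler_wpM2l// ler_pM.
have main : 1 <= eta * K + q * (2 * x).
  have : B * K <= eta * K by rewrite ler_wpM2r// ltW.
  by move: side BK; lra.
have pp : 0 <= p ^- 2 / N by rewrite divr_ge0 ?(ltW N0)// invr_ge0 sqr_ge0.
have k1 : (p ^- 2 / N) <= (eta * K + q * (2 * x)) * (p ^- 2 / N) by rewrite ler_peMl.
have k2 : 0 <= cutoff x t * ((eta * K + q * (2 * x)) * (p ^- 2 / N) + s - 1).
  by rewrite mulr_ge0//; move: k1 pl hs; lra.
rewrite -subr_ge0 (_ : _ - _ = cutoff x t * ((eta * K + q * (2 * x)) * (p ^- 2 / N) + s - 1))//.
ring.
Qed.

Lemma cutoff_ge0 x t : 0 <= cutoff x t. Proof. exact: flatexp_ge0. Qed.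
Lemma cutoff_le1 x t : cutoff x t <= 1. Proof. exact: flatexp_le1. Qed.

End cutoff.

Section production.
Context {R : realType}.
Variables (f : R -> R -> R) (up um xm xp M C : R) (v : R * R -> R).
Variables (c eps B Ce : R) (eta : R -> R) (Q : R -> R -> R) (bs : seq (R * R * R)).
Hypotheses (f2 : Ck 2 f) (sol : plane_solution f up um xm xp M v).
Hypothesis fC : forall x z, `|z| <= M -> `|f x z| <= C.
Hypothesis be : barrier_entropy f up um M c eps B Ce eta Q.
Hypothesis hbs : forall b, b \in bs -> forall x z, `|z| <= M ->
  eta z * (f x z - b.1.2) + Q x z * (b.1.1 - z) <= 0.

Let source x z := derive1 eta z * d1 f x z - d1 Q x z.

Let jc_source : jointly_continuous source.
Proof.
have [_ _ _ _ jQ] := be_pair be.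
have jf : jointly_continuous (d1 f) by case: f2 => _ [_ _ + _]; exact: (@Ck_jcont _ 1).
have je : jointly_continuous (fun _ z : R => derive1 eta z).
  move=> p; apply: (@continuous_comp _ _ _ snd (derive1 eta)); first exact: cvg_snd.
  exact: be_slope be _.
by move=> p; apply: cvgB; [exact: (jcontM je jf)|exact: jQ].
Qed.

Let jc_eta : jointly_continuous (fun _ z : R => eta z).
Proof.
move=> p; apply: (@continuous_comp _ _ _ snd eta); first exact: cvg_snd.
have [_ de _ _ _] := be_pair be.
by apply: differentiable_continuous; apply/derivable1_diffP.
Qed.

Variables (I r e : R) (V G W : R -> R -> R).
Hypothesis app : near_potential f up um xm xp M C v I r e V G W.
Variables (tau rho K lam Db : R).
Hypotheses (tau0 : 0 < tau) (rho0 : 0 < rho) (K0 : 0 < K) (lam0 : 0 <= lam).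
Hypothesis BK : 2 * rho * Ce + 1 <= B * K.
Hypothesis hlam : forall x z, `|x| <= rho -> `|z| <= M -> - source x z <= lam.
Hypothesis hDb : forall s : R, s <= 1 -> dflatexp s <= Db.
Hypotheses (rhor : rho <= r) (Kr : rho ^+ 2 / K <= r).
Hypothesis start : forall x, `|x| <= rho -> exists2 b, b \in bs & affine b x 0 <= W x 0.

Let E := total_excess tau W bs.
Let phi x t := flatexp (1 - E x t) * cutoff rho K lam x t.
Let err (p : R * R) := `|flux_of f v p - G p.1 p.2| * \1_(box r) p + `|v p - V p.1 p.2| * \1_(box r) p.

Let E0 x t : 0 <= E x t. Proof. by apply: sumr_ge0 => ? _; exact: excess_ge0. Qed.

Let E1 x t := \sum_(b <- bs) excess tau W b x t * (tau^-1 * (V x t - b.1.1)).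
Let E2 x t := \sum_(b <- bs) excess tau W b x t * (tau^-1 * (b.1.2 - G x t)).
Let cutoff1 (x t : R) := - (2 * x / (rho ^+ 4 * (lam + 1))) * dflatexp (paraboloid rho K lam x t).
Let cutoff2 (x t : R) := - (K / (rho ^+ 4 * (lam + 1))) * dflatexp (paraboloid rho K lam x t).

Let Ck_phi n : Ck n phi.
Proof.
apply: CkM; last exact: Ck_cutoff.
by apply: Ck_flat; apply: CkB; [exact: Ck_cst|exact: Ck_total (ap_smooth app) _ _].
Qed.

Let phi1 x t : d1 phi x t =
  flatexp (1 - E x t) * cutoff1 x t - cutoff rho K lam x t * (dflatexp (1 - E x t) * E1 x t).
Proof.
apply: is_derive_derive1.
have h := derB (der_cst 1 x) (der1_total tau (ap_d1 app) bs x t).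
have := derM (der_comp (der_flatexp _) h) (der1_cutoff rho K lam x t).
by move=> {}h; apply: (der_eq h); rewrite sub0r mulrN mulrN.
Qed.

Let phi2 x t : d2 phi x t =
  flatexp (1 - E x t) * cutoff2 x t - cutoff rho K lam x t * (dflatexp (1 - E x t) * E2 x t).
Proof.
apply: is_derive_derive1.
have h := derB (der_cst 1 t) (der2_total tau (ap_d2 app) bs x t).
have := derM (der_comp (der_flatexp _) h) (der2_cutoff rho K lam x t).
by move=> {}h; apply: (der_eq h); rewrite sub0r mulrN mulrN.
Qed.

Let off_box x t : 0 <= t -> ~ box r (x, t) -> paraboloid rho K lam x t <= 0.
Proof.
move=> t0 nb; rewrite leNgt; apply/negP => /(cutoff_support rho0 K0 lam0 t0)[xr tr].
apply: nb; apply/boxE; split; first exact: le_trans rhor.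
by rewrite ger0_norm// (le_trans tr).
Qed.

Let phi_off x t : 0 <= t -> ~ box r (x, t) -> [/\ phi x t = 0, d1 phi x t = 0 & d2 phi x t = 0].
Proof.
move=> t0 /(off_box t0) p0.
by rewrite phi1 phi2 /phi /cutoff1 /cutoff2 /cutoff (flatexp_le0 p0) (dflatexp_le0 p0) !mulr0 !mul0r !subr0.
Qed.

Let phi_start x : phi x 0 = 0.
Proof.
have [xr|xr] := leP `|x| rho.
  have [b bbs bW] := start xr.
  by rewrite /phi flatexp_le0 ?mul0r// subr_le0; exact: total_excess_ge1 bbs bW.
rewrite /phi /cutoff (_ : flatexp (paraboloid _ _ _ _ _) = 0) ?mulr0//.
apply: flatexp_le0; rewrite leNgt; apply/negP => /(cutoff_support rho0 K0 lam0 (lexx 0))[].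
by rewrite leNgt xr.
Qed.

Let production_le x t : 0 <= t ->
  entropy_production f eta Q phi v (x, t) <= Db * (Ce / tau) * err (x, t) - phi x t.
Proof.
move=> t0; rewrite /entropy_production phi1 phi2 -/(source x (v (x, t))) /=.
have vM := ps_bound sol (x, t).
set b := flatexp _; set db := dflatexp _; set z := cutoff _ _ _ _ _.
set et := eta _; set q := Q _ _; set s := source _ _.
have b0 : 0 <= b by exact: flatexp_ge0.
have z0 : 0 <= z by exact: cutoff_ge0.
have db0 : 0 <= db by exact: dflatexp_ge0.
have dbD : db <= Db by apply: hDb; rewrite gerBl.
have cut : et * cutoff2 x t + q * cutoff1 x t - z * s <= - z.
  apply: (cutoff_production rho0 K0 lam0 BK t0 (be_ge be _) (be_flux_le be x vM)) => xr.
  exact: hlam.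
have {}cut := ler_wpM2l b0 cut.
have exc : z * (db * - (et * E2 x t + q * E1 x t)) <= Db * (Ce / tau) * err (x, t).
  have err0 : 0 <= err (x, t).
    by rewrite /err addr_ge0// mulr_ge0// indicE.
  have Ce0 : 0 <= Ce := le_trans (normr_ge0 _) (be_eta_le be vM).
  have Db0 : 0 <= Db := le_trans db0 dbD.
  have rhs0 : 0 <= Db * (Ce / tau) * err (x, t) by rewrite !mulr_ge0// invr_ge0 ltW.
  have [E1le|/ltW E1gt] := leP (E x t) 1; last first.
    by rewrite /db dflatexp_le0 ?subr_le0// mul0r mulr0.
  have [bx|nb] := pselect (box r (x, t)); last first.
    by rewrite /z /cutoff flatexp_le0 ?mul0r//; exact: off_box.
  have -> : err (x, t) = `|f x (v (x, t)) - G x t| + `|v (x, t) - V x t|.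
    by rewrite /err /flux_of /= t0 indicE mem_set// !mulr1.
  have P := total_excess_production V G tau0 (be_eta_le be vM) (be_flux_le be x vM)
    (fun b bbs => hbs bbs x vM) E1le.
  have z1 : z <= 1 by exact: cutoff_le1.
  set X := Ce / tau * _ in P; have X0 : 0 <= X.
    by rewrite mulr_ge0 ?addr_ge0// divr_ge0// ltW.
  rewrite -/(E1 x t) -/(E2 x t) -/et -/q in P.
  rewrite -[leRHS]mulrA -/X -[leRHS]mul1r.
  have dP := ler_wpM2l db0 P; have dX : db * X <= Db * X by rewrite ler_wpM2r.
  apply: (@le_trans _ _ (z * (Db * X))); last by rewrite ler_wpM2r// mulr_ge0.
  by apply: ler_wpM2l => //; apply: (le_trans dP); exact: dX.
rewrite [leLHS](_ : _ = z * (db * - (et * E2 x t + q * E1 x t))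
  + b * (et * cutoff2 x t + q * cutoff1 x t - z * s)); last by rewrite /phi -/b -/z; ring.
rewrite [X in _ <= X](_ : _ = Db * (Ce / tau) * err (x, t) + b * - z); last first.
  by rewrite /phi -/b -/z mulrN.
exact: lerD exc cut.
Qed.

Let mv := ps_measurable sol.
Let vM := ps_bound sol.

Let boxed_production : boxed ((entropy_production f eta Q phi v) \_ half_plane).
Proof.
have mc (g : R -> R -> R) : jointly_continuous g -> measurable_fun setT (fun p : R * R => g p.1 p.2).
  exact: jcont_measurable.
have sphi n := Ck_phi n.
have j0 := Ck_jcont (sphi 0%N); have j1 := Ck_jcont (smooth_d1 sphi 0%N).
have j2 := Ck_jcont (smooth_d2 sphi 0%N).
have [a0 a00 ha0] := box_bounded r j0; have [a1 a10 ha1] := box_bounded r j1.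
have [a2 a20 ha2] := box_bounded r j2.
have [s s0 hs] := box_bounded (Num.max r M) jc_source.
apply: (@boxed_half _ _ r (Ce * a2 + Ce * a1 + a0 * s)).
- apply: measurable_funB; first apply: measurable_funD.
  + apply: measurable_funM; last exact: mc j2.
    exact: (measurable_jcont_comp jc_eta mv).
  + apply: measurable_funM; last exact: mc j1.
    exact: (measurable_jcont_comp (be_flux be) mv).
  + apply: measurable_funM; first exact: mc j0.
    exact: (measurable_jcont_comp jc_source mv).
- move=> x t _ /boxE[xr tr]; rewrite /entropy_production /= -/(source x (v (x, t))).
  rewrite (le_trans (ler_normB _ _))// lerD//; last first.
    by rewrite normrM ler_pM ?ha0// hs// le_max ?xr ?vM ?orbT.
  apply: le_trans (ler_normD _ _) _; apply: lerD; rewrite normrM.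
    by apply: ler_pM; [exact: normr_ge0|exact: normr_ge0|have Z := be_eta_le be (vM (x, t)); exact: Z|exact: ha2].
  by apply: ler_pM; [exact: normr_ge0|exact: normr_ge0|have Z := be_flux_le be x (vM (x, t)); exact: Z|exact: ha1].
- move=> x t t0 nb; rewrite /entropy_production /=.
  by have [-> -> ->] := phi_off t0 nb; rewrite !mulr0 mul0r subr0 addr0.
Qed.

Lemma boxed_total_excess :
  boxed ((fun p => flatexp (1 - total_excess tau W bs p.1 p.2) * cutoff rho K lam p.1 p.2) \_ half_plane).
Proof.
change (boxed ((fun p => phi p.1 p.2) \_ half_plane)).
have j0 := Ck_jcont (Ck_phi 0).
have [a0 a00 ha0] := box_bounded r j0.
apply: (@boxed_half _ _ r a0); first exact: jcont_measurable.
  by move=> x t _ /boxE[xr tr]; exact: ha0.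
by move=> x t t0 nb; have [] := phi_off t0 nb.
Qed.

Let V0 : jointly_continuous V. Proof. exact: Ck_jcont (ap_smoothV app 0%N). Qed.
Let G0 : jointly_continuous G. Proof. exact: Ck_jcont (ap_smoothG app 0%N). Qed.

Let boxed_errF : boxed (fun p => `|flux_of f v p - G p.1 p.2| * \1_(box r) p).
Proof.
apply: (@boxed_err _ _ C _ _ _ _ _); last by move=> p; exact: ap_G app _ _.
- exact: flux_of_measurable (Ck_jcont f2) mv.
- move=> p; rewrite /flux_of; case: ifPn => _; first exact: fC.
  by rewrite normr0 (le_trans _ (fC 0 (vM p))).
- exact: jcont_measurable.
Qed.

Let boxed_errv : boxed (fun p => `|v p - V p.1 p.2| * \1_(box r) p).
Proof.
by apply: (@boxed_err _ _ M _ _ _ _ _) => //; [exact: jcont_measurable|move=> p; exact: ap_V app _ _].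
Qed.

(** The test function [flatexp (1 - E) * cutoff] vanishes at time 0, where some barrier lies
    under [W]. Its first factor contributes an error term by [total_excess_production], its
    second a negative multiple of the test function itself by [cutoff_production]. *)
Lemma total_excess_integral :
  I2 ((fun p => flatexp (1 - total_excess tau W bs p.1 p.2) * cutoff rho K lam p.1 p.2) \_ half_plane)
    <= Db * (Ce / tau) * (2 * e).
Proof.
have k0 : 0 <= Db * (Ce / tau).
  have Db0 : 0 <= Db := le_trans (dflatexp_ge0 _) (hDb ler01).
  have Ce0 : 0 <= Ce := le_trans (normr_ge0 _) (be_eta_le be (vM (0, 0))).
  by rewrite mulr_ge0// divr_ge0// ltW.
have bE : boxed err by exact: boxedD.
have E2e : I2 err <= 2 * e.
  rewrite I2D// mulr_natl mulr2n; apply: lerD; [exact: ap_L1F app|exact: ap_L1v app].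
have P := ps_entropy sol (be_pair be) (be_slope be) (be_flux be) (fun n => Ck_phi n)
  (fun x t _ => mulr_ge0 (flatexp_ge0 _) (cutoff_ge0 _ _ _ _ _)) phi_start phi_off.
have Q' : I2 ((entropy_production f eta Q phi v) \_ half_plane)
    <= I2 (fun p => Db * (Ce / tau) * err p - ((fun p => phi p.1 p.2) \_ half_plane) p).
  apply: le_I2; [exact: boxed_production|by apply: boxedB; [exact: boxedZ|exact: boxed_total_excess]|].
  move=> [x t]; rewrite !patchE; case: ifPn => [|_].
    by rewrite inE /half_plane/= => t0; exact: production_le.
  by rewrite subr0 mulr_ge0// /err addr_ge0// mulr_ge0// indicE.
have {P Q'} := le_trans P Q'; rewrite I2B; [|exact: boxedZ|exact: boxed_total_excess].
by rewrite I2Z// subr_ge0 => /le_trans; apply; rewrite ler_wpM2l.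
Qed.

End production.

Section rectangles.
Context {R : realType}.
Local Notation mu := (@lebesgue_measure R).
Local Notation mu2 := (mu \x mu)%E.

Definition rect (a b c d : R) : set (R * R) := `[a, b] `*` `[c, d].

Lemma rectE (a b c d x t : R) : rect a b c d (x, t) <-> a <= x <= b /\ c <= t <= d.
Proof. by rewrite /rect /setX/= !in_itv. Qed.

Lemma measurable_rect (a b c d : R) : measurable (rect a b c d).
Proof. exact: measurableX. Qed.

Lemma mu2_rect (a b c d : R) : a <= b -> c <= d -> mu2 (rect a b c d) = ((b - a) * (d - c))%:E.
Proof.
move=> ab cd; rewrite /rect product_measure1E//.
rewrite -[LHS]/((mu `[a, b] * mu `[c, d])%E) !lebesgue_measure_itv/= !lte_fin.
move: ab cd; rewrite !le_eqVlt => /predU1P[->|->] /predU1P[->|->]; rewrite ?ltxx.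
- by rewrite mul0e subrr mul0r.
- by rewrite mul0e subrr mul0r.
- by rewrite mule0 subrr mulr0.
- by rewrite -!EFinB -EFinM.
Qed.

Lemma boxed_rect (a b c d : R) : boxed (\1_(rect a b c d)).
Proof.
exists (`|a| + `|b| + `|c| + `|d|), 1; split; first exact: measurable_indic (measurable_rect _ _ _ _).
  by move=> p; rewrite indicE; case: (_ \in _); rewrite ?normr1 ?normr0.
move=> [x t] np; rewrite indicE memNset// => /rectE[/andP[ax xb] /andP[ct td]]; apply: np.
have h (y : R) : - `|y| <= y <= `|y| by rewrite -ler_norml.
move: (h a) (h b) (h c) (h d) => /andP[? ?] /andP[? ?] /andP[? ?] /andP[? ?].
apply/boxE; rewrite !ler_norml; split; apply/andP; split; lra.
Qed.

Lemma I2_rect (a b c d : R) : a <= b -> c <= d -> I2 (\1_(rect a b c d)) = (b - a) * (d - c).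
Proof.
move=> ab cd; rewrite /I2 /Rintegral integral_indic//; last exact: measurable_rect.
by rewrite setIT -[X in fine X]/(mu2 (rect a b c d)) mu2_rect.
Qed.

End rectangles.

Section lower_bound.
Context {R : realType}.
Variables (f : R -> R -> R) (up um xm xp M C : R) (v : R * R -> R).
Variables (c eps B Ce : R) (eta : R -> R) (Q : R -> R -> R) (bs : seq (R * R * R)).
Hypotheses (f2 : Ck 2 f) (sol : plane_solution f up um xm xp M v).
Hypothesis fC : forall x z, `|z| <= M -> `|f x z| <= C.
Hypothesis B0 : 0 < B.
Hypothesis be : barrier_entropy f up um M c eps B Ce eta Q.
Hypothesis hbs : forall b, b \in bs -> forall x z, `|z| <= M ->
  eta z * (f x z - b.1.2) + Q x z * (b.1.1 - z) <= 0.

(** A paraboloid large enough for the cut-off to be bounded below on a given strip. *)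
Let parabola (X T : R) : 0 < X -> 0 < T -> 0 <= Ce -> exists rho K,
  [/\ 0 < rho, 0 < K, 2 * rho * Ce + 1 <= B * K &
    forall x t, `|x| <= X -> 0 <= t <= T -> 1 <= rho ^+ 2 - (x ^+ 2 + K * t)].
Proof.
move=> X0 T0 Ce0; pose q := Ce / B; pose k := B^-1.
have q0 : 0 <= q by rewrite divr_ge0// ltW.
have k0 : 0 < k by rewrite invr_gt0.
pose s := X + 1 + k * T + q * T; pose rho := s + q * T.
have qT : 0 <= q * T by rewrite mulr_ge0// ltW.
have kT : 0 < k * T by rewrite mulr_gt0.
have s0 : 0 < s by rewrite /s; move: X0 qT kT; lra.
have r0 : 0 < rho by rewrite /rho; move: s0 qT; lra.
exists rho, (2 * rho * q + k); split=> //.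
- by rewrite ltr_wpDl// !mulr_ge0// ltW.
- rewrite le_eqVlt; apply/orP; left; apply/eqP; rewrite /q /k; field.
  by rewrite gt_eqF.
move=> x t xX /andP[t0 tT].
have xx : x ^+ 2 <= X ^+ 2.
  by rewrite -real_normK ?num_real// ler_sqr ?nnegrE// ltW.
have Kt : (2 * rho * q + k) * t <= (2 * rho * q + k) * T.
  by rewrite ler_wpM2l// addr_ge0 ?(ltW k0)// !mulr_ge0// ltW.
apply: (@le_trans _ _ (s ^+ 2 - (q * T) ^+ 2 - k * T - X ^+ 2)); last first.
  rewrite -subr_ge0; have : 0 <= X ^+ 2 - x ^+ 2 by rewrite subr_ge0.
  move: Kt; rewrite -subr_ge0 => Kt xx'; apply: le_trans (addr_ge0 Kt xx') _.
  by rewrite le_eqVlt; apply/orP; left; apply/eqP; rewrite /rho; ring.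
have XkT : 0 <= 2 * X * (k * T) by rewrite !mulr_ge0 ?(ltW X0) ?(ltW k0) ?(ltW T0).
have XqT : 0 <= 2 * (X + 1 + k * T) * (q * T).
  by apply: mulr_ge0 => //; move: X0 kT; lra.
have kk := sqr_ge0 (k * T).
rewrite (_ : s ^+ 2 - _ - _ - _ = 1 + 2 * X + 2 * X * (k * T) + 2 * (X + 1 + k * T) * (q * T)
  + k * T + (k * T) ^+ 2); last by rewrite /s; ring.
by move: X0 XkT XqT kk kT; lra.
Qed.

(** Near a point where all barriers exceed [W] the total excess is small, so that the
    integral of the entropy inequality is bounded below. *)
Lemma lower_bound (X T g : R) : 0 < X -> 0 < T -> 0 < g -> exists r0 e0,
  [/\ 0 < r0, 0 < e0 & forall r e I V G W, r0 <= r -> e <= e0 ->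
    near_potential f up um xm xp M C v I r e V G W ->
    (forall x, exists2 b, b \in bs & affine b x 0 <= W x 0) ->
    forall x t, `|x| <= X -> 0 <= t <= T ->
      exists2 b, b \in bs & affine b x t - g < W x t].
Proof.
move=> X0 T0 g0.
have M0 : 0 <= M := le_trans (normr_ge0 _) (ps_bound sol (0, 0)).
have C0 : 0 <= C := le_trans (normr_ge0 _) (fC 0 (ps_bound sol (0, 0))).
have Ce0 : 0 <= Ce := le_trans (normr_ge0 _) (be_eta_le be (ps_bound sol (0, 0))).
have X1 : 0 < X + 1 by rewrite addr_gt0.
have T1 : 0 < T + 1 by rewrite addr_gt0.
have [rho [K [rho0 K0 BK hp]]] := parabola X1 T1 Ce0.
have [lam lam0 hlam] : exists2 lam, 0 < lam & forall x z, `|x| <= rho -> `|z| <= M ->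
    - (derive1 eta z * d1 f x z - d1 Q x z) <= lam.
  have [_ _ _ _ jQ] := be_pair be.
  have jf : jointly_continuous (d1 f) by case: f2 => _ [_ _ + _]; exact: (@Ck_jcont _ 1).
  have je : jointly_continuous (fun _ z : R => derive1 eta z).
    move=> p; apply: (@continuous_comp _ _ _ snd (derive1 eta)); first exact: cvg_snd.
    exact: be_slope be _.
  have js : jointly_continuous (fun x z => derive1 eta z * d1 f x z - d1 Q x z).
    by move=> p; apply: cvgB; [exact: (jcontM je jf)|exact: jQ].
  have [l l0 hl] := box_bounded (Num.max rho M) js; exists l => // x z xr zM.
  by rewrite (le_trans (ler_norm _))// normrN hl// le_max ?xr ?zM ?orbT.
have [Db Db0 hDb] := @dflatexp_bounded R.
have [tau [tau0 htau]] : exists tau, 0 < tau /\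
    (size bs)%:R * expR (- (g / 2 / tau)) <= 1 / 2.
  pose n : R := (size bs)%:R; exists (g / 2 / (2 * n + 1)).
  have n0 : 0 <= n by rewrite ler0n.
  have n1 : 0 < 2 * n + 1 by rewrite ltr_wpDl// mulr_ge0.
  have g2 : 0 < g / 2 by rewrite divr_gt0.
  split; first by rewrite divr_gt0.
  rewrite invf_div mulrCA divff ?gt_eqF// mulr1 expRN ler_pdivrMr ?expR_gt0//.
  have := expR_ge1Dx (2 * n + 1); lra.
pose L := \sum_(b <- bs) (`|b.1.1| + `|b.1.2|).
have L0 : 0 <= L by apply: sumr_ge0 => b _; rewrite addr_ge0.
pose del := Num.min 1 (g / 2 / (M + C + L + 1)).
have den : 0 < M + C + L + 1 by rewrite ltr_wpDl// !addr_ge0.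
have del0 : 0 < del by rewrite lt_min ltr01/= !divr_gt0.
have del1 : del <= 1 by rewrite ge_min lexx.
have delg : (M + C + L) * del <= g / 2.
  apply: (@le_trans _ _ ((M + C + L + 1) * del)).
    by rewrite ler_wpM2r ?(ltW del0)// lerDl.
  by rewrite mulrC -ler_pdivlMr// ge_min lexx orbT.
pose N := rho ^+ 4 * (lam + 1).
have N0 : 0 < N by rewrite mulr_gt0 ?exprn_gt0// ltr_wpDl// ltW.
pose k := flatexp (1 / 2 : R) * flatexp N^-1.
have k0 : 0 < k by rewrite mulr_gt0 ?flatexp_gt0 ?invr_gt0 ?divr_gt0.
pose D := Db * (Ce / tau) * 2.
have D0 : 0 <= D by rewrite !mulr_ge0 ?invr_ge0// ltW.
exists (Num.max rho (rho ^+ 2 / K)), (k * (del * del) / (D + 1)).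
have kd0 : 0 < k * (del * del) by apply: mulr_gt0 => //; exact: mulr_gt0.
split; [by rewrite lt_max rho0|by rewrite divr_gt0// ltr_wpDl|].
move=> r e I V G W; rewrite ge_max => /andP[rhor Kr] ee0 app start x t xX /andP[t0 tT].
apply: contrapT => nW.
have hW b : b \in bs -> W x t + g <= affine b x t.
  move=> bbs; rewrite leNgt; apply/negP => Wb; apply: nW; exists b => //.
  by move: Wb; lra.
have := total_excess_integral f2 sol fC be hbs app tau0 rho0 K0 (ltW lam0) BK hlam hDb rhor Kr
  (fun x _ => start x).
apply/negP; rewrite -ltNge.
apply: (@lt_le_trans _ _ (k * (del * del))).
  rewrite mulrA -/D; apply: (@le_lt_trans _ _ (D * (k * (del * del) / (D + 1)))).
    by rewrite ler_wpM2l.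
  by rewrite mulrCA -[X in _ < X]mulr1 ltr_pM2l// ltr_pdivrMr ?ltr_wpDl// mul1r ltrDl.
have xdel : x <= x + del by rewrite lerDl ltW.
have tdel : t <= t + del by rewrite lerDl ltW.
have <- : I2 (fun p => k * \1_(rect x (x + del) t (t + del)) p) = k * (del * del).
  by rewrite I2Z ?I2_rect//; [rewrite !(addrC _ del) !addrK|exact: boxed_rect].
have close y s : x <= y <= x + del -> t <= s <= t + del -> `|y - x| <= del /\ `|s - t| <= del.
  by move=> /andP[? ?] /andP[? ?]; rewrite !ger0_norm ?subr_ge0// !lerBlDl.
have Wclose y s : x <= y <= x + del -> t <= s <= t + del -> W y s <= W x t + (M + C) * del.
  move=> hy hs; have [yx st] := close _ _ hy hs.
  have h1 := derive_norm_le (a := x) (b := y) (fun z => ap_d1 app z t) (fun z _ => ap_V app z t).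
  have h2 := derive_norm_le (a := t) (b := s) (C := C) (fun z => ap_d2 app y z) _.
  have {}h2 := h2 (fun z _ => eq_ind_r (fun w => w <= C) (ap_G app y z) (normrN (G y z))).
  have h3 : M * `|y - x| <= M * del by rewrite ler_wpM2l.
  have h4 : C * `|s - t| <= C * del by rewrite ler_wpM2l.
  have a1 := le_trans (le_trans (ler_norm _) h1) h3.
  have a2 := le_trans (le_trans (ler_norm _) h2) h4.
  rewrite -lerBlDl mulrDl (_ : W y s - W x t = (W y t - W x t) + (W y s - W y t)); last by ring.
  exact: lerD.
have bclose b y s : b \in bs -> x <= y <= x + del -> t <= s <= t + del ->
    affine b x t - L * del <= affine b y s.
  move=> bbs hy hs; have [yx st] := close _ _ hy hs.
  have bL : `|b.1.1| + `|b.1.2| <= L.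
    rewrite /L; elim: (bs) bbs => // b' l IH; rewrite inE big_cons => /predU1P[->|/IH h].
      by rewrite lerDl sumr_ge0// => *; rewrite addr_ge0.
    by rewrite (le_trans h)// lerDr addr_ge0.
  have h1 : - (b.1.1 * (y - x)) <= `|b.1.1| * del.
    by rewrite (le_trans (ler_norm _))// normrN normrM ler_wpM2l.
  have h2 : b.1.2 * (s - t) <= `|b.1.2| * del.
    by rewrite (le_trans (ler_norm _))// normrM ler_wpM2l.
  have h3 : (`|b.1.1| + `|b.1.2|) * del <= L * del by rewrite ler_wpM2r// ltW.
  by rewrite /affine; move: h1 h2 h3; lra.
have small y s : x <= y <= x + del -> t <= s <= t + del -> total_excess tau W bs y s <= 1 / 2.
  move=> hy hs; apply: le_trans htau; apply: total_excess_small => // b bbs.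
  have h1 := hW b bbs; have h2 := bclose b y s bbs hy hs; have h3 := Wclose y s hy hs.
  by move: h1 h2 h3 delg; lra.
have big y s : x <= y <= x + del -> t <= s <= t + del -> N^-1 <= paraboloid rho K lam y s.
  move=> hy hs; have [yx st] := close _ _ hy hs.
  rewrite /paraboloid -/N -[leLHS]mul1r ler_wpM2r ?invr_ge0 ?(ltW N0)//; apply: hp.
    rewrite (_ : y = x + (y - x)); last by rewrite addrC subrK.
    by rewrite (le_trans (ler_normD _ _))// lerD// (le_trans yx).
  by move: hs => /andP[ts std]; rewrite (le_trans t0 ts) (le_trans std)// lerD.
apply: le_I2; first by apply: boxedZ; exact: boxed_rect.
  exact: (boxed_total_excess bs app tau rho0 K0 (ltW lam0) rhor Kr).
move=> [y s]; rewrite !patchE indicE.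
have F0 : 0 <= flatexp (1 - total_excess tau W bs y s) * cutoff rho K lam y s.
  by rewrite mulr_ge0 ?flatexp_ge0 ?cutoff_ge0.
case: ifPn => [|nh].
  move=> _ /=; have [|] := boolP ((y, s) \in _) => [|_]; last by rewrite mulr0.
  rewrite inE => /rectE[hy hs]; rewrite mulr1 /k /cutoff.
  apply: ler_pM; [exact: flatexp_ge0|exact: flatexp_ge0| |].
    by apply: le_flatexp; have := small y s hy hs; lra.
  by apply: le_flatexp; exact: big.
rewrite memNset ?mulr0// => /rectE[_ /andP[ts _]].
by move/negP: nh; apply; rewrite inE /half_plane/= (le_trans t0).
Qed.

End lower_bound.

(** * The upper bound *)

Section maximum_principle.
Context {R : realType}.

Lemma closed_jcont_ge0 (g : R -> R -> R) : jointly_continuous g ->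
  closed [set p : R * R | 0 <= g p.1 p.2].
Proof.
move=> cg; rewrite (_ : [set p | _] = (fun p : R * R => g p.1 p.2) @^-1` [set z | 0 <= z])//.
by apply: closed_comp => [p _|]; [exact: cg|exact: closed_ge].
Qed.

Variables (Z Z1 Z2 : R -> R -> R) (a : R -> R) (y1 s1 y2 s2 T e : R).
Hypotheses (cZ : jointly_continuous Z) (c1 : jointly_continuous Z1) (c2 : jointly_continuous Z2).
Hypothesis der1 : forall x t : R, is_derive x 1 (Z ^~ t) (Z1 x t).
Hypothesis der2 : forall x t : R, is_derive t 1 (Z x) (Z2 x t).
Hypothesis e0 : 0 < e.

Let region x t := [/\ 0 <= t, t <= T, y1 + s1 * t <= x & x <= y2 + s2 * t].

Hypothesis speed : forall x t, region x t -> s2 <= a x <= s1.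
Hypothesis sub : forall x t, region x t -> Z2 x t + a x * Z1 x t <= - e.

(** Characteristics run out of the sides of the trapezoid as time increases, so the
    maximum of a strict subsolution is reached at the bottom. *)
Lemma maximum_principle x t : region x t -> exists2 y, y1 <= y <= y2 & Z x t <= Z y 0.
Proof.
move=> rxt; pose A := [set p : R * R | region p.1 p.2].
have cA : compact A.
  pose r := `|y1| + `|s1 * T| + `|y2| + `|s2 * T| + `|T|.
  have jl : jointly_continuous (fun x t : R => x - (y1 + s1 * t)).
    by apply: (@Ck_jcont _ 0); apply: CkB; [exact: Ck_fst|apply: CkD; [exact: Ck_cst|apply: CkM; [exact: Ck_cst|exact: Ck_snd]]].
  have jr : jointly_continuous (fun x t : R => y2 + s2 * t - x).
    by apply: (@Ck_jcont _ 0); apply: CkB; [apply: CkD; [exact: Ck_cst|apply: CkM; [exact: Ck_cst|exact: Ck_snd]]|exact: Ck_fst].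
  have j0 : jointly_continuous (fun x t : R => t) by exact: (Ck_jcont (@Ck_snd _ 0)).
  have jT : jointly_continuous (fun x t : R => T - t).
    by apply: (@Ck_jcont _ 0); apply: CkB; [exact: Ck_cst|exact: Ck_snd].
  apply: (subclosed_compact _ (@box_compact R r)).
    rewrite (_ : A = ([set p : R * R | 0 <= p.2] `&` [set p : R * R | 0 <= T - p.2]) `&`
      ([set p : R * R | 0 <= p.1 - (y1 + s1 * p.2)] `&` [set p : R * R | 0 <= y2 + s2 * p.2 - p.1])).
      apply: closedI; apply: closedI.
      - exact: (closed_jcont_ge0 j0).
      - exact: (closed_jcont_ge0 jT).
      - exact: (closed_jcont_ge0 jl).
      - exact: (closed_jcont_ge0 jr).
    apply/seteqP; split => -[y s] /=; rewrite /A /region /= !subr_ge0.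
      by move=> [].
    by move=> [[? ?] [? ?]].
  move=> [y s] [/= s0 sT l1 l2]; apply/boxE.
  have T0 := le_trans s0 sT.
  have b (k : R) : `|k * s| <= `|k * T|.
    by rewrite !normrM ler_wpM2l// !ger0_norm.
  have h (z : R) : - `|z| <= z <= `|z| by rewrite -ler_norml.
  have [b1 b2] := (b s1, b s2).
  have n1 := normr_ge0 y1; have n2 := normr_ge0 y2; have n3 := normr_ge0 T.
  have n4 := normr_ge0 (s1 * T); have n5 := normr_ge0 (s2 * T).
  move: (h (s1 * s)) (h (s2 * s)) (h y1) (h y2) => /andP[? ?] /andP[? ?] /andP[? ?] /andP[? ?].
  split; last by rewrite ger0_norm// (le_trans sT)// (le_trans (ler_norm T))// /r lerDr !addr_ge0.
  by rewrite ler_norml /r; apply/andP; split; lra.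
have cf : {within A, continuous (fun p : R * R => Z p.1 p.2)} by exact: continuous_subspaceT.
have [|p] := compact_EVT_max _ cA cf; first by exists (x, t).
rewrite inE; case: p => y s /= [/= s0 sT l1 l2] pmax.
have Zxt : Z x t <= Z y s by apply: (pmax (x, t)); rewrite inE.
have [s00|s00|s0E] := ltgtP 0 s; [|by move: s0; rewrite leNgt s00|].
- exfalso; pose c := a y.
  have ry : region y s by [].
  have /andP[s2c cs1] := speed ry.
  have k0 : 0 < `|c| + 1 by rewrite ltr_wpDl.
  have e40 : 0 < e / 4 by rewrite divr_gt0.
  have ek0 : 0 < e / 4 / (`|c| + 1) by rewrite divr_gt0.
  have [d1 d10 hd1] := jcont_eps y s c1 ek0; have [d2 d20 hd2] := jcont_eps y s c2 e40.
  pose d := Num.min d1 d2; have d0 : 0 < d by rewrite lt_min d10.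
  pose h := Num.min s (d / 2 / (`|c| + 1)).
  have h0 : 0 < h by rewrite lt_min s00 !divr_gt0.
  have hs : h <= s by rewrite ge_min lexx.
  have hk : h * (`|c| + 1) <= d / 2 by rewrite -ler_pdivlMr// ge_min lexx orbT.
  have hc : `|c| * h + h < d.
    by rewrite (_ : _ + h = h * (`|c| + 1)); [rewrite (le_lt_trans hk)// ltr_pdivrMr// ltr_pMr// ltr1n|ring].
  have ch0 : 0 <= `|c| * h by rewrite mulr_ge0// ltW.
  have rh : region (y - c * h) (s - h).
    have p1 : c * h <= s1 * h by rewrite ler_wpM2r// ltW.
    have p2 : s2 * h <= c * h by rewrite ler_wpM2r// ltW.
    by split; move: sT l1 l2 p1 p2 hs h0; rewrite ?mulrBr; lra.
  have := pmax (y - c * h, s - h); rewrite inE => /(_ rh) /=.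
  apply/negP; rewrite -ltNge.
  have shs : s - h <= s by rewrite gerBl ltW.
  have A1 : Z y s - Z y (s - h) <= (Z2 y s + e / 4) * (s - (s - h)).
    apply: (derive_le shs (fun z _ => der2 y z)) => z /andP[z1 z2].
    have zs : `|z - s| < d2.
      rewrite ler0_norm ?subr_le0// opprB; apply: (@le_lt_trans _ _ h); first by rewrite lerBlDl -lerBlDr.
      apply: (@lt_le_trans _ _ d); last by rewrite ge_min lexx orbT.
      by apply: le_lt_trans hc; rewrite lerDr.
    have yy : `|y - y| < d2 by rewrite subrr normr0.
    by rewrite -lerBlDl (le_trans (ler_norm _))// ltW// hd2.
  have D1 (z : R) : is_derive z 1 (fun z => Z (y - c * z) (s - h)) (Z1 (y - c * z) (s - h) * (- c)).
    have hd := der_comp (k := fun z => y - c * z) (der1 (y - c * z) (s - h))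
      (derB (der_cst y z) (derZ c (der_id z))).
    by apply: (der_eq hd); rewrite sub0r mulr1.
  have A2 : (- (c * Z1 y s) - e / 4) * (h - 0) <= Z (y - c * h) (s - h) - Z (y - c * 0) (s - h).
    apply: (derive_ge (ltW h0) (fun z _ => D1 z)) => z /andP[z1 z2].
    have cz : `|y - c * z - y| < d1.
      rewrite addrAC subrr sub0r normrN normrM (ger0_norm z1).
      apply: (@le_lt_trans _ _ (`|c| * h)); first by rewrite ler_wpM2l.
      apply: (@lt_le_trans _ _ d); last by rewrite ge_min lexx.
      by apply: le_lt_trans hc; rewrite lerDl ltW.
    have sz : `|s - h - s| < d1.
      rewrite addrAC subrr sub0r normrN (gtr0_norm h0).
      apply: (@lt_le_trans _ _ d); last by rewrite ge_min lexx.
      by apply: le_lt_trans hc; rewrite lerDr.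
    have H := ltW (hd1 _ _ cz sz).
    have : c * (Z1 (y - c * z) (s - h) - Z1 y s) <= e / 4.
      rewrite (le_trans (ler_norm _))// normrM.
      apply: (@le_trans _ _ (`|c| * (e / 4 / (`|c| + 1)))); first by rewrite ler_wpM2l.
      rewrite mulrCA ler_piMr ?(ltW e40)// ler_pdivrMr// mul1r lerDl//.
    by lra.
  move: A1 A2 (sub ry); rewrite -/c mulr0 !subr0 opprB addrCA subrr addr0 => A1 A2 S.
  have S' : (Z2 y s + c * Z1 y s + e / 2) * h < 0 by rewrite pmulr_llt0//; move: S e0; lra.
  by move: A1 A2 S'; lra.
- exists y; last by rewrite s0E.
  by move: l1 l2; rewrite -s0E !mulr0 !addr0 => -> ->.
Qed.

End maximum_principle.

(** * Convergence of the potential *)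

Section potential_convergence.
Context {R : realType}.
Variables (f : R -> R -> R) (up um xm xp M C alpha Theta : R) (v : R * R -> R).
Hypotheses (f2 : Ck 2 f) (hx : xm < xp) (upum : up < um).
Hypotheses (upM : `|up| <= M) (umM : `|um| <= M).
Hypothesis fC : forall x z, `|z| <= M -> `|f x z| <= C.
Hypotheses (alpha0 : 0 < alpha) (convex : forall x z, alpha <= d2 (d2 f) x z).
Hypotheses (Theta0 : 0 <= Theta) (dfT : forall x z, `|z| <= M -> `|d2 f x z| <= Theta).
Hypothesis stat : forall w x y, w = um \/ w = up -> f x w = f y w.
Hypothesis sol : plane_solution f up um xm xp M v.

Let D := um - up.
Let sigma := shock_speed f up um.
Let D0 : 0 < D. Proof. by rewrite subr_gt0. Qed.

Let d2f : Ck 1 (d2 f). Proof. by case: f2 => _ []. Qed.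

Let sigmaD : sigma * D = f 0 um - f 0 up.
Proof. by rewrite /sigma /shock_speed divfK// gt_eqF. Qed.

(** The characteristics enter the shock from both sides. *)
Lemma characteristic_speed_left x : sigma + alpha * D / 2 <= d2 f x um <= Theta.
Proof.
have := dfT x umM; rewrite ler_norml => /andP[_ ->]; rewrite andbT.
have := convex_tangent um up (Ck_d2 (CkS f2) x) (Ck_d2 d2f x) (convex x).
rewrite (stat x 0 (or_introl erefl)) (stat x 0 (or_intror erefl)) => T.
rewrite -(ler_pM2r D0) mulrDl sigmaD.
have -> : alpha * D / 2 * D = alpha / 2 * (up - um) ^+ 2 by rewrite /D; field.
by move: T; rewrite /D; lra.
Qed.

Lemma characteristic_speed_right x : - Theta <= d2 f x up <= sigma - alpha * D / 2.
Proof.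
have := dfT x upM; rewrite ler_norml => /andP[-> _] /=.
have := convex_tangent up um (Ck_d2 (CkS f2) x) (Ck_d2 d2f x) (convex x).
rewrite (stat x 0 (or_introl erefl)) (stat x 0 (or_intror erefl)) => T.
rewrite -(ler_pM2r D0) mulrBl sigmaD.
have -> : alpha * D / 2 * D = alpha / 2 * (um - up) ^+ 2 by rewrite /D; field.
by move: T; rewrite /D; lra.
Qed.

Section upper_bound.
Variables (I r e : R) (V G W : R -> R -> R).
Hypothesis app : near_potential f up um xm xp M C v I r e V G W.
Hypothesis e0 : 0 < e.

(** The extra [2 e t] turns the approximate subsolution into a strict one. *)
Lemma upper_edge w k y1 s1 y2 s2 T : w = um \/ w = up ->
  (forall x, s2 <= d2 f x w <= s1) ->
  (forall x t, 0 <= t <= T -> y1 + s1 * t <= x -> x <= y2 + s2 * t -> `|x| <= r) ->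
  (forall y, y1 <= y <= y2 -> W y 0 <= w * y + k + e) ->
  forall x t, 0 <= t <= T -> y1 + s1 * t <= x -> x <= y2 + s2 * t ->
    W x t <= affine (w, f 0 w, k) x t + e + 2 * e * t.
Proof.
move=> hw speed inr init x t /andP[t0 tT] l1 l2.
pose Z x t := W x t - affine (w, f 0 w, k) x t - 2 * e * t.
have cW := Ck_jcont (ap_smooth app 0%N); have cV := Ck_jcont (ap_smoothV app 0%N).
have cG := Ck_jcont (ap_smoothG app 0%N).
have cZ : jointly_continuous Z.
  apply: (@Ck_jcont _ 0); apply: CkB; last by apply: CkM; [exact: Ck_cst|exact: Ck_snd].
  by apply: CkB; [exact: ap_smooth app 0%N|exact: Ck_affine].
have c1 : jointly_continuous (fun x t => V x t - w) by move=> p; apply: cvgB; [exact: cV|exact: cvg_cst].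
have c2 : jointly_continuous (fun x t => - G x t + f 0 w - 2 * e).
  by move=> p; apply: cvgB; [apply: cvgD; [apply: cvgN; exact: cG|exact: cvg_cst]|exact: cvg_cst].
have h1 (y s : R) : is_derive y 1 (Z ^~ s) (V y s - w).
  have h := derB (derB (ap_d1 app y s) (der1_affine (w, f 0 w, k) y s)) (der_cst (2 * e * s) y).
  by apply: (der_eq h); rewrite subr0.
have h2 (y s : R) : is_derive s 1 (Z y) (- G y s + f 0 w - 2 * e).
  have h := derB (derB (ap_d2 app y s) (der2_affine (w, f 0 w, k) y s)) (derZ (2 * e) (der_id s)).
  by apply: (der_eq h); rewrite opprK mulr1.
have rxt : [/\ 0 <= t, t <= T, y1 + s1 * t <= x & x <= y2 + s2 * t] by [].
have [|y yy] := maximum_principle cZ c1 c2 h1 h2 e0 (fun x t _ => speed x) _ rxt.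
  move=> y s [s0 sT ry1 ry2]; have yr : `|y| <= r by apply: (inr y s) => //; rewrite s0.
  by have := ap_tangent app hw yr s0; rewrite (stat y 0 hw); lra.
have := init y yy; rewrite /Z /affine /= !mulr0 !subr0; lra.
Qed.

Let x0 := xm - 1.
Let fm := f 0 um.
Let fp := f 0 up.

Lemma upper_left X T x t : X + 2 * `|x0| + Theta * T <= r -> `|x| <= X -> 0 <= t <= T ->
  x <= x0 + (sigma + alpha * D / 2) * t ->
  W x t <= affine (um, fm, - (um * x0)) x t + e + 2 * e * t.
Proof.
move=> rX xX tT xl; have xb : - X <= x <= X by rewrite -ler_norml.
have hx0 : - `|x0| <= x0 <= `|x0| by rewrite -ler_norml.
have X0 : 0 <= X := le_trans (normr_ge0 _) xX.
have /andP[sT _] := characteristic_speed_left 0.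
have Th s : 0 <= s <= T -> [/\ 0 <= Theta * s, Theta * s <= Theta * T &
    (sigma + alpha * D / 2) * s <= Theta * s].
  move=> /andP[s0 sT']; split; [by rewrite mulr_ge0|by rewrite ler_wpM2l|].
  rewrite ler_wpM2r//; have /andP[] := characteristic_speed_left 0; exact: le_trans.
pose Y := X + Theta * T + `|x0|.
apply: (@upper_edge um (- (um * x0)) (- Y) Theta x0 (sigma + alpha * D / 2) T) => //.
- by left.
- exact: characteristic_speed_left.
- move=> y s sT' l1 l2; have [q1 q2 q3] := Th _ sT'.
  rewrite ler_norml; move: hx0 => /andP[? ?]; rewrite /Y in l1.
  by apply/andP; split; lra.
- move=> y /andP[_ yx0]; have := ap_left app yx0; rewrite ler_norml => /andP[_].
  by rewrite /x0; lra.
- have [q1 q2 q3] := Th _ tT; move: xb hx0 => /andP[? ?] /andP[? ?].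
  by rewrite /Y; lra.
Qed.

Lemma upper_right X T x t : X + 2 * `|xp| + Theta * T <= r -> `|x| <= X -> 0 <= t <= T ->
  xp + (sigma - alpha * D / 2) * t <= x ->
  W x t <= affine (up, fp, I - up * xp) x t + e + 2 * e * t.
Proof.
move=> rX xX tT xl; have xb : - X <= x <= X by rewrite -ler_norml.
have hx0 : - `|xp| <= xp <= `|xp| by rewrite -ler_norml.
have X0 : 0 <= X := le_trans (normr_ge0 _) xX.
have Th s : 0 <= s <= T -> [/\ 0 <= Theta * s, Theta * s <= Theta * T &
    - (Theta * s) <= (sigma - alpha * D / 2) * s].
  move=> /andP[s0 sT']; split; [by rewrite mulr_ge0|by rewrite ler_wpM2l|].
  rewrite -mulNr ler_wpM2r//; have /andP[] := characteristic_speed_right 0; exact: le_trans.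
pose Y := X + Theta * T + `|xp|.
apply: (@upper_edge up (I - up * xp) xp (sigma - alpha * D / 2) Y (- Theta) T) => //.
- by right.
- exact: characteristic_speed_right.
- move=> y s sT' l1 l2; have [q1 q2 q3] := Th _ sT'.
  rewrite ler_norml; move: hx0 => /andP[? ?]; rewrite /Y mulNr in l2.
  by apply/andP; split; lra.
- move=> y /andP[xy _]; have := ap_right app xy; rewrite ler_norml => /andP[_].
  by lra.
- have [q1 q2 q3] := Th _ tT; move: xb hx0 => /andP[? ?] /andP[? ?].
  by rewrite /Y mulNr; lra.
Qed.

End upper_bound.

Definition crossing (I : R) := (I - up * xp + um * (xm - 1)) / (um - up).

Section limit.
Variable I : R.
Let x0 := xm - 1.
Let fm := f 0 um.
Let fp := f 0 up.
Let m := (up + um) / 2.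
Let c := alpha * D ^+ 2 / 16.
Let left_state := affine (um, fm, - (um * x0)).
Let right_state := affine (up, fp, I - up * xp).
Let cr := crossing I.

(** The two states cross along the future shock line. *)
Lemma state_gap x t : left_state x t - right_state x t = D * (x - (cr + sigma * t)).
Proof.
have Dcr : D * cr = I - up * xp + um * x0 by rewrite mulrC divfK// gt_eqF.
rewrite (_ : D * _ = D * x - D * cr - sigma * D * t); last by ring.
by rewrite Dcr sigmaD /left_state /right_state /affine /= -/fm -/fp /D; ring.
Qed.

Let c0 : 0 < c. Proof. by rewrite divr_gt0// mulr_gt0// exprn_gt0. Qed.
Let aD : 0 < alpha * D / 2. Proof. by rewrite divr_gt0// mulr_gt0. Qed.

(* Low enough for the intermediate barrier to start below [W] on [[xm - 1, xp]], where only
   a crude bound of [W] is known. *)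
Let k3 := - (M * (xp - x0) + 1) - `|m| * (`|x0| + `|xp|).
(* After this time the regions of validity of the two upper bounds contain the two sides
   of the line, and the intermediate barrier is above the average of the two states. *)
Let T0 := 1 + `|cr - x0| / (alpha * D / 2) + `|cr - xp| / (alpha * D / 2)
  + (`|k3| + `|I - up * xp - um * x0|) / c.

Let T0_ge : [/\ 0 < T0, `|cr - x0| <= alpha * D / 2 * T0, `|cr - xp| <= alpha * D / 2 * T0 &
  `|k3| + `|I - up * xp - um * x0| <= c * T0].
Proof.
have p1 : 0 <= `|cr - x0| / (alpha * D / 2) by rewrite divr_ge0// ltW.
have p2 : 0 <= `|cr - xp| / (alpha * D / 2) by rewrite divr_ge0// ltW.
have p3 : 0 <= (`|k3| + `|I - up * xp - um * x0|) / c by rewrite divr_ge0 ?addr_ge0// ltW.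
split.
- by rewrite /T0; move: p1 p2 p3; lra.
- by rewrite mulrC -ler_pdivrMr// /T0; move: p1 p2 p3; lra.
- by rewrite mulrC -ler_pdivrMr// /T0; move: p1 p2 p3; lra.
- by rewrite [leRHS]mulrC -ler_pdivrMr// /T0 lerDr !addr_ge0.
Qed.

Let barrier_start (k e r : R) V G W : 0 <= e -> e <= k -> e <= 1 ->
  near_potential f up um xm xp M C v I r e V G W -> forall h1 h2 h3 x,
  exists2 b, b \in [:: (um, h1, - (um * x0) - k); (up, h2, I - up * xp - k); (m, h3, k3)] &
    affine b x 0 <= W x 0.
Proof.
move=> e0 ek e1 app h1 h2 h3 x.
have [xx0|x0x] := leP x x0.
  exists (um, h1, - (um * x0) - k); first by rewrite !inE eqxx.
  have := ap_left app xx0; rewrite /affine /= mulr0 subr0 ler_norml => /andP[+ _].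
  by rewrite -/x0; move: ek; lra.
have [xpx|xxp] := leP xp x.
  exists (up, h2, I - up * xp - k); first by rewrite !inE eqxx orbT.
  have := ap_right app xpx; rewrite /affine /= mulr0 subr0 ler_norml => /andP[+ _].
  by move: ek; lra.
exists (m, h3, k3); first by rewrite !inE eqxx !orbT.
have xx : xm - 1 <= x <= xp by rewrite (ltW x0x) (ltW xxp).
have := ap_mid app xx; rewrite /affine /= mulr0 subr0 ler_norml => /andP[+ _].
have mx : m * x <= `|m| * (`|x0| + `|xp|).
  rewrite (le_trans (ler_norm _))// normrM ler_wpM2l// ler_norml.
  have := ler_norm (- x0); have := ler_norm xp; rewrite normrN.
  have := normr_ge0 x0; have := normr_ge0 xp; move: x0x xxp => *; apply/andP; split; lra.
by rewrite /k3 -/x0; move: mx e1; lra.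
Qed.

(** Three quarters of [g] are spent below: the initial lowering of the barriers, their
    extra decay up to time [T], and the error of [lower_bound]. *)
Lemma potential_limit : exists T1, 0 < T1 /\ forall X T g, 0 < X -> T1 < T -> 0 < g ->
  exists r0 e0, [/\ 0 < r0, 0 < e0 & forall r e V G W, r0 <= r -> 0 < e -> e <= e0 ->
    near_potential f up um xm xp M C v I r e V G W ->
    forall x t, `|x| <= X -> T1 <= t <= T ->
      (x <= cr + sigma * t -> `|W x t - left_state x t| <= g) /\
      (cr + sigma * t <= x -> `|W x t - right_state x t| <= g)].
Proof.
have [T00 Tl Tr Tm] := T0_ge; exists T0; split=> // X T g X0 TT g0.
have Tpos : 0 < T := lt_trans T00 TT.
pose eps := g / 4 / T; have eps0 : 0 < eps by rewrite !divr_gt0.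
have epsT : eps * T = g / 4 by rewrite /eps divfK// gt_eqF.
have g40 : 0 < g / 4 by rewrite divr_gt0.
have [B [Ce [eta [Q [B0 be]]]]] :=
  barrier_entropy_exists f2 upum upM umM alpha0 convex Theta0 dfT eps0 stat.
pose b1 := (um, fm + eps, - (um * x0) - g / 4); pose b2 := (up, fp + eps, I - up * xp - g / 4).
pose b3 := (m, (fp + fm) / 2 - c, k3); pose bs := [:: b1; b2; b3].
have hbs b : b \in bs -> forall x z, `|z| <= M ->
    eta z * (f x z - b.1.2) + Q x z * (b.1.1 - z) <= 0.
  rewrite !inE => /or3P[/eqP->|/eqP->|/eqP->] x z zM.
  - exact: (be_fast be x zM).
  - exact: (be_slow be x zM).
  - exact: (be_mid be x zM).
have [r1 [e1 [r10 e10 lower]]] := lower_bound f2 sol fC B0 be hbs X0 Tpos g40.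
exists (Num.max r1 (X + 2 * `|x0| + 2 * `|xp| + Theta * T)),
  (Num.min (Num.min e1 1) (Num.min (g / 4) (g / (1 + 2 * T)))).
have T2 : 0 < 1 + 2 * T by rewrite ltr_wpDr// mulr_ge0// ltW.
split; [by rewrite lt_max r10|by rewrite !lt_min e10 ltr01 g40 divr_gt0|].
move=> r e V G W; rewrite ge_max => /andP[r1r Xr] e0.
rewrite !le_min => /andP[/andP[ee1 el1] /andP[eg4 eg]] app x t xX /andP[Tt tT].
have t0 : 0 < t := lt_le_trans T00 Tt.
have t0T : 0 <= t <= T by rewrite ltW.
have low := lower r e I V G W r1r ee1 app
  (barrier_start (ltW e0) eg4 el1 app _ _ _) x t xX t0T.
have mid : (left_state x t + right_state x t) / 2 <= affine b3 x t.
  have ct : c * T0 <= c * t by rewrite ler_wpM2l// ltW.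
  have n1 : - `|k3| <= k3 by rewrite lerNl -normrN ler_norm.
  have n2 := ler_norm (I - up * xp - um * x0); have n3 := normr_ge0 (I - up * xp - um * x0).
  by rewrite /left_state /right_state /affine /= /m; move: Tm ct n1 n2 n3; lra.
have et : eps * t <= g / 4 by rewrite -epsT ler_wpM2l// ltW.
have lowmin : left_state x t - g < W x t \/ right_state x t - g < W x t.
  have [b + bW] := low; rewrite !inE => /or3P[/eqP E|/eqP E|/eqP E]; rewrite E in bW.
  - by left; move: bW et g0; rewrite /affine /left_state /affine /=; lra.
  - by right; move: bW et g0; rewrite /affine /right_state /affine /=; lra.
  - have [lr|/ltW rl] := leP (left_state x t) (right_state x t).
      by left; move: bW mid lr g0; lra.
    by right; move: bW mid rl g0; lra.
have ete : e + 2 * e * t <= g.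
  apply: (@le_trans _ _ (e * (1 + 2 * T))); last by rewrite -ler_pdivlMr.
  have := ler_wpM2l (ltW e0) tT; lra.
have x00 := normr_ge0 x0; have xp0 := normr_ge0 xp.
split=> side.
- have gap : left_state x t <= right_state x t.
    by rewrite -subr_le0 state_gap pmulr_rle0// subr_le0.
  have xl : x <= x0 + (sigma + alpha * D / 2) * t.
    have at_ : alpha * D / 2 * T0 <= alpha * D / 2 * t by rewrite ler_wpM2l// ltW.
    by have := ler_norm (cr - x0); move: side Tl at_; lra.
  have rX : X + 2 * `|x0| + Theta * T <= r by apply: le_trans Xr; lra.
  have := upper_left app e0 rX xX t0T xl; rewrite -/x0 -/fm -/left_state => up1.
  rewrite ler_norml; apply/andP; split; last by move: up1 ete; lra.
  by case: lowmin => lw; move: lw gap; lra.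
- have gap : right_state x t <= left_state x t.
    by rewrite -subr_ge0 state_gap pmulr_rge0// subr_ge0.
  have xl : xp + (sigma - alpha * D / 2) * t <= x.
    have at_ : alpha * D / 2 * T0 <= alpha * D / 2 * t by rewrite ler_wpM2l// ltW.
    by have := ler_norm (xp - cr); rewrite distrC; move: side Tr at_; lra.
  have rX : X + 2 * `|xp| + Theta * T <= r by apply: le_trans Xr; lra.
  have := upper_right app e0 rX xX t0T xl; rewrite -/fp -/right_state => up1.
  rewrite ler_norml; apply/andP; split; last by move: up1 ete; lra.
  by case: lowmin => lw; move: lw gap; lra.
Qed.

End limit.

End potential_convergence.

(** * Constancy on either side of the shock *)

Section rectangle_fluxes.
Context {R : realType}.
Local Notation mu := (@lebesgue_measure R).
Local Notation mu2 := (mu \x mu)%E.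
Variables (a b c d : R).
Hypotheses (ab : a <= b) (cd : c <= d).

Let indic_rect x t : \1_(rect a b c d) (x, t) = \1_(`[a, b]) x * \1_(`[c, d]) t :> R.
Proof.
rewrite !indicE; have [xt|nxt] := boolP ((x, t) \in _).
  move: xt; rewrite inE => /rectE[xab tcd].
  by rewrite !mem_set ?mulr1//= in_itv.
have [xab|nx] := boolP (x \in _); last by rewrite mul0r.
have [tcd|nt] := boolP (t \in _); last by rewrite mulr0.
exfalso; move/negP: nxt; apply; rewrite inE; apply/rectE.
by move: xab tcd; rewrite !inE /= !in_itv.
Qed.

Let integral_indic_itv (g : R -> R) (u w : R) :
  \int[mu]_x (g x * \1_(`[u, w]) x) = \int[mu]_(x in `[u, w]) g x.
Proof.
rewrite [RHS]Rintegral_mkcond; apply: eq_Rintegral => x _.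
by rewrite patchE indicE; case: (_ \in _); rewrite ?mulr1 ?mulr0.
Qed.

Let slab (phi : R -> R) (u w K : R) : u <= w -> continuous phi ->
  (forall x, u <= x <= w -> `|phi x| <= K) -> `|\int[mu]_x (phi x * \1_(`[u, w]) x)| <= K * (w - u).
Proof.
move=> uw cphi hK.
have bI : boxed1 (\1_(`[u, w]) : R -> R).
  exists (`|u| + `|w|), 1; split; first exact: measurable_indic.
    by move=> x; rewrite indicE; case: (_ \in _); rewrite ?normr1 ?normr0.
  move=> x ux; rewrite indicE memNset//= in_itv/= => /andP[h1 h2].
  move: ux; apply/negP; rewrite -leNgt ler_norml.
  have := ler_norm (- u); have := ler_norm w; rewrite normrN => *.
  have := normr_ge0 u; have := normr_ge0 w => *; apply/andP; split; lra.
have hKI x : `|phi x * \1_(`[u, w]) x| <= K * \1_(`[u, w]) x.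
  rewrite indicE; have [|_] := boolP (x \in _); last by rewrite !mulr0 normr0.
  by rewrite inE/= in_itv/= !mulr1 => /hK.
have bKI : boxed1 (fun x => K * \1_(`[u, w]) x).
  have [r [C [m1 h1 h2]]] := bI; exists r, (`|K| * C); split.
  - exact: measurable_funM.
  - by move=> x; rewrite normrM ler_wpM2l.
  - by move=> x /h2 ->; rewrite mulr0.
have bphi : boxed1 (fun x => phi x * \1_(`[u, w]) x).
  have [r [C [m1 h1 h2]]] := bKI; exists r, C; split.
  - apply: measurable_funM; first exact: continuous_measurable_fun.
    exact: measurable_indic.
  - by move=> x; rewrite (le_trans (hKI x))// (le_trans (ler_norm _)).
  - by move=> x /h2 K0; apply/eqP; rewrite -normr_le0 -K0.
apply: (le_trans (le_normr_Rintegral _ (boxed1_integrable bphi))) => //.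
apply: (@le_trans _ _ (\int[mu]_x (K * \1_(`[u, w]) x))).
  apply: le_Rintegral => //; last exact: boxed1_integrable.
  have [r [C [m1 h1 h2]]] := bphi; apply: boxed1_integrable; exists r, C; split.
  - by apply: measurableT_comp.
  - by move=> x; rewrite normr_id.
  - by move=> x /h2 ->; rewrite normr0.
rewrite RintegralZl//; last exact: boxed1_integrable.
rewrite /Rintegral integral_indic// setIT -[X in fine X]/(mu `[u, w]) lebesgue_measure_itv/= lte_fin.
move: uw; rewrite le_eqVlt => /predU1P[->|uw]; first by rewrite ltxx/= subrr.
by rewrite uw -EFinB.
Qed.

Variables (H H' : R -> R -> R) (K : R).
Hypotheses (cH : jointly_continuous H) (cH' : jointly_continuous H').
Hypothesis HK : forall x t, a <= x <= b -> c <= t <= d -> `|H x t| <= K.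

Lemma boxed_on_rect (g : R -> R -> R) : jointly_continuous g ->
  boxed (fun p => g p.1 p.2 * \1_(rect a b c d) p).
Proof.
move=> cg; have [r [C [m1 h1 h2]]] := @boxed_rect R a b c d.
have [k k0 hk] := box_bounded r cg.
apply: boxedM; [exact: jcont_measurable|by exists r, C|].
exists k => -[x t] /= ne; have [xr tr] : `|x| <= r /\ `|t| <= r.
  by apply/boxE; apply: contrapT => nb; move/eqP: ne; apply; exact: h2.
exact: hk.
Qed.

(** A derivative integrates to a boundary term: small functions may have large derivatives,
    but these have small integrals over rectangles. *)
Lemma I2_rect_d2 : (forall x t : R, is_derive t 1 (H x) (H' x t)) ->
  `|I2 (fun p => H' p.1 p.2 * \1_(rect a b c d) p)| <= 2 * K * (b - a).
Proof.
move=> hd; rewrite I2_fubini12; last exact: boxed_on_rect.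
rewrite (_ : (fun x => _) = fun x => (H x d - H x c) * \1_(`[a, b]) x); last first.
  apply/funext => x; rewrite -(Rintegral_deriv (hd x))//; last exact: jcont_r.
  rewrite -integral_indic_itv indicE; have [xab|xab] := boolP (x \in _).
    by rewrite mulr1; apply: eq_Rintegral => t _; rewrite indic_rect indicE xab mul1r.
  rewrite mulr0 /Rintegral integral0_eq// => t _.
  by rewrite indic_rect indicE (negbTE xab) mul0r mulr0.
apply: slab => //.
  move=> x; apply: cvgB; [exact: (@jcont_l _ _ d cH)|exact: (@jcont_l _ _ c cH)].
move=> x xab; rewrite (le_trans (ler_normB _ _))// mulr_natl mulr2n.
by apply: lerD; apply: HK => //; rewrite lexx cd.
Qed.

Lemma I2_rect_d1 : (forall x t : R, is_derive x 1 (H ^~ t) (H' x t)) ->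
  `|I2 (fun p => H' p.1 p.2 * \1_(rect a b c d) p)| <= 2 * K * (d - c).
Proof.
move=> hd; rewrite I2_fubini21; last exact: boxed_on_rect.
rewrite (_ : (fun t => _) = fun t => (H b t - H a t) * \1_(`[c, d]) t); last first.
  apply/funext => t; rewrite -(Rintegral_deriv (fun x => hd x t))//; last exact: jcont_l.
  rewrite -integral_indic_itv indicE; have [tcd|tcd] := boolP (t \in _).
    by rewrite mulr1; apply: eq_Rintegral => x _; rewrite indic_rect !indicE tcd mulr1.
  rewrite mulr0 /Rintegral integral0_eq// => x _.
  by rewrite indic_rect !indicE (negbTE tcd) !mulr0.
apply: slab => //.
  move=> t; apply: cvgB; [exact: (@jcont_r _ _ b cH)|exact: (@jcont_r _ _ a cH)].
move=> t tcd; rewrite (le_trans (ler_normB _ _))// mulr_natl mulr2n.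
by apply: lerD; apply: HK => //; rewrite lexx ab.
Qed.

End rectangle_fluxes.

Section constancy.
Context {R : realType}.
Local Notation mu := (@lebesgue_measure R).
Local Notation mu2 := (mu \x mu)%E.
Variables (f : R -> R -> R) (up um xm xp M C alpha Theta : R) (v : R * R -> R).
Hypotheses (f2 : Ck 2 f) (alpha0 : 0 < alpha) (convex : forall x z, alpha <= d2 (d2 f) x z).
Hypothesis fC : forall x z, `|z| <= M -> `|f x z| <= C.
Hypothesis sol : plane_solution f up um xm xp M v.
Variables (I w k a b c d : R).
Hypothesis stat : forall x y, f x w = f y w.
Hypotheses (Theta0 : 0 <= Theta) (dfT : forall x, `|d2 f x w| <= Theta).
Hypotheses (ab : a <= b) (cd : c <= d) (c0 : 0 <= c).
Hypothesis app : forall r e, 0 < r -> 0 < e ->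
  exists V G W, near_potential f up um xm xp M C v I r e V G W.
Hypothesis lim : forall g, 0 < g -> exists r0 e0, [/\ 0 < r0, 0 < e0 &
  forall r e V G W, r0 <= r -> 0 < e -> e <= e0 ->
    near_potential f up um xm xp M C v I r e V G W ->
    forall x t, a <= x <= b -> c <= t <= d -> `|W x t - affine (w, f 0 w, k) x t| <= g].

Let d2f : Ck 1 (d2 f). Proof. by case: f2 => _ []. Qed.
Let mv := ps_measurable sol.
Let vM := ps_bound sol.
Let rho := `|a| + `|b| + `|c| + `|d| + 1.

Let rho0 : 0 < rho. Proof. by rewrite ltr_wpDl// !addr_ge0. Qed.

Let rect_box p : rect a b c d p -> box rho p.
Proof.
case: p => x t /rectE[/andP[ax xb] /andP[ct td]].
have h (y : R) : - `|y| <= y <= `|y| by rewrite -ler_norml.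
move: (h a) (h b) (h c) (h d) => /andP[? ?] /andP[? ?] /andP[? ?] /andP[? ?].
have [n1 n2] := (normr_ge0 a, normr_ge0 b); have [n3 n4] := (normr_ge0 c, normr_ge0 d).
by apply/boxE; rewrite !ler_norml /rho; split; apply/andP; split; lra.
Qed.

Let boxed_square : boxed (fun p => alpha / 2 * (v p - w) ^+ 2 * \1_(rect a b c d) p).
Proof.
apply: boxedM; [|exact: boxed_rect|].
  by apply: measurable_funM => //; apply: measurable_funX; exact: measurable_funB.
exists (alpha / 2 * (M + `|w|) ^+ 2) => p _; rewrite normrM gtr0_norm ?divr_gt0//.
rewrite ler_wpM2l ?divr_ge0 ?(ltW alpha0)// normrX ler_sqr ?nnegrE ?addr_ge0//.
  by rewrite (le_trans (ler_normB _ _))// lerD.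
exact: le_trans (normr_ge0 _) (vM (0, 0)).
Qed.

(** Convexity dominates the square of the deviation by the defect of the tangent line,
    whose integral is a boundary term in the potential. *)
Let square_small : exists K, forall g, 0 < g ->
  I2 (fun p => alpha / 2 * (v p - w) ^+ 2 * \1_(rect a b c d) p) <= K * g.
Proof.
have ca' : jointly_continuous (d1 (d2 f)) by case: d2f => _ [_ _ []].
have [A A0 hA] := box_bounded (Num.max rho `|w|) ca'.
exists (1 + Theta + 2 * (b - a) + 2 * Theta * (d - c) + A * ((b - a) * (d - c))) => g g0.
have [r0 [e0 [r00 e00 hlim]]] := lim g0.
pose r := Num.max r0 rho; have rr : 0 < r by rewrite lt_max r00.
pose e := Num.min e0 g; have e0' : 0 < e by rewrite lt_min e00.
have [V [G [W apW]]] := app rr e0'.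
have hD x t : a <= x <= b -> c <= t <= d -> `|W x t - affine (w, f 0 w, k) x t| <= g.
  by apply: (hlim r e V G W) => //; rewrite ?le_max ?ge_min lexx.
have eg : e <= g by rewrite ge_min lexx orbT.
have sV := ap_smoothV apW; have sG := ap_smoothG apW.
pose Dv x t := W x t - affine (w, f 0 w, k) x t.
pose an (x : R) (_ : R) := d2 f x w; pose an' (x : R) (_ : R) := d1 (d2 f) x w.
have cfst (h : R -> R -> R) : jointly_continuous h -> jointly_continuous (fun x _ : R => h x w).
  move=> ch p; apply: (@continuous_comp _ _ _ fst (h ^~ w)); first exact: cvg_fst.
  exact: (@jcont_l _ _ w ch).
have cD : jointly_continuous Dv.
  by apply: (@Ck_jcont _ 0); apply: CkB; [exact: ap_smooth apW 0%N|exact: Ck_affine].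
have can : jointly_continuous an := cfst _ (Ck_jcont d2f).
have can' : jointly_continuous an' := cfst _ ca'.
have cV1 : jointly_continuous (fun x t => V x t - w).
  by move=> p; apply: cvgB; [exact: (Ck_jcont (sV 0%N))|exact: cvg_cst].
have cG1 : jointly_continuous (fun x t => - G x t + f 0 w).
  by move=> p; apply: cvgD; [apply: cvgN; exact: (Ck_jcont (sG 0%N))|exact: cvg_cst].
have dD1 (x t : R) : is_derive x 1 (Dv ^~ t) (V x t - w).
  exact: derB (ap_d1 apW x t) (der1_affine _ _ _).
have dD2 (x t : R) : is_derive t 1 (Dv x) (- G x t + f 0 w).
  by apply: (der_eq (derB (ap_d2 apW x t) (der2_affine (w, f 0 w, k) x t))); rewrite opprK.
have daD (x t : R) : is_derive x 1 (fun x => an x t * Dv x t) (an x t * (V x t - w) + Dv x t * an' x t).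
  exact: derM (Ck_d1 d2f x w) (dD1 x t).
have caD := jcontM can cD; have caD' := jcontD (jcontM can cV1) (jcontM cD can').
have T1 := I2_rect_d2 ab cd cD cG1 hD dD2.
have aDK x t : a <= x <= b -> c <= t <= d -> `|an x t * Dv x t| <= Theta * g.
  by move=> xab tcd; rewrite normrM ler_pM ?dfT ?hD.
have T2 := I2_rect_d1 ab cd caD caD' aDK daD.
have T3 : I2 (fun p => Dv p.1 p.2 * an' p.1 p.2 * \1_(rect a b c d) p) <= A * g * ((b - a) * (d - c)).
  rewrite -(I2_rect ab cd) -I2Z; last exact: boxed_rect.
  apply: le_I2; [exact: (boxed_on_rect a b c d (jcontM cD can'))|apply: boxedZ; exact: boxed_rect|].
  move=> [x t]; rewrite indicE; have [|_] := boolP ((x, t) \in _); last by rewrite !mulr0.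
  rewrite inE !mulr1 => xt; have /boxE[xr _] := rect_box xt; move: xt => /rectE[xab tcd].
  rewrite (le_trans (ler_norm _))// normrM mulrC ler_pM ?hD//.
  by apply: hA; rewrite le_max ?xr ?lexx ?orbT.
have b1 := boxed_on_rect a b c d cG1; have b2 := boxed_on_rect a b c d caD'.
have b3 := boxed_on_rect a b c d (jcontM cD can').
have bF : boxed (fun p => `|flux_of f v p - G p.1 p.2| * \1_(box r) p).
  apply: (@boxed_err _ _ C _ _ _ _ _); last by move=> p; exact: ap_G apW _ _.
  - exact: flux_of_measurable (Ck_jcont f2) mv.
  - move=> p; rewrite /flux_of; case: ifPn => _; first exact: fC.
    by rewrite normr0 (le_trans _ (fC 0 (vM p))).
  - exact: jcont_measurable (Ck_jcont (sG 0%N)).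
have bv : boxed (fun p => `|v p - V p.1 p.2| * \1_(box r) p).
  apply: (@boxed_err _ _ M _ _ _ _ _) => //; last by move=> p; exact: ap_V apW _ _.
  exact: jcont_measurable (Ck_jcont (sV 0%N)).
have L1 := ap_L1F apW; have L2 := ler_wpM2l Theta0 (ap_L1v apW).
pose R1 (p : R * R) := `|flux_of f v p - G p.1 p.2| * \1_(box r) p
  + Theta * (`|v p - V p.1 p.2| * \1_(box r) p).
pose R2 (p : R * R) := (Dv p.1 p.2 * an' p.1 p.2 * \1_(rect a b c d) p
    - (- G p.1 p.2 + f 0 w) * \1_(rect a b c d) p)
    - (an p.1 p.2 * (V p.1 p.2 - w) + Dv p.1 p.2 * an' p.1 p.2) * \1_(rect a b c d) p.
have bR1 : boxed R1 by apply: boxedD => //; exact: boxedZ.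
have bR2 : boxed R2 by apply: boxedB => //; exact: boxedB.
have main : I2 (fun p => alpha / 2 * (v p - w) ^+ 2 * \1_(rect a b c d) p) <= I2 R1 + I2 R2.
  rewrite -I2D//; apply: le_I2 => //; first exact: boxedD.
  move=> [x t]; rewrite /R1 /R2 /= [\1_(rect a b c d) _]indicE.
  have [|_] := boolP ((x, t) \in _); last first.
    by rewrite !mulr0 !subr0 addr0 addr_ge0// !mulr_ge0// indicE.
  rewrite inE => xt; have bx := rect_box xt; move: xt => /rectE[xab /andP[ct td]].
  have t0 : 0 <= t := le_trans c0 ct.
  rewrite indicE mem_set; last by apply: box_mono bx; rewrite le_max lexx orbT.
  rewrite !mulr1 /flux_of /= t0.
  have := convex_tangent w (v (x, t)) (Ck_d2 (CkS f2) x) (Ck_d2 d2f x) (convex x).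
  rewrite (stat x 0) /an => tan.
  have n1 := ler_norm (f x (v (x, t)) - G x t).
  have n2 : - (d2 f x w * (v (x, t) - V x t)) <= Theta * `|v (x, t) - V x t|.
    by rewrite (le_trans (ler_norm _))// normrN normrM ler_wpM2r.
  by move: tan n1 n2; lra.
apply: (le_trans main).
rewrite /R1 I2D//; last exact: boxedZ.
rewrite I2Z// /R2 I2B//; last exact: boxedB.
rewrite I2B//.
move: T1 T2; rewrite !ler_norml => /andP[T1 _] /andP[T2 _].
have L2' : Theta * e <= Theta * g by rewrite ler_wpM2l.
move: T1 T2 T3 L1 L2 L2' eg.
move: (I2 _) (I2 _) (I2 _) (I2 _) (I2 _) => *; lra.
Qed.

Lemma constant_on_rect : {ae mu2, forall p, rect a b c d p -> v p = w}.
Proof.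
have [K hK] := square_small.
have S0 : I2 (fun p => alpha / 2 * (v p - w) ^+ 2 * \1_(rect a b c d) p) = 0.
  apply/eqP; rewrite eq_le; apply/andP; split; last first.
    by apply: I2_ge0 => p; rewrite mulr_ge0// mulr_ge0 ?sqr_ge0// divr_ge0// ltW.
  apply/ler_addgt0Pr => g g0; rewrite add0r.
  have K1 : 0 < `|K| + 1 by rewrite ltr_wpDl.
  apply: (le_trans (hK (g / (`|K| + 1)) _)); first by rewrite divr_gt0.
  rewrite mulrCA ler_piMr ?(ltW g0)// ler_pdivrMr// mul1r.
  by rewrite (le_trans (ler_norm _))// lerDl.
have := boxed_integrable boxed_square; set h := (X in EFin \o X) => ih.
have h0 p : 0 <= h p.
  by rewrite mulr_ge0 ?indicE// mulr_ge0 ?sqr_ge0// divr_ge0// ltW.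
have E : (\int[mu2]_p `|(EFin \o h) p| = 0)%E.
  have -> : (fun p => `|(EFin \o h) p|%E) = EFin \o h.
    by apply/funext => p /=; rewrite ger0_norm.
  have fin := integrable_fin_num measurableT ih.
  by rewrite -[LHS]fineK//; congr EFin; exact: S0.
have /integrableP[mh _] := ih.
have := (ae_eq_integral_abs mu2 measurableT mh).1 E.
apply: ae2_imp => p /(_ Logic.I) /= hp rp; have {hp} : h p = 0 by case: hp.
have a20 : 0 < alpha / 2 by rewrite divr_gt0.
rewrite /h indicE mem_set// mulr1 => /eqP.
by rewrite mulf_eq0 gt_eqF//= sqrf_eq0 subr_eq0 => /eqP.
Qed.

End constancy.

(** * Null sets, rectangles and slices *)

Section null_sets.
Context {R : realType}.
Local Notation mu := (@lebesgue_measure R).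
Local Notation mu2 := (mu \x mu)%E.

(** A null set of the plane has null sections, by Tonelli. *)
Lemma ae_slices (P : R * R -> Prop) : {ae mu2, forall p, P p} ->
  {ae mu, forall t, {ae mu, forall x, P (x, t)}}.
Proof.
move=> [N [mN N0 sub]].
have mf : measurable_fun setT (EFin \o \1_N : R * R -> \bar R).
  by apply/measurable_EFinP; exact: measurable_indic.
have f0 (p : R * R) : (0 <= (EFin \o (\1_N : R * R -> R)) p)%E by rewrite lee_fin indicE.
have := @fubini_tonelli2 _ _ _ _ _ mu mu _ mf f0.
have -> : (\int[mu2]_z (EFin \o \1_N) z = 0)%E by rewrite integral_indic// setIT.
have mG := @measurable_fun_fubini_tonelli_G _ _ _ _ _ mu _ mf f0.
move=> /esym G0.
have : (\int[mu]_y `|fubini_G mu (EFin \o \1_N) y| = 0)%E.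
  by rewrite -[RHS]G0; apply: eq_integral => y _; rewrite gee0_abs// integral_ge0.
move=> /(ae_eq_integral_abs mu measurableT mG).1; apply: ae_imp => t /(_ Logic.I) /=.
rewrite /fubini_G => Gt; exists (ysection N t); split; first exact: measurable_ysection.
  rewrite -(setIT (ysection N t)) -integral_indic//; last exact: measurable_ysection.
  rewrite -[RHS]Gt; apply: eq_integral => x _ /=; rewrite !indicE; congr (_%:R)%:E.
  by congr nat_of_bool; apply/idP/idP; rewrite mem_ysection !inE.
by move=> x /= nP; rewrite /ysection/= inE; exact: sub.
Qed.

Lemma ae_of_rects (O : set (R * R)) (P : R * R -> Prop) : open O ->
  (forall a b c d, a <= b -> c <= d -> rect a b c d `<=` O ->
    {ae mu2, forall p, rect a b c d p -> P p}) ->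
  {ae mu2, forall p, O p -> P p}.
Proof.
move=> oO h.
pose S (n : nat) (p : R * R) := forall q : (rat * rat) * (rat * rat), unpickle n = Some q ->
  ratr q.1.1 <= ratr q.1.2 :> R -> ratr q.2.1 <= ratr q.2.2 :> R ->
  rect (ratr q.1.1) (ratr q.1.2) (ratr q.2.1) (ratr q.2.2) `<=` O ->
  rect (ratr q.1.1) (ratr q.1.2) (ratr q.2.1) (ratr q.2.2) p -> P p.
have hS n : {ae mu2, forall p, S n p}.
  rewrite /S; case: unpickle => [q|]; last by apply: aeW.
  have [ab|nab] := pselect (ratr q.1.1 <= ratr q.1.2 :> R); last first.
    by apply: aeW => p _ [<-].
  have [cd|ncd] := pselect (ratr q.2.1 <= ratr q.2.2 :> R); last first.
    by apply: aeW => p _ [<-].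
  have [rO|nrO] := pselect (rect (ratr q.1.1) (ratr q.1.2) (ratr q.2.1) (ratr q.2.2) `<=` O); last first.
    by apply: aeW => p _ [<-].
  by move: (h _ _ _ _ ab cd rO); apply: ae2_imp => p hp _ [<-].
have := ae_foralln hS; apply: ae2_imp => -[x t] hp Oxt.
have /nbhs_ballP[e /= e0 he] := open_nbhs_nbhs (conj oO Oxt).
have lt_e (y : R) : y - e < y /\ y < y + e by rewrite ltrDl ltrBlDr ltrDl.
have [[x1 x2] [t1 t2]] := (lt_e x, lt_e t).
have [q1 q1x] := rat_in_itvoo x1; have [q2 q2x] := rat_in_itvoo x2.
have [q3 q3t] := rat_in_itvoo t1; have [q4 q4t] := rat_in_itvoo t2.
move: q1x q2x q3t q4t; rewrite !in_itv/= => /andP[a1 a2] /andP[b1 b2] /andP[c1 c2] /andP[d1 d2].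
have := hp (pickle ((q1, q2), (q3, q4))) ((q1, q2), (q3, q4)) (pickleK _) => /=.
apply; [exact: ltW (lt_trans a2 b1)|exact: ltW (lt_trans c2 d1)| |].
  move=> [y s] /rectE[/andP[y1 y2] /andP[s1 s2]]; apply: he; split; rewrite /ball/= ltr_norml.
    by apply/andP; split; [rewrite ltrBrDr addrC -ltrBrDr opprK (le_lt_trans y2)|rewrite ltrBlDr addrC -ltrBlDr (lt_le_trans a1)].
  by apply/andP; split; [rewrite ltrBrDr addrC -ltrBrDr opprK (le_lt_trans s2)|rewrite ltrBlDr addrC -ltrBlDr (lt_le_trans c1)].
by apply/rectE; rewrite !ltW.
Qed.

End null_sets.

(** * The shock *)

Section bounds.
Context {R : realType}.
Variables (f : R -> R -> R) (up um : R).
Hypothesis hf : flux_assumptions f up um.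

Lemma stationary_flux w x y : w = um \/ w = up -> f x w = f y w.
Proof.
have [_ hp hm] := flux_S hf; move=> hw.
have hd (z : R) : is_derive z 1 (f ^~ w) 0.
  have := Ck_d1 (CkS (flux_C2 hf)) z w.
  by have -> : d1 f z w = 0 by case: hw => ->.
exact: (derive0_cst hd).
Qed.

Lemma speed_bounded M : 0 <= M -> exists2 Theta, 0 <= Theta &
  forall x z, `|z| <= M -> `|d2 f x z| <= Theta.
Proof.
move=> M0; have [hub cspeed] := flux_FSP hf.
have MM : - M <= M by rewrite (le_trans _ M0)// oppr_le0.
have [c _ hc] := EVT_max MM (continuous_subspaceT cspeed).
have le_speed x z : `|d2 f x z| <= max_speed f z.
  by apply: ub_le_sup; [exact: hub|exists x].
exists (max_speed f c) => [|x z zM]; first exact: le_trans (normr_ge0 _) (le_speed 0 c).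
by rewrite (le_trans (le_speed x z))// hc// in_itv/= -ler_norml.
Qed.

Lemma flux_bounded M Theta : `|um| <= M -> 0 <= Theta ->
  (forall x z, `|z| <= M -> `|d2 f x z| <= Theta) ->
  exists C, forall x z, `|z| <= M -> `|f x z| <= C.
Proof.
move=> umM T0 dfT; exists (Theta * (2 * M) + `|f 0 um|) => x z zM.
rewrite -(stationary_flux x 0 (or_introl erefl)).
rewrite -[X in `|X|](subrK (f x um)) (le_trans (ler_normD _ _))// lerD2r.
apply: (@le_trans _ _ (Theta * `|z - um|)).
  apply: (derive_norm_le (Ck_d2 (CkS (flux_C2 hf)) x)) => s /andP[].
  rewrite ge_min le_max => s1 s2; apply: dfT.
  move: umM zM; rewrite !ler_norml => /andP[? ?] /andP[? ?].
  by apply/andP; split; [case/orP: s1 => /(le_trans _); exact|case/orP: s2 => /le_trans; exact].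
by rewrite ler_wpM2l// (le_trans (ler_normB _ _))// mulr_natl mulr2n lerD.
Qed.

End bounds.

Section plane_shock.
Context {R : realType}.
Local Notation mu := (@lebesgue_measure R).
Local Notation mu2 := (mu \x mu)%E.
Variables (f : R -> R -> R) (up um xm xp M : R) (v : R * R -> R).
Hypotheses (hf : flux_assumptions f up um) (hx : xm < xp).
Hypotheses (umM : `|um| <= M) (upM : `|up| <= M).
Hypothesis sol : plane_solution f up um xm xp M v.

Lemma plane_shock : exists X T, 0 < T /\
  {ae mu2, forall p, T < p.2 ->
    (p.1 < X + shock_speed f up um * p.2 -> v p = um) /\
    (X + shock_speed f up um * p.2 < p.1 -> v p = up)}.
Proof.
have [upum _ _] := flux_S hf; have [alpha alpha0 convex] := flux_UC hf.
have f2 := flux_C2 hf; have stat := stationary_flux hf.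
have M0 : 0 <= M := le_trans (normr_ge0 _) umM.
have [ Theta Theta0 dfT] := speed_bounded hf M0.
have [C fC] := flux_bounded hf umM Theta0 dfT.
have convex0 x z : 0 <= d2 (d2 f) x z by rewrite (le_trans _ (convex x z))// ltW.
have [I app] := near_potential_exists f2 hx umM upM fC convex0 sol stat.
have [T1 [T10 lim]] := potential_limit f2 upum upM umM fC alpha0 convex Theta0 dfT stat sol I.
set cr := crossing _ _ _ _ _ in lim.
set sigma := shock_speed f up um in lim *.
exists cr, T1; split=> //.
have jg : jointly_continuous (fun x t : R => cr + sigma * t - x).
  apply: (@Ck_jcont _ 0); apply: CkB; last exact: Ck_fst.
  by apply: CkD; [exact: Ck_cst|apply: CkM; [exact: Ck_cst|exact: Ck_snd]].
have opos (g : R -> R -> R) : jointly_continuous g -> open [set p : R * R | 0 < g p.1 p.2].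
  move=> cg; rewrite (_ : [set p | _] = (fun p : R * R => g p.1 p.2) @^-1` [set z | 0 < z])//.
  by apply: open_comp => [p _|]; [exact: cg|exact: open_gt].
have jT : jointly_continuous (fun _ t : R => t - T1).
  by apply: (@Ck_jcont _ 0); apply: CkB; [exact: Ck_snd|exact: Ck_cst].
have jNg : jointly_continuous (fun x t : R => x - (cr + sigma * t)).
  apply: (@Ck_jcont _ 0); apply: CkB; first exact: Ck_fst.
  by apply: CkD; [exact: Ck_cst|apply: CkM; [exact: Ck_cst|exact: Ck_snd]].
have lft := ae_of_rects (P := fun p => v p = um) (openI (opos _ jT) (opos _ jg)) _.
have rgt := ae_of_rects (P := fun p => v p = up) (openI (opos _ jT) (opos _ jNg)) _.
have bigger (a b c d : R) : a <= b -> c <= d -> exists X T, [/\ 0 < X, T1 < T &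
    forall x t, a <= x <= b -> c <= t <= d -> `|x| <= X /\ t <= T].
  move=> ab cd; exists (`|a| + `|b| + 1), (Num.max T1 d + 1); split.
  - by rewrite ltr_wpDl// addr_ge0.
  - by rewrite (le_lt_trans (y := Num.max T1 d))// ?le_max ?lexx// ltrDl.
  move=> x t /andP[ax xb] /andP[_ td]; split; last first.
    by rewrite (le_trans td)// (le_trans (y := Num.max T1 d))// ?le_max ?lexx ?orbT// lerDl.
  have := ler_norm (- a); have := ler_norm b; rewrite normrN ler_norml.
  have := normr_ge0 a; have := normr_ge0 b => *; apply/andP; split; lra.
have {}lft : {ae mu2, forall p, T1 < p.2 -> p.1 < cr + sigma * p.2 -> v p = um}.
  have : {ae mu2, forall p : R * R, ([set p | 0 < p.2 - T1] `&` [set p | 0 < cr + sigma * p.2 - p.1]) p -> v p = um}.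
    apply: lft => a b c d ab cd sub.
    have /sub[] : rect a b c d (a, c) by apply/rectE; rewrite !lexx ab cd.
    rewrite /= subr_gt0 => T1c _.
    apply: (@constant_on_rect _ f up um xm xp M C alpha Theta v f2 alpha0 convex fC sol I um
      (- (um * (xm - 1)))) => //.
    - by move=> x y; apply: stat; left.
    - by move=> x; exact: dfT.
    - exact: le_trans (ltW T10) (ltW T1c).
    - move=> g g0; have [X [T [X0 TT hXT]]] := bigger _ _ _ _ ab cd.
      have [r0 [e0 [r00 e00 h]]] := lim X T g X0 TT g0.
      exists r0, e0; split => // r e V G W r0r e0' ee0 aW x t xab tcd.
      have [xX tT] := hXT x t xab tcd; have /andP[ct td] := tcd.
      have T1t : T1 <= t <= T by rewrite tT (le_trans (ltW T1c) ct).
      apply: (h r e V G W r0r e0' ee0 aW x t xX T1t).1.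
      by have /sub[_] /= : rect a b c d (x, t) by []; rewrite subr_gt0 => /ltW.
  by apply: ae2_imp => p hp p2 p1; apply: hp; split; rewrite /= subr_gt0.
have {}rgt : {ae mu2, forall p, T1 < p.2 -> cr + sigma * p.2 < p.1 -> v p = up}.
  have : {ae mu2, forall p : R * R, ([set p | 0 < p.2 - T1] `&` [set p | 0 < p.1 - (cr + sigma * p.2)]) p -> v p = up}.
    apply: rgt => a b c d ab cd sub.
    have /sub[] : rect a b c d (a, c) by apply/rectE; rewrite !lexx ab cd.
    rewrite /= subr_gt0 => T1c _.
    apply: (@constant_on_rect _ f up um xm xp M C alpha Theta v f2 alpha0 convex fC sol I up
      (I - up * xp)) => //.
    - by move=> x y; apply: stat; right.
    - by move=> x; exact: dfT.
    - exact: le_trans (ltW T10) (ltW T1c).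
    - move=> g g0; have [X [T [X0 TT hXT]]] := bigger _ _ _ _ ab cd.
      have [r0 [e0 [r00 e00 h]]] := lim X T g X0 TT g0.
      exists r0, e0; split => // r e V G W r0r e0' ee0 aW x t xab tcd.
      have [xX tT] := hXT x t xab tcd; have /andP[ct td] := tcd.
      have T1t : T1 <= t <= T by rewrite tT (le_trans (ltW T1c) ct).
      apply: (h r e V G W r0r e0' ee0 aW x t xX T1t).2.
      by have /sub[_] /= : rect a b c d (x, t) by []; rewrite subr_gt0 => /ltW.
  by apply: ae2_imp => p hp p2 p1; apply: hp; split; rewrite /= subr_gt0.
apply: (@filterS2 _ _ (ae_filter_ringOfSetsType mu2) _ _ _ _ lft rgt) => p h1 h2 p2.
by split; [exact: h1|exact: h2].
Qed.

End plane_shock.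

Section slices.
Context {R : realType}.
Local Notation mu := (@lebesgue_measure R).

(** Intervals are not negligible: a property that holds almost everywhere can be had
    arbitrarily close to a given point. *)
Lemma ae_near (P : R -> Prop) (Q : set R) (t : R) : {ae mu, forall s, P s} ->
  (\forall s \near t, Q s) -> exists s, P s /\ Q s.
Proof.
move=> [N [mN N0 sub]] /nbhs_ballP[e /= e0 he]; apply: contrapT => no.
have ballN : `[t - e / 2, t + e / 2] `<=` N.
  move=> s /=; rewrite in_itv/= => /andP[s1 s2]; apply: sub => /= Ps; apply: no; exists s.
  split=> //; apply: he; rewrite /ball/= ltr_norml.
  by move: s1 s2 e0 => *; apply/andP; split; lra.
have : (mu `[(t - e / 2)%R, (t + e / 2)%R] <= mu N)%E by apply: le_measure => //; rewrite inE.
rewrite [in leRHS]N0 lebesgue_measure_itv/= lte_fin ifT; last by move: e0; lra.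
by rewrite -EFinB lee_fin leNgt; move: e0 => ?; lra.
Qed.

Lemma ae_of_itvs (O : set R) (P : R -> Prop) : open O ->
  (forall a b, a <= b -> `[a, b] `<=` O -> {ae mu, forall x, a <= x <= b -> P x}) ->
  {ae mu, forall x, O x -> P x}.
Proof.
move=> oO h.
pose S (n : nat) (x : R) := forall q : rat * rat, unpickle n = Some q ->
  ratr q.1 <= ratr q.2 :> R -> `[ratr q.1, ratr q.2] `<=` O ->
  ratr q.1 <= x <= ratr q.2 -> P x.
have hS n : {ae mu, forall x, S n x}.
  rewrite /S; case: unpickle => [q|]; last by apply: aeW.
  have [ab|nab] := pselect (ratr q.1 <= ratr q.2 :> R); last by apply: aeW => x _ [<-].
  have [rO|nrO] := pselect (`[ratr q.1, ratr q.2] `<=` O); last by apply: aeW => x _ [<-].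
  by move: (h _ _ ab rO); apply: ae_imp => x hx _ [<-].
have := ae_foralln hS; apply: ae_imp => x hx Ox.
have /nbhs_ballP[e /= e0 he] := open_nbhs_nbhs (conj oO Ox).
have x1 : x - e < x by rewrite ltrBDr ltrDl.
have x2 : x < x + e by rewrite ltrDl.
have [q1 q1x] := rat_in_itvoo x1; have [q2 q2x] := rat_in_itvoo x2.
move: q1x q2x; rewrite !in_itv/= => /andP[a1 a2] /andP[b1 b2].
have := hx (pickle (q1, q2)) (q1, q2) (pickleK _) => /=.
apply; [exact: ltW (lt_trans a2 b1)| |by rewrite !ltW].
move=> y /=; rewrite in_itv/= => /andP[y1 y2]; apply: he; rewrite /ball/= ltr_norml.
by apply/andP; split; [rewrite ltrBrDr addrC -ltrBrDr opprK (le_lt_trans y2)|rewrite ltrBlDr addrC -ltrBlDr (lt_le_trans a1)].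
Qed.

(** A constant value taken on an interval at almost all nearby times persists at a
    time of continuity. *)
Lemma slice_limit (u : R -> R -> R) (t w a b : R) (P : R -> Prop) : 0 < t -> a <= b ->
  (forall s, 0 <= s -> measurable_fun setT (u ^~ s)) ->
  L1loc_continuous_at u t -> {ae mu, forall s, P s} ->
  (\forall s \near t, P s -> {ae mu, forall x, a <= x <= b -> u x s = w}) ->
  {ae mu, forall x, a <= x <= b -> u x t = w}.
Proof.
move=> t0 ab mu_ hc aeP near.
have mt := mu_ t (ltW t0).
have mabs : measurable_fun `[a, b] (fun x => (`|u x t - w|)%:E).
  apply/measurable_EFinP; apply: measurable_funTS; apply: measurableT_comp => //.
  exact: measurable_funB.
pose L := `|a| + `|b|.
have sub : `[a, b] `<=` `[- L, L].
  move=> x /=; rewrite !in_itv/= => /andP[xa xb].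
  have := ler_norm (- a); have := ler_norm b; rewrite normrN /L.
  have := normr_ge0 a; have := normr_ge0 b => *; apply/andP; split; lra.
have small e : 0 < e -> (\int[mu]_(x in `[a, b]) (`|u x t - w|)%:E <= e%:E)%E.
  move=> e0; have le0 : (0 < e%:E)%E by rewrite lte_fin.
  have nc : \forall s \near t, (\int[mu]_(x in `[(- L)%R, L]) (`|u x s - u x t|)%:E < e%:E)%E.
    exact: (hc L [set y | (y < e%:E)%E] (open_ereal_lt' le0)).
  have n0 : \forall s \near t, 0 < s by exact: (lt_nbhsr t0).
  have [s [Ps [[hs Is] s0]]] := ae_near aeP (filterI (filterI near nc) n0).
  have ms := mu_ s (ltW s0).
  have mst : measurable_fun `[- L, L] (fun x => (`|u x s - u x t|)%:E).
    apply/measurable_EFinP; apply: measurable_funTS; apply: measurableT_comp => //.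
    exact: measurable_funB.
  have -> : (\int[mu]_(x in `[a, b]) (`|u x t - w|)%:E =
      \int[mu]_(x in `[a, b]) (`|u x s - u x t|)%:E)%E.
    apply: ae_eq_integral => //; first exact: (measurable_funS _ sub mst).
    move: (hs Ps); apply: ae_imp => x hx /=; rewrite in_itv/= => xab.
    by rewrite (hx xab) distrC.
  by apply: (le_trans _ (ltW Is)); exact: ge0_subset_integral.
have I0 : (\int[mu]_(x in `[a, b]) `|(`|u x t - w|)%:E| = 0)%E.
  have -> : (fun x => `|(`|u x t - w|)%:E|%E) = (fun x => (`|u x t - w|)%:E).
    by apply/funext => x; rewrite gee0_abs.
  apply/eqP; rewrite eq_le; apply/andP; split; last exact: integral_ge0.
  by apply/lee_addgt0Pr => e e0; rewrite add0e small.
have := (ae_eq_integral_abs mu (measurable_itv _) mabs).1 I0; apply: ae_imp => x hx xab.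
have xI : [set` `[a, b]] x by rewrite /= in_itv.
by case: (hx xI) => /eqP; rewrite normr_eq0 subr_eq0 => /eqP.
Qed.

End slices.

(* [u] is an arbitrary representative of its class in L^oo(R x [0, +oo[), for
   which an individual slice [u ^~ t] may be meaningless: the conclusion holds
   for almost every t > T in general, and for every t > T at which
   s |-> u(., s) is L^1_loc-continuous; for the representative of u in
   C(]0, +oo[; L^1_loc), this is every t > T. *)
Theorem theorem2p1 (R : realType) (f : R -> R -> R) (up um : R)
    (hf : flux_assumptions f up um)
    (xm xp : R) (hx : xm < xp)
    (u0 : R -> R)
    (hu0 : u0 \in Lfun (@lebesgue_measure R) +oo%E)
    (hu0m : {ae @lebesgue_measure R, forall x, x < xm -> u0 x = um})
    (hu0p : {ae @lebesgue_measure R, forall x, xp < x -> u0 x = up})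
    (u : R -> R -> R) (hu : entropy_solution f u0 u) :
  exists X T : R,
    [/\ 0 < T,
        {ae @lebesgue_measure R, forall t, T < t ->
           is_shock um up (X + shock_speed f up um * (t - T)) (u ^~ t)} &
        forall t, T < t -> L1loc_continuous_at u t ->
           is_shock um up (X + shock_speed f up um * (t - T)) (u ^~ t)].
Proof.
have [M [v [M0 umM upM sol uv]]] := plane_solution_exists (flux_C2 hf) hx hu0 hu0m hu0p hu.
have [X0 [T [T0 shock]]] := plane_shock hf hx umM upM sol.
set sigma := shock_speed f up um in shock *.
exists (X0 + sigma * T), T.
have pos t : X0 + sigma * T + sigma * (t - T) = X0 + sigma * t by ring.
have good : {ae @lebesgue_measure R, forall t, T < t -> is_shock um up (X0 + sigma * t) (u ^~ t)}.
  have := @filterS2 _ _ (ae_filter_ringOfSetsType _) _ _ _ _ uv shock.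
  move=> /(_ (fun p => T < p.2 -> (p.1 < X0 + sigma * p.2 -> u p.1 p.2 = um) /\
    (X0 + sigma * p.2 < p.1 -> u p.1 p.2 = up))) H.
  have /ae_slices : {ae (@lebesgue_measure R \x @lebesgue_measure R)%E, forall p : R * R,
      T < p.2 -> (p.1 < X0 + sigma * p.2 -> u p.1 p.2 = um) /\
      (X0 + sigma * p.2 < p.1 -> u p.1 p.2 = up)}.
    apply: H => p h1 h2 p2; have := h2 p2; rewrite h1//.
    by rewrite /half_plane/= (ltW (lt_trans T0 p2)).
  by apply: ae_imp => t ht Tt; move: ht; apply: ae_imp => x /(_ Tt).
have [mw _] := Lfun_ae_bounded (entropy_solution_bounded hu).
have slices s : 0 <= s -> measurable_fun setT (u ^~ s).
  move=> s0; rewrite (_ : u ^~ s = (fun x => ((fun p : R * R => u p.1 p.2) \_ half_plane) (x, s))).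
    by apply: (measurableT_comp mw); exact: measurable_fun_pair.
  by apply/funext => x; rewrite patchE mem_set.
split => // [|t Tt ct]; first by move: good; apply: ae_imp => t; rewrite pos.
rewrite pos; have t0 := lt_trans T0 Tt.
have cpos : continuous (fun s => X0 + sigma * s).
  move=> s; apply: cvgD; first exact: cvg_cst.
  by apply: cvgM; [exact: cvg_cst|exact: cvg_id].
have nT : \forall s \near t, T < s by exact: (lt_nbhsr Tt).
have lft : {ae @lebesgue_measure R, forall x, [set y | y < X0 + sigma * t] x -> u x t = um}.
  apply: ae_of_itvs; first exact: open_lt.
  move=> a b ab sub; apply: (slice_limit t0 ab slices ct good).
  have bt : b < X0 + sigma * t by apply: sub; rewrite /= in_itv/= ab lexx.
  have nb : \forall s \near t, b < X0 + sigma * s by exact: (cpos t _ (lt_nbhsr bt)).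
  apply: filterS2 nT nb => s Ts bs /(_ Ts); apply: ae_imp => x [h _] /andP[_ xb].
  by apply: h; exact: le_lt_trans bs.
have rgt : {ae @lebesgue_measure R, forall x, [set y | X0 + sigma * t < y] x -> u x t = up}.
  apply: ae_of_itvs; first exact: open_gt.
  move=> a b ab sub; apply: (slice_limit t0 ab slices ct good).
  have at_ : X0 + sigma * t < a by apply: sub; rewrite /= in_itv/= ab lexx.
  have na : \forall s \near t, X0 + sigma * s < a by exact: (cpos t _ (lt_nbhsl at_)).
  apply: filterS2 nT na => s Ts as_ /(_ Ts); apply: ae_imp => x [_ h] /andP[ax _].
  by apply: h; exact: lt_le_trans ax.
by apply: (@filterS2 _ _ (ae_filter_ringOfSetsType _) _ _ _ _ lft rgt) => x h1 h2.
Qed.
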